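(* (i) Let $T\subset\mathbb{R}^d$ be compact, let $X=(X(t),\,t\in T)$ be a real-valued centered Gaussian random field with continuous sample paths and covariance $R_X(s,t)=\mathrm{Cov}(X(s),X(t))$, and let $a\ne b\in T$ be such that $T$ contains a path from $a$ to $b$. With $\Psi_{a,b}(u)$ and $C_X(a,b)$ as defined below, $$\lim_{u\to\infty}\frac1{u^2}\log\Psi_{a,b}(u)=-\frac12C_X(a,b)=-\frac12\Big[\sup_{\xi}\ \min_{\mu\in M_1^+([0,1])}\int_0^1\!\!\int_0^1R_X(\xi(u),\xi(v))\,\mu(du)\,\mu(dv)\Big]^{-1},$$ where the supremum is over $\xi\in\mathcal{P}(a,b)$ with $\xi([0,1])\subset T$. (ii) Let $X=(X(t),\,t\in\mathbb{R}^d)$ be a real-valued centered stationary Gaussian random field with continuous sample paths, covariance $R_X(t)=\mathrm{Cov}(X(0),X(t))$ satisfying $\limsup_{\|t\|\to\infty}R_X(t)\le0$, and let $a\ne0$. With $\Psi_a(u)$ and $C_X(a)$ as defined below, $$\lim_{u\to\infty}\frac1{u^2}\log\Psi_{a}(u)=-\frac12C_X(a)=-\frac12\Big[\sup_{\xi\in\mathcal{P}(0,a)}\ \min_{\mu\in M_1^+([0,1])}\int_0^1\!\!\int_0^1R_X(\xi(u)-\xi(v))\,\mu(du)\,\mu(dv)\Big]^{-1}.$$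
   Context: $\mathcal{P}(a,b)$ is the set of continuous $\xi:[0,1]\to\mathbb{R}^d$ with $\xi(0)=a,\xi(1)=b$; $M_1^+([0,1])$ is the set of Borel probability measures on $[0,1]$. $\Psi_{a,b}(u)=P(\exists\,\xi\in\mathcal{P}(a,b):\ \xi(v)\in T,\ X(\xi(v))>u\ \forall v\in[0,1])$ and $\Psi_a(u)=P(\exists\,\xi\in\mathcal{P}(0,a):\ X(\xi(v))>u\ \forall v\in[0,1])$. $\mathcal{L}$ is the $L^2(P)$-closure of finite linear combinations of values $X(t)$, and $w_H(t)=E(X(t)H)$. $C_X(a,b)=\inf\{EH^2: H\in\mathcal{L},\ \exists\,\xi\in\mathcal{P}(a,b)$ with $\xi(v)\in T$, $w_H(\xi(v))>1\ \forall v\}$. In the stationary case, $F_X$ is the spectral measure ($R_X(t)=\int e^{i(t,x)}F_X(dx)$) and $C_X(a)=\inf\{\int|h|^2dF_X: h\in L^2(F_X)$ with even real and odd imaginary part, $\exists\,\xi\in\mathcal{P}(0,a)$ with $\int e^{i(\xi(v),x)}\overline{h(x)}F_X(dx)>1\ \forall v\}$. Conventions: $\inf\emptyset=+\infty$, $0^{-1}=+\infty$. *)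

(* Defs.v *)
From HB Require Import structures.
From mathcomp Require Import all_boot all_order all_algebra.
From mathcomp Require Import all_classical all_reals all_analysis.

Set Implicit Arguments.
Unset Strict Implicit.
Unset Printing Implicit Defensive.

Import Order.TTheory GRing.Theory Num.Def Num.Theory.
Import numFieldTopology.Exports.

Local Open Scope classical_set_scope.
Local Open Scope ring_scope.

Definition I01 {R : realType} : set R := `[0%R, 1%R]%classic.

Section GaussDefs.
Context {R : realType} {d : nat}.
Local Notation V := 'rV[R]_d.

Definition dotR (t x : V) : R := \sum_(i < d) t ord0 i * x ord0 i.

Definition is_path (xi : R -> V) (a b : V) : Prop :=
  {within I01, continuous xi} /\ xi 0 = a /\ xi 1 = b.

Definition path_in (T : set V) (xi : R -> V) (a b : V) : Prop :=
  is_path xi a b /\ xi @` I01 `<=` T.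

Definition BorelV := g_sigma_algebraType (@open V).

Context {dO : measure_display} {Omega : measurableType dO}
  (P : probability Omega R).

Definition lin_comb (X : V -> Omega -> R) (s : seq (V * R)) : Omega -> R :=
  fun w => \sum_(p <- s) p.2 * X p.1 w.

Definition centered_gaussian (Y : Omega -> R) : Prop :=
  measurable_fun setT Y /\
  exists s : R, 0 <= s /\
    forall A : set R, measurable A ->
      P (Y @^-1` A) = (if s == 0 then \d_(0 : R) A else normal_prob 0 s A).

Definition centered_gaussian_field (T : set V) (X : V -> Omega -> R) : Prop :=
  forall s : seq (V * R), (forall p, p \in s -> T p.1) ->
    centered_gaussian (lin_comb X s).

(** Covariance E[X(s) X(t)] (the field is centered). *)
Definition cov (X : V -> Omega -> R) (s t : V) : R :=
  fine (\int[P]_w (X s w * X t w)%:E)%E.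

Definition sq_integrable (H : Omega -> R) : Prop :=
  measurable_fun setT H /\ (\int[P]_w ((H w) ^+ 2)%:E < +oo)%E.

Definition in_L (T : set V) (X : V -> Omega -> R) (H : Omega -> R) : Prop :=
  sq_integrable H /\
  forall eps : R, 0 < eps -> exists s : seq (V * R),
    (forall p, p \in s -> T p.1) /\
    (\int[P]_w ((H w - lin_comb X s w) ^+ 2)%:E < eps%:E)%E.

Definition w_H (X : V -> Omega -> R) (H : Omega -> R) (t : V) : R :=
  fine (\int[P]_w (X t w * H w)%:E)%E.

Definition C_X (T : set V) (X : V -> Omega -> R) (a b : V) : \bar R :=
  ereal_inf [set (\int[P]_w ((H w) ^+ 2)%:E)%E | H in
    [set H | in_L T X H /\ exists xi, path_in T xi a b /\
        forall v, I01 v -> 1 < w_H X H (xi v)]].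

Definition event_ab (T : set V) (X : V -> Omega -> R) (a b : V) (u : R)
  : set Omega :=
  [set w | exists xi, path_in T xi a b /\
     forall v, I01 v -> u < X (xi v) w].

Definition Psi_ab T X a b u : R := fine (P (event_ab T X a b u)).

Definition event_a (X : V -> Omega -> R) (a : V) (u : R) : set Omega :=
  [set w | exists xi, is_path xi 0 a /\
     forall v, I01 v -> u < X (xi v) w].

Definition Psi_a X a u : R := fine (P (event_a X a u)).

End GaussDefs.

Definition elog {R : realType} (x : R) : \bar R :=
  if x == 0 then -oo%E else (ln x)%:E.

Definition rate {R : realType} (f : R -> R) (u : R) : \bar R :=
  ((u ^- 2)%:E * elog (f u))%E.

Definition einv {R : realType} (x : \bar R) : \bar R :=
  if x == 0%E then +oo%E
  else if x == +oo%E then 0%E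
  else ((fine x)^-1)%:E.

Definition M1_01 {R : realType} (mu : probability R R) : Prop :=
  mu I01 = 1%E.

Section QuadForm.
Context {R : realType} {d : nat}.
Local Notation V := 'rV[R]_d.

Definition quad (K : V -> V -> R) (xi : R -> V) (mu : probability R R)
  : \bar R :=
  (\int[mu]_(v in I01) \int[mu]_(u in I01) (K (xi u) (xi v))%:E)%E.

(** min over mu in M_1^+([0,1]) (written as an infimum; attainment is
    stated separately in the theorem) *)
Definition quad_min (K : V -> V -> R) (xi : R -> V) : \bar R :=
  ereal_inf [set quad K xi mu | mu in [set mu | M1_01 mu]].

Definition is_min_quad (K : V -> V -> R) (xi : R -> V) : Prop :=
  exists2 mu, M1_01 mu & quad K xi mu = quad_min K xi.

(** the spectral side, stationary case: h = hr + i hi in L^2(F) with even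
    real part and odd imaginary part; ∫ e^{i(t,x)} conj(h(x)) F(dx) split
    into real and imaginary parts *)
Definition spec_re (F : set BorelV -> \bar R) (hr hi : BorelV -> R) (t : V)
  : \bar R :=
  (\int[F]_x (cos (dotR t x) * hr x + sin (dotR t x) * hi x)%:E)%E.

Definition spec_im (F : set BorelV -> \bar R) (hr hi : BorelV -> R) (t : V)
  : \bar R :=
  (\int[F]_x (sin (dotR t x) * hr x - cos (dotR t x) * hi x)%:E)%E.

Definition spec_admissible (F : set BorelV -> \bar R) (hr hi : BorelV -> R)
  : Prop :=
  measurable_fun setT hr /\ measurable_fun setT hi /\
  (\int[F]_x ((hr x) ^+ 2 + (hi x) ^+ 2)%:E < +oo)%E /\
  (forall x : V, hr (- x) = hr x) /\ (forall x : V, hi (- x) = - hi x).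

Definition C_X_spec (F : set BorelV -> \bar R) (a : V) : \bar R :=
  ereal_inf [set z | exists (hr hi : BorelV -> R),
    [/\ spec_admissible F hr hi,
      (exists xi, is_path xi 0 a /\
        forall v, I01 v ->
          (1 < spec_re F hr hi (xi v))%E /\ spec_im F hr hi (xi v) = 0%E) &
      z = (\int[F]_x ((hr x) ^+ 2 + (hi x) ^+ 2)%:E)%E]].

End QuadForm.

(* Main.v *)
(** Write [m xi] for the minimal energy of [R (xi u, xi v)] over probability measures on
    [[0, 1]]. If the field exceeds [u] on a path, so does each of its averages over points of
    the path, and the average for a nearly minimal measure is Gaussian with variance close to
    [m xi]. Fernique's inequality makes the field constant on the cells of a fine net up to
    [del * u], outside an event which is negligible on the exponential scale, so that only
    finitely many such averages matter; this bounds the probability from above. Conversely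
    the first-order condition at the minimizer [mu] says that the potential
    [v => \int R (xi u, xi v) mu (du)] is at least [m xi]; hence a multiple [H] of the average
    of the field with respect to [mu] satisfies [w_H > 1] on the path with [E H^2] close to
    [1 / m xi], which yields the value of [C_X] and, by a Cameron-Martin tilt along [u H], the
    lower bound.

    Measures on [[0, 1]] are replaced by their quantile functions, and these by finite
    sequences of points with equal weights. In the stationary case a path which leaves a large
    ball contains many almost uncorrelated points, so it cannot contribute. *)

(* A Gaussian field is given only through the one-dimensional laws of its linear combinations,
   whereas Fernique's inequality rests on the rotation invariance of a joint law. The bridge is the
   characteristic function: equality of [E cos] of all linear forms is carried over to probabilities
   of symmetric boxes, the only joint events needed. Fernique's inequality starts from a level
   exceeded with probability at most 1/4 and then decays like a Gaussian in the ratio of the levels;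
   uniform continuity of sample paths makes the starting level for increments as small as desired,
   so the rate at level [del * u] beats any prescribed [K]. The same 3/4 estimate yields mean-square
   continuity. The identity [C_X = 1 / sup m] is Hilbert-space duality: [0 <= |H - lam Y|^2] and
   [w_H > 1] give [2 lam - lam^2 E Y^2 <= E H^2] for every average [Y] over the path, and optimizing
   over [lam] and [Y] gives [1 / m]; the first-order condition shows that this bound is sharp. The
   same computation in [L^2(F)] settles the spectral form. *)
Require Import Defs.
From HB Require Import structures.
From mathcomp Require Import all_boot all_order all_algebra.
From mathcomp Require Import all_classical all_reals all_analysis measurable_realfun.
From mathcomp Require Import ring lra.

Import Order.TTheory GRing.Theory Num.Def Num.Theory.
Import numFieldTopology.Exports.

Local Open Scope classical_set_scope.
Local Open Scope ring_scope.

Set Implicit Arguments.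
Unset Strict Implicit.
Unset Printing Implicit Defensive.

(** * Gaussian variables *)

Import HBNNSimple.

Section density.
Local Open Scope ereal_scope.
Context d (T : measurableType d) (R : realType).
Variables (mu nu : {measure set T -> \bar R}) (g : T -> R).
Hypothesis mg : measurable_fun setT g.
Hypothesis g0 : forall x, (0 <= g x)%R.
Hypothesis nuE : forall A, measurable A -> nu A = \int[mu]_(x in A) (g x)%:E.

Let density_nnsfun (f : {nnsfun T >-> R}) :
  \int[nu]_x (f x)%:E = \int[mu]_x ((f x)%:E * (g x)%:E).
Proof.
have mEg : measurable_fun setT (fun x => (g x)%:E) by exact/measurable_EFinP.
under [LHS]eq_integral do rewrite fimfunE -fsumEFin//.
rewrite [LHS]ge0_integral_fsum//; last 2 first.
  - by move=> r; exact/measurable_EFinP/measurableT_comp.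
  - by move=> n x _; rewrite EFinM nnfun_muleindic_ge0.
under [RHS]eq_integral.
  move=> x xD; rewrite fimfunE -fsumEFin// muleC ge0_mule_fsumr; last first.
    by move=> r; rewrite EFinM nnfun_muleindic_ge0.
  over.
rewrite [RHS]ge0_integral_fsum//; last 2 first.
  - move=> r; apply: emeasurable_funM => //.
    by apply/measurable_EFinP; do 2 apply/measurableT_comp => //.
  - move=> n x _; rewrite EFinM mule_ge0//; first by rewrite lee_fin.
    by rewrite nnfun_muleindic_ge0.
apply: eq_fsbigr => r _.
rewrite integralZl_indic_nnsfun//= integral_indic// setIT nuE//.
under [RHS]eq_integral do rewrite EFinM muleCA.
(* The sum runs over all reals; a negative [r] has an empty fibre, while pulling [r] out of the
   integral requires [0 <= r]. *)
have [r0|r0] := ltP r 0%R.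
  have -> : f @^-1` [set r] = set0.
    by apply/seteqP; split => // x /= fx; move: r0; rewrite -fx ltNge fun_ge0.
  rewrite integral_set0 mule0; apply/esym/integral0_eq => x _.
  by rewrite indic0 /= !mule0.
rewrite ge0_integralZl//; first last.
- by move=> x _; rewrite mule_ge0// lee_fin.
- apply: emeasurable_funM => //.
  by apply/measurable_EFinP/measurable_indic.
congr (_ * _); rewrite integral_mkcond; apply: eq_integral => x _.
rewrite patchE indicE; case: ifPn => _; by rewrite ?mule1 ?mule0.
Qed.

Lemma ge0_integral_density (f : T -> \bar R) :
  measurable_fun setT f -> (forall x, 0 <= f x) ->
  \int[nu]_x f x = \int[mu]_x (f x * (g x)%:E).
Proof.
move=> mf f0.
have mEg : measurable_fun setT (fun x => (g x)%:E) by exact/measurable_EFinP.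
pose f_ := nnsfun_approx measurableT mf.
transitivity (lim (\int[nu]_x (f_ n x)%:E @[n --> \oo])).
  rewrite -monotone_convergence//=.
  - apply: eq_integral => x _; apply/esym/cvg_lim => //=.
    exact: cvg_nnsfun_approx.
  - by move=> n; exact/measurable_EFinP/measurable_funTS.
  - by move=> n ? _; rewrite lee_fin.
  - by move=> ? _ ? ? mn; rewrite lee_fin; exact/lefP/nd_nnsfun_approx.
under eq_fun do rewrite density_nnsfun.
rewrite -monotone_convergence//=.
- apply: eq_integral => x _; apply/cvg_lim => //=.
  apply: cvgeZr => //; exact: cvg_nnsfun_approx.
- move=> n; apply: emeasurable_funM => //.
  exact/measurable_EFinP/measurable_funTS.
- by move=> n x _; rewrite mule_ge0// lee_fin.
- move=> x _ m n mn; rewrite lee_wpmul2r// lee_fin//.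
  exact/lefP/nd_nnsfun_approx.
Qed.

End density.

Section normal_density.
Context {R : realType}.
Implicit Types (s t m x : R).

(** Completing the square. *)
Lemma normal_pdf_exp_tilt s t x : s != 0 ->
  expR (t * x) * normal_pdf 0 s x =
  expR (t ^+ 2 * s ^+ 2 / 2) * normal_pdf (t * s ^+ 2) s x.
Proof.
move=> s0; rewrite !normal_pdfE// mulrCA [RHS]mulrCA; congr (_ * _).
rewrite /normal_fun -!expRD; congr expR.
by field.
Qed.

Lemma normal_pdf_shift s m x : s != 0 ->
  normal_pdf m s (x + m) = normal_pdf 0 s x.
Proof. by move=> s0; rewrite !normal_pdfE// /normal_fun addrK subr0. Qed.

Lemma lebesgue_integral_shift m (G : R -> R) :
  continuous G -> (forall x, 0 <= G x) ->
  (\int[lebesgue_measure]_x (G x)%:E =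
   \int[lebesgue_measure]_x (G (x + m))%:E)%E.
Proof.
move=> cG G0.
have dF (x : R) : is_derive x 1 (fun x : R => x + m) 1.
  by apply: is_derive_eq; rewrite addr0.
have F'E : derive1 (fun x : R => x + m) = cst 1.
  by apply/funext => x; rewrite derive1E; exact: derive_val.
rewrite (@increasing_ge0_integration_by_substitutionT _ (fun x => x + m))//=.
- by apply: eq_integral => x _; rewrite F'E /= mulr1.
- by move=> x y xy; rewrite ltrD2r.
- by rewrite F'E => x; exact: cvg_cst.
- by rewrite F'E; exact: is_cvg_cst.
- by rewrite F'E; exact: is_cvg_cst.
- exact: cvg_addrr_Ny.
- exact: cvg_addrr.
Qed.

End normal_density.

Section gaussian_variable.
Context {R : realType} {dO : measure_display} {Omega : measurableType dO}.
Variables (P : probability Omega R) (Y : Omega -> R) (s : R).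
Hypothesis mY : measurable_fun setT Y.
Hypothesis lawY : forall A : set R, measurable A ->
  P (Y @^-1` A) = (if s == 0 then \d_(0 : R) A else normal_prob 0 s A).

Lemma ge0_integral_gaussian0 (f : R -> R) : s = 0 ->
  measurable_fun setT f -> (forall x, 0 <= f x) ->
  (\int[P]_w (f (Y w))%:E = (f 0)%:E)%E.
Proof.
move=> s0 mf f0.
rewrite -(@ge0_integral_pushforward _ _ _ R _ _ mY P setT (EFin \o f))//; last 2 first.
- exact/measurable_EFinP.
- by move=> x _; rewrite lee_fin.
rewrite (@eq_measure_integral _ _ _ setT (\d_(0 : R))).
  rewrite integral_dirac//=; first by rewrite diracT mul1e.
  exact/measurable_EFinP.
move=> A mA _; by move: (lawY mA); rewrite s0 eqxx.
Qed.

Lemma ge0_integral_gaussian (f : R -> R) : s != 0 ->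
  measurable_fun setT f -> (forall x, 0 <= f x) ->
  (\int[P]_w (f (Y w))%:E =
   \int[lebesgue_measure]_x (f x * normal_pdf 0 s x)%:E)%E.
Proof.
move=> s0 mf f0.
have mY' : measurable_fun setT (Y : Omega -> measurableTypeR R) by [].
have mf' : measurable_fun setT (f : measurableTypeR R -> R) by [].
rewrite -(@ge0_integral_pushforward _ _ _ (measurableTypeR R) _ _ mY' P setT (EFin \o f))//; last 2 first.
- exact/measurable_EFinP.
- by move=> x _; rewrite lee_fin.
rewrite (@eq_measure_integral _ _ _ setT (normal_prob 0 s)).
  rewrite (@ge0_integral_density _ _ R lebesgue_measure _ (normal_pdf 0 s))//.
  - exact: measurable_normal_pdf.
  - by move=> x; exact: normal_pdf_ge0.
  - exact/measurable_EFinP.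
by move=> A mA _; move: (lawY mA); rewrite (negbTE s0).
Qed.

Lemma gaussian_exp_tilt (F : R -> R) (t : R) :
  continuous F -> (forall x, 0 <= F x) ->
  (\int[P]_w (F (Y w) * expR (t * Y w))%:E =
   (expR (t ^+ 2 * s ^+ 2 / 2))%:E * \int[P]_w (F (Y w + t * s ^+ 2))%:E)%E.
Proof.
move=> cF F0; set m := t * s ^+ 2.
have mF : measurable_fun setT F by exact: continuous_measurable_fun.
have cFm : continuous (fun x : R => F (x + m)).
  move=> x; apply: (@continuous_comp _ _ _ (fun x : R => x + m) F); last exact: cF.
  by apply: cvgD; [exact: cvg_id|exact: cvg_cst].
have mFm : measurable_fun setT (fun x : R => F (x + m)).
  exact: continuous_measurable_fun.
have mFe : measurable_fun setT (fun x : R => F x * expR (t * x)).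
  apply: measurable_funM => //.
  by apply: measurableT_comp => //; exact: measurable_funM.
have Fe0 x : 0 <= F x * expR (t * x) by rewrite mulr_ge0 ?expR_ge0.
have [s0|s0] := eqVneq s 0.
  rewrite (ge0_integral_gaussian0 s0 mFe Fe0).
  rewrite (ge0_integral_gaussian0 s0 mFm (fun x => F0 _)).
  by rewrite /m s0 expr0n/= !(mulr0, mul0r) expR0 mul1e mulr1 addr0.
rewrite (ge0_integral_gaussian s0 mFe Fe0).
rewrite (ge0_integral_gaussian s0 mFm (fun x => F0 _)).
under [in RHS]eq_integral do rewrite -(normal_pdf_shift m)//.
rewrite -(@lebesgue_integral_shift _ m (fun x => F x * normal_pdf m s x)); first last.
- by move=> x; rewrite mulr_ge0// normal_pdf_ge0.
- by move=> x; apply: cvgM; [exact: cF|exact: continuous_normal_pdf].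
rewrite -ge0_integralZl//=; first last.
- by move=> x _; rewrite lee_fin mulr_ge0// normal_pdf_ge0.
- apply/measurable_EFinP/measurable_funM => //; exact: measurable_normal_pdf.
apply: eq_integral => x _.
by rewrite -!EFinM -mulrA normal_pdf_exp_tilt// [in RHS]mulrCA.
Qed.

Lemma gaussian_mgf (t : R) :
  (\int[P]_w (expR (t * Y w))%:E = (expR (t ^+ 2 * s ^+ 2 / 2))%:E)%E.
Proof.
have := @gaussian_exp_tilt (cst 1) t; rewrite /=.
under eq_integral do rewrite mul1r.
move=> ->//; last exact: cst_continuous.
by rewrite integral_cst//= probability_setT !mule1.
Qed.

Lemma integrable_gaussian_expR (t : R) :
  P.-integrable setT (fun w => (expR (t * Y w))%:E).
Proof.
apply/integrableP; split.
  apply/measurable_EFinP.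
  by apply: measurableT_comp => //; exact: measurable_funM.
under eq_integral do rewrite gee0_abs ?lee_fin ?expR_ge0//.
by rewrite gaussian_mgf ltry.
Qed.

End gaussian_variable.

Section Rintegral_extra.
Context {R : realType} {dO : measure_display} {Omega : measurableType dO}.

Lemma bounded_integrable (mu : {finite_measure set Omega -> \bar R}) (f : Omega -> R) (C : R) :
  measurable_fun setT f -> (forall w, `|f w| <= C) ->
  mu.-integrable setT (EFin \o f).
Proof.
move=> mf fC; apply: (@le_integrable _ _ _ mu _ measurableT _ (EFin \o cst C)).
- exact/measurable_EFinP.
- move=> w _; rewrite /= lee_fin (le_trans (fC w))// ler_norm//.
- exact: finite_measure_integrable_cst.
Qed.

Variable P : probability Omega R.

Lemma Rintegral_cstP (r : R) : \int[P]_w r = r.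
Proof.
by rewrite Rintegral_cst// (_ : fine _ = 1) ?mulr1// -[RHS]/(fine 1) -(@probability_setT _ _ _ P).
Qed.

Lemma is_derive_Rintegral (f f' : R -> Omega -> R) (G : Omega -> R) (a : R) :
  (forall x, P.-integrable setT (EFin \o f x)) ->
  (forall (x : R) w, is_derive x 1 (f ^~ w) (f' x w)) ->
  P.-integrable setT (EFin \o G) ->
  (forall x w, `|x - a| < 1 -> `|f' x w| <= G w) ->
  is_derive a 1 (fun x => \int[P]_w f x w) (\int[P]_w f' a w).
Proof.
move=> intf df intG f'G.
have Ia : (`]a - 1, a + 1[%classic : set R) a.
  by rewrite /= in_itv/= ltrBlDr ltrDl ltr01.
have d1f : forall x w, partial1of2 f x w = f' x w.
  by move=> x w; rewrite /partial1of2 derive1E; exact: derive_val.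
have df1 (x : R) w : derivable (f ^~ w) x 1 by apply: ex_derive.
have G0 w : 0 <= G w by rewrite (le_trans _ (f'G a w _))// subrr normr0.
have G_ub x w : (`]a - 1, a + 1[%classic : set R) x -> setT w ->
    `|partial1of2 f x w| <= G w.
  rewrite /= in_itv/= => /andP[ax xa] _; rewrite d1f f'G// ltr_norml.
  by apply/andP; split; lra.
apply: DeriveDef.
  exact: (@derivable_under_integral _ _ _ P f _ measurableT _ _ _ Ia
    (fun x _ => intf x) (fun x w _ _ => df1 x w) G G0 intG G_ub).
rewrite -derive1E.
rewrite (@differentiation_under_integral _ _ _ P f _ measurableT _ _ _ Ia
    (fun x _ => intf x) (fun x w _ _ => df1 x w) G G0 intG G_ub).
by apply: eq_Rintegral => w _; rewrite /= d1f.
Qed.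

End Rintegral_extra.

(** * Stein's identity, characteristic function and variance of a Gaussian variable *)

Section gaussian_char.
Context {R : realType} {dO : measure_display} {Omega : measurableType dO}.
Variables (P : probability Omega R) (Y : Omega -> R) (s : R).
Hypothesis mY : measurable_fun setT Y.
Hypothesis lawY : forall A : set R, measurable A ->
  P (Y @^-1` A) = (if s == 0 then \d_(0 : R) A else normal_prob 0 s A).

Let expE (t : R) : P.-integrable setT (EFin \o (fun w => expR (t * Y w))).
Proof. exact: integrable_gaussian_expR lawY t. Qed.

Let mcos (th c : R) : measurable_fun setT (fun w => cos (th * Y w + c)).
Proof.
apply: (@measurable_comp _ _ _ _ _ _ setT (cos : R -> R)) => //.
  by apply: continuous_measurable_fun; exact: continuous_cos.
by apply: measurable_funD => //; exact: measurable_funM.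
Qed.

Let msin (th c : R) : measurable_fun setT (fun w => sin (th * Y w + c)).
Proof.
apply: (@measurable_comp _ _ _ _ _ _ setT (sin : R -> R)) => //.
  by apply: continuous_measurable_fun; exact: continuous_sin.
by apply: measurable_funD => //; exact: measurable_funM.
Qed.

Let Icos (th c : R) : P.-integrable setT (EFin \o (fun w => cos (th * Y w + c))).
Proof. by apply: (@bounded_integrable _ _ _ P _ 1) => // w; exact: cos_max. Qed.

Let Isin (th c : R) : P.-integrable setT (EFin \o (fun w => sin (th * Y w + c))).
Proof. by apply: (@bounded_integrable _ _ _ P _ 1) => // w; exact: sin_max. Qed.

(** This is [2 cosh (t Y)], an integrable majorant of [expR (r * Y)] for all [|r| <= t]; up to
    constants it also dominates [Y], [Y ^+ 2] and the derivatives in [t] that occur below. *)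
Let dom (t : R) (w : Omega) := expR (t * Y w) + expR (- t * Y w).

Let dom_int t : P.-integrable setT (EFin \o dom t).
Proof.
rewrite (_ : EFin \o dom t =
  (EFin \o (fun w => expR (t * Y w))) \+ (EFin \o (fun w => expR (- t * Y w))))%E //.
exact: integrableD.
Qed.

Let exp_dom (t r : R) w : `|r| <= t -> expR (r * Y w) <= dom t w.
Proof.
move=> rt; have [y0|y0] := leP 0 (Y w).
  rewrite /dom (@le_trans _ _ (expR (t * Y w)))//; last by rewrite lerDl expR_ge0.
  by rewrite ler_expR ler_wpM2r// (le_trans _ rt)// ler_norm.
rewrite /dom (@le_trans _ _ (expR (- t * Y w)))//; last by rewrite lerDr expR_ge0.
rewrite ler_expR ler_wnM2r// ?(ltW y0)//.
by rewrite lerNl (le_trans _ rt)// -normrN ler_norm.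
Qed.

Let abs_dom (w : Omega) : `|Y w| <= dom 1 w.
Proof.
have h (y : R) : y <= expR y by rewrite (le_trans _ (expR_ge1Dx y))// lerDr.
rewrite ler_norml; apply/andP; split; last first.
  by rewrite (le_trans (h _))// -[X in expR X]mul1r exp_dom// normr1.
rewrite lerNl (le_trans (h _))// -mulN1r exp_dom//.
by rewrite normrN normr1.
Qed.

Let absexp_dom (t : R) (w : Omega) : `|t| < 1 ->
  `|Y w * expR (t * Y w)| <= dom 2 w.
Proof.
move=> t1; rewrite normrM (ger0_norm (expR_ge0 _)).
have tY : expR (t * Y w) <= expR `|Y w|.
  rewrite ler_expR (le_trans (ler_norm _))// normrM.
  by rewrite ler_piMl// ltW.
have h : `|Y w| <= expR `|Y w|.
  by rewrite (le_trans _ (expR_ge1Dx _))// lerDr.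
rewrite (@le_trans _ _ (expR `|Y w| * expR `|Y w|))//.
  by rewrite ler_pM ?expR_ge0.
rewrite -expRD; have [y0|y0] := leP 0 (Y w).
  by rewrite ger0_norm// -mulr2n -[_ *+ 2]mulr_natl exp_dom// ger0_norm.
by rewrite ltr0_norm// -mulr2n -[_ *+ 2]mulr_natl mulrN -mulNr exp_dom// normrN ger0_norm.
Qed.

Let sqr_dom (w : Omega) : `|Y w ^+ 2| <= 4 * dom 1 w.
Proof.
have h (y : R) : 0 <= y -> y ^+ 2 <= 4 * expR y.
  move=> y0; rewrite -[leLHS](@divfK _ 4)// mulrC ler_pM2l//.
  have -> : y ^+ 2 / 4 = (y / 2) ^+ 2 by field.
  have -> : expR y = expR (y / 2) ^+ 2 by rewrite -expRM_natl; congr expR; field.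
  rewrite lerXn2r ?nnegrE ?divr_ge0 ?expR_ge0//.
  by rewrite (le_trans _ (expR_ge1Dx _))// lerDr.
rewrite ger0_norm ?sqr_ge0//.
have [y0|/ltW y0] := leP 0 (Y w).
  rewrite (le_trans (h _ y0))// ler_pM2l// -[X in expR X]mul1r.
  by rewrite exp_dom// normr1.
rewrite -sqrrN (le_trans (h _ _)) ?oppr_ge0// ler_pM2l// -mulN1r.
by rewrite exp_dom// normrN normr1.
Qed.

Lemma gaussian_integrable : P.-integrable setT (EFin \o Y).
Proof.
apply: (le_integrable _ _ _ (dom_int 1)) => //; first exact/measurable_EFinP.
by move=> w _; rewrite /= lee_fin (le_trans (abs_dom w))// ler_norm.
Qed.

Lemma gaussian_sqr_integrable : P.-integrable setT (EFin \o (fun w => Y w ^+ 2)).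
Proof.
apply: (le_integrable _ _ _ (integrableZl measurableT 4 (dom_int 1))) => //.
  by apply/measurable_EFinP; exact: measurable_funX.
by move=> w _; rewrite /= lee_fin (le_trans (sqr_dom w))// ler_norm.
Qed.

(** The tilt formula is available for nonnegative functions, so it is applied to [1 + cos]; the
    contribution of 1 is the moment generating function and cancels. *)
Let gaussian_exp_tilt_cos (th c t : R) :
  \int[P]_w (cos (th * Y w + c) * expR (t * Y w)) =
  expR (t ^+ 2 * s ^+ 2 / 2) *
    (cos (th * (t * s ^+ 2)) * \int[P]_w cos (th * Y w + c)
     - sin (th * (t * s ^+ 2)) * \int[P]_w sin (th * Y w + c)).
Proof.
have ccos (a : R): continuous (fun x : R => 1 + cos (th * x + a)).
  move=> x; apply: cvgD; first exact: cvg_cst.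
  apply: (@continuous_comp _ _ _ (fun x : R => th * x + a) cos); last exact: continuous_cos.
  by apply: cvgD; [apply: cvgM; [exact: cvg_cst|exact: cvg_id]|exact: cvg_cst].
have cge0 x : 0 <= 1 + cos (th * x + c) by rewrite -lerBlDl sub0r cos_geN1.
have := gaussian_exp_tilt mY lawY t (ccos c) cge0.
under eq_integral do rewrite mulrDl mul1r.
move=> /(congr1 fine).
have Ice : P.-integrable setT (EFin \o (fun w => cos (th * Y w + c) * expR (t * Y w))).
  apply: (le_integrable _ _ _ (expE t)) => //.
    apply/measurable_EFinP/measurable_funM => //.
    by have /measurable_int/measurable_EFinP := expE t.
  move=> w _; rewrite /= lee_fin normrM ler_piMl// cos_max//.
rewrite -/(Rintegral P setT _) RintegralD// fineM//; last first.
  apply: integrable_fin_num => //.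
  apply: (@bounded_integrable _ _ _ P _ 2) => //.
    apply: measurable_funD => //.
    rewrite (_ : (fun x => _) = (fun w => cos (th * Y w + (th * (t * s ^+ 2) + c)))) //.
    by apply/funext => w; congr cos; ring.
  by move=> w; rewrite (le_trans (ler_normD _ _))// normr1 -[2]/(1+1) lerD2l cos_max.
rewrite -/(Rintegral P setT _).
rewrite {1}/Rintegral (gaussian_mgf mY lawY t) /=.
have -> : \int[P]_w (1 + cos (th * (Y w + t * s ^+ 2) + c)) =
    1 + (cos (th * (t * s ^+ 2)) * \int[P]_w cos (th * Y w + c)
     - sin (th * (t * s ^+ 2)) * \int[P]_w sin (th * Y w + c)).
  have Z1 r : P.-integrable setT (EFin \o (fun w => r * cos (th * Y w + c))).
    exact: integrableZl (Icos th c).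
  have Z2 r : P.-integrable setT (EFin \o (fun w => r * sin (th * Y w + c))).
    exact: integrableZl (Isin th c).
  rewrite -(RintegralZl _ _ (Icos th c))// -(RintegralZl _ _ (Isin th c))//.
  rewrite -RintegralB//.
  transitivity (\int[P]_w (1 + (cos (th * (t * s ^+ 2)) * cos (th * Y w + c) -
    sin (th * (t * s ^+ 2)) * sin (th * Y w + c)))).
    apply: eq_Rintegral => w _; rewrite -cosD; congr (_ + cos _); ring.
  have Z r1 r2 : P.-integrable setT
      (EFin \o (fun w => r1 * cos (th * Y w + c) - r2 * sin (th * Y w + c))).
    exact: integrableB (Z1 _) (Z2 _).
  rewrite (RintegralD measurableT _ (Z _ _)).
    by rewrite Rintegral_cstP.
  exact: finite_measure_integrable_cst.
rewrite mulrDr mulr1 => /addrI; exact.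
Qed.

(** Stein's identity [E[Y g(Y)] = s^2 E[g'(Y)]] for [g(y) = cos (th y + c)]: both sides of the
    previous formula are differentiated at [t = 0]. The phase [c] lets one identity serve cosines
    and sines. *)
Let gaussian_stein (th c : R) :
  \int[P]_w (Y w * cos (th * Y w + c)) =
  - (th * s ^+ 2 * \int[P]_w sin (th * Y w + c)).
Proof.
set A := \int[P]_w cos (th * Y w + c); set B := \int[P]_w sin (th * Y w + c).
have D1 : is_derive (0 : R) 1 (fun t => \int[P]_w (cos (th * Y w + c) * expR (t * Y w)))
    (\int[P]_w (Y w * cos (th * Y w + c))).
  have -> : \int[P]_w (Y w * cos (th * Y w + c)) =
     \int[P]_w (cos (th * Y w + c) * (Y w * expR (0 * Y w))).
    by apply: eq_Rintegral => w _; rewrite mul0r expR0 mulr1 mulrC.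
  apply: (is_derive_Rintegral (f' := fun t w => cos (th * Y w + c) * (Y w * expR (t * Y w)))
     (G := dom 2)) => //.
  - move=> t; apply: (le_integrable _ _ _ (expE t)) => //.
      apply/measurable_EFinP/measurable_funM => //.
      by have /measurable_int/measurable_EFinP := expE t.
    by move=> w _; rewrite /= lee_fin normrM ler_piMl// cos_max.
  - move=> t w; apply: is_derive_eq.
    by rewrite /GRing.scale/=; ring.
  - move=> t w; rewrite subr0 => t1; rewrite normrM (le_trans _ (absexp_dom w t1))//.
    by rewrite ler_piMl// cos_max.
have D2 : is_derive (0 : R) 1 (fun t => expR (t ^+ 2 * s ^+ 2 / 2) *
    (cos (th * (t * s ^+ 2)) * A - sin (th * (t * s ^+ 2)) * B))
    (- (th * s ^+ 2 * B)).
  apply: is_derive_eq.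
  rewrite /= /GRing.scale/= !(mul0r, mulr0, expr0n) cos0 sin0 expR0.
  by rewrite !(mulr0, mul0r, addr0, add0r, mulr1, mul1r, oppr0); ring.
have := @derive_val _ _ _ _ _ _ _ D1.
rewrite (_ : (fun t => _) = (fun t => expR (t ^+ 2 * s ^+ 2 / 2) *
    (cos (th * (t * s ^+ 2)) * A - sin (th * (t * s ^+ 2)) * B))).
  by move=> <-; exact: derive_val.
by apply/funext => t; exact: gaussian_exp_tilt_cos.
Qed.

(** By Stein's identity [B t = E sin (t Y + c)] solves [B' = - t s^2 B], so
    [B t * expR (t^2 s^2 / 2)] is constant and equals its value [sin c] at 0. *)
Lemma gaussian_sin (th c : R) :
  \int[P]_w sin (th * Y w + c) = expR (- (th ^+ 2 * s ^+ 2 / 2)) * sin c.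
Proof.
pose B t := \int[P]_w sin (t * Y w + c).
have dB (t : R) : is_derive t 1 B (- (t * s ^+ 2 * B t)).
  rewrite -gaussian_stein.
  apply: (is_derive_Rintegral (f := fun t w => sin (t * Y w + c))
     (f' := fun t w => Y w * cos (t * Y w + c)) (G := fun w => `|Y w|)) => //.
  - move=> x w; apply: is_derive_eq.
    by rewrite /GRing.scale/=; ring.
  - exact: integrable_norm gaussian_integrable.
  - by move=> x w _; rewrite normrM ler_piMr// cos_max.
have dC (t : R) : is_derive t 1 (fun t : R => B t * expR (t ^+ 2 * s ^+ 2 / 2)) 0.
  apply: is_derive_eq; rewrite /GRing.scale/= /GRing.scale/= !(mulr0, add0r, mulr1).
  by field.
have := is_derive_0_is_cst th 0 dC.
have -> : B 0 = sin c.
  rewrite -[RHS](Rintegral_cstP P); apply: eq_Rintegral => w _.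
  by rewrite mul0r add0r.
rewrite expr0n/= !mul0r expR0 mulr1 => <-.
by rewrite mulrCA -expRD addNr expR0 mulr1.
Qed.

Lemma gaussian_char_sin : \int[P]_w sin (Y w) = 0.
Proof.
have := gaussian_sin 1 0; rewrite sin0 mulr0 => <-.
by apply: eq_Rintegral => w _; rewrite mul1r addr0.
Qed.

Lemma gaussian_char_cos : \int[P]_w cos (Y w) = expR (- (s ^+ 2 / 2)).
Proof.
have := gaussian_sin 1 (pi / 2); rewrite sin_pihalf mulr1 expr1n mul1r => <-.
by apply: eq_Rintegral => w _; rewrite mul1r sinDpihalf.
Qed.

(** [E Y^2] is the derivative at 0 of [t => E[Y sin (t Y)]], a function which Stein's identity and
    the formula for [E sin] evaluate explicitly. *)
Lemma gaussian_variance : \int[P]_w (Y w ^+ 2) = s ^+ 2.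
Proof.
have sE (t : R) : \int[P]_w (Y w * sin (t * Y w)) =
    t * s ^+ 2 * expR (- (t ^+ 2 * s ^+ 2 / 2)).
  transitivity (\int[P]_w (Y w * cos (t * Y w - pi / 2))).
    by apply: eq_Rintegral => w _; rewrite cosBpihalf.
  by rewrite gaussian_stein gaussian_sin sinN sin_pihalf; ring.
have D1 : is_derive (0 : R) 1 (fun t => \int[P]_w (Y w * sin (t * Y w)))
    (\int[P]_w (Y w ^+ 2)).
  have -> : \int[P]_w (Y w ^+ 2) = \int[P]_w (Y w * (Y w * cos (0 * Y w))).
    by apply: eq_Rintegral => w _; rewrite mul0r cos0 mulr1 expr2.
  apply: (is_derive_Rintegral (f' := fun t w => Y w * (Y w * cos (t * Y w)))
     (G := fun w => Y w ^+ 2)) => //.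
  - move=> t; apply: (le_integrable _ _ _ gaussian_integrable) => //.
      apply/measurable_EFinP/measurable_funM => //.
      have := msin t 0; congr measurable_fun; apply/funext => w.
      by rewrite addr0.
    by move=> w _; rewrite /= lee_fin normrM ler_piMr// sin_max.
  - move=> t w; apply: is_derive_eq.
    by rewrite /GRing.scale/=; ring.
  - exact: gaussian_sqr_integrable.
  - move=> t w _; rewrite mulrA -expr2 normrM ger0_norm ?sqr_ge0//.
    by rewrite ler_piMr ?sqr_ge0// cos_max.
have := @derive_val _ _ _ _ _ _ _ D1.
rewrite (_ : (fun t => _) = (fun t => t * s ^+ 2 * expR (- (t ^+ 2 * s ^+ 2 / 2)))).
  have D2 : is_derive (0 : R) 1
      (fun t : R => t * s ^+ 2 * expR (- (t ^+ 2 * s ^+ 2 / 2))) (s ^+ 2).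
    apply: is_derive_eq; rewrite /GRing.scale/= /GRing.scale/=.
    by rewrite expr0n/= !(mul0r,oppr0) expR0; ring.
  by move=> <-; exact: derive_val.
by apply/funext.
Qed.

End gaussian_char.

Section centered_gaussian_theory.
Context {R : realType} {dO : measure_display} {Omega : measurableType dO}.
Variables (P : probability Omega R) (Y : Omega -> R).
Hypothesis gY : centered_gaussian P Y.

Lemma cg_measurable : measurable_fun setT Y. Proof. by case: gY. Qed.

Lemma cg_sqr_integrable : P.-integrable setT (EFin \o (fun w => Y w ^+ 2)).
Proof. by case: gY => mY [s [_ lawY]]; exact: gaussian_sqr_integrable mY lawY. Qed.

Lemma cg_expR_integrable (t : R) :
  P.-integrable setT (EFin \o (fun w => expR (t * Y w))).
Proof. by case: gY => mY [s [_ lawY]]; exact: integrable_gaussian_expR mY lawY t. Qed.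

Lemma cg_mgf (t : R) :
  \int[P]_w expR (t * Y w) = expR (t ^+ 2 * \int[P]_w (Y w ^+ 2) / 2).
Proof.
case: gY => mY [s [_ lawY]].
by rewrite (gaussian_variance mY lawY) /Rintegral (gaussian_mgf mY lawY).
Qed.

Lemma cg_cos : \int[P]_w cos (Y w) = expR (- (\int[P]_w (Y w ^+ 2) / 2)).
Proof.
case: gY => mY [s [_ lawY]].
by rewrite (gaussian_variance mY lawY) (gaussian_char_cos mY lawY).
Qed.

Lemma cg_sin : \int[P]_w sin (Y w) = 0.
Proof. by case: gY => mY [s [_ lawY]]; exact: gaussian_char_sin mY lawY. Qed.

(** Chernoff's bound with the optimal parameter [t = x / q]. Only an upper bound [q] of the variance
    enters, so degenerate variables need no separate case. *)
Lemma cg_tail (x q : R) : 0 <= x -> 0 < q -> \int[P]_w (Y w ^+ 2) <= q ->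
  (P [set w | (x <= Y w)%R] <= (expR (- (x ^+ 2 / (2 * q))))%:E)%E.
Proof.
move=> x0 q0 Yq; pose t := x / q.
have t0 : 0 <= t by rewrite divr_ge0// ltW.
have mA : measurable [set w | x <= Y w].
  rewrite -[X in measurable X]setTI.
  have := cg_measurable measurableT (measurable_itv `[x, +oo[).
  by congr measurable; congr setI; apply/seteqP; split => w /=; rewrite in_itv/= andbT.
have IE := cg_expR_integrable t.
have mE : measurable_fun setT (fun w => expR (t * Y w - t * x)).
  apply: measurableT_comp => //; apply: measurable_funB => //.
  by apply: measurable_funM => //; exact: cg_measurable.
have <- : (\int[P]_w (\1_[set w | (x <= Y w)%R] w)%:E)%E = P [set w | x <= Y w].
  by rewrite integral_indic// setIT.
apply: (@le_trans _ _ (\int[P]_w (expR (t * Y w - t * x))%:E)%E).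
  apply: ge0_le_integral => //.
  - by apply/measurable_EFinP; exact: measurable_indic.
  - exact/measurable_EFinP.
  - move=> w _; rewrite indicE lee_fin; case: (boolP (w \in _)) => [|_]; last exact: expR_ge0.
    rewrite inE /= => xY; rewrite -expR0 ler_expR subr_ge0.
    by rewrite ler_wpM2l.
under eq_integral do rewrite expRD EFinM.
rewrite (integralZr measurableT IE).
rewrite -[X in (X * _)%E]fineK; last exact: integrable_fin_num.
rewrite -EFinM lee_fin -[fine _]/(Rintegral _ _ _) cg_mgf -expRD ler_expR.
rewrite (@le_trans _ _ (t ^+ 2 * q / 2 - t * x))//.
  by rewrite lerD2r ler_pM2r// ler_wpM2l ?sqr_ge0.
rewrite /t le_eqVlt; apply/orP; left; apply/eqP; field.
by rewrite gt_eqF.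
Qed.

End centered_gaussian_theory.

(** * Laws of Gaussian vectors on boxes *)

Section limits.
Context {R : realType}.
Implicit Types q y : R.

Lemma Bernoulli_pos (h : R) n : 0 <= h -> 1 + n%:R * h <= (1 + h) ^+ n.
Proof.
move=> h0; elim: n => [|n IH]; first by rewrite mul0r addr0 expr0.
rewrite exprS (le_trans _ (ler_wpM2l _ IH)) ?addr_ge0//.
rewrite -natr1 mulrDl mulrDl mul1r mulrDr mulr1.
have : 0 <= h * (n%:R * h) by rewrite !mulr_ge0.
lra.
Qed.

Lemma Bernoulli_neg (z : R) n : 0 <= z <= 1 -> 1 - n%:R * z <= (1 - z) ^+ n.
Proof.
move=> /andP[z0 z1]; elim: n => [|n IH]; first by rewrite mul0r subr0 expr0.
rewrite exprS (le_trans _ (ler_wpM2l _ IH)) ?subr_ge0//.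
rewrite -natr1 mulrDl mulrBl mul1r mulrBr mulr1.
have : 0 <= z * (n%:R * z) by rewrite !mulr_ge0.
lra.
Qed.

(** With [t = (1 + q) / 2] one has [q <= t^2]; Bernoulli's inequality bounds [n t^n], and the
    remaining factor [t^n] tends to 0. *)
Lemma cvg_mulrn_expr q : 0 <= q < 1 -> n%:R * q ^+ n @[n --> \oo] --> 0.
Proof.
move=> /andP[q0 q1]; pose t := (1 + q) / 2.
have t0 : 0 < t by rewrite divr_gt0//; lra.
have t1 : t < 1 by rewrite /t; lra.
have qt : q <= t ^+ 2.
  by rewrite /t -subr_ge0 (_ : _ - _ = ((1 - q) / 2) ^+ 2) ?sqr_ge0//; field.
pose h := t^-1 - 1.
have h0 : 0 < h by rewrite subr_gt0 invf_gt1.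
have nt n : n%:R * t ^+ n <= h^-1.
  have ht : 1 + h = t^-1 by rewrite /h addrC subrK.
  have := Bernoulli_pos n (ltW h0); rewrite ht exprVn => H.
  rewrite -[leRHS]mul1r ler_pdivlMr// mulrAC -ler_pdivlMr ?exprn_gt0// mul1r.
  by rewrite (le_trans _ H)// lerDr.
apply: (@squeeze_cvgr _ _ _ _ (cst 0) (geometric h^-1 t)).
- apply: nearW => n; apply/andP; split; first by rewrite mulr_ge0 ?exprn_ge0.
  rewrite /geometric/= (le_trans (_ : _ <= n%:R * t ^+ n * t ^+ n))//.
    by rewrite -mulrA -exprD ler_wpM2l// addnn -mul2n exprM lerXn2r ?nnegrE ?sqr_ge0.
  by rewrite ler_wpM2r// exprn_ge0// ltW.
- exact: cvg_cst.
- by apply: cvg_geometric; rewrite ger0_norm// ltW.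
Qed.

(** Polynomials approximating the indicator of [[1/2, 1]] on [[0, 1]], as in the elementary proof of
    Weierstrass' theorem. By Bernoulli's inequality their limit is governed by
    [(n 2^n) y^n = n (2 y)^n], which tends to infinity for [y >= 1/2], the endpoint being covered by
    the factor [n], and to 0 below. *)
Definition threshold_poly n y := 1 - (1 - y ^+ n) ^+ (n * 2 ^ n).

Lemma threshold_poly_itv n y : 0 <= y <= 1 -> 0 <= threshold_poly n y <= 1.
Proof.
move=> /andP[y0 y1]; rewrite /threshold_poly subr_ge0 gerBl.
have /andP[a b] : 0 <= 1 - y ^+ n <= 1.
  by rewrite subr_ge0 exprn_ile1//= gerBl exprn_ge0.
by rewrite exprn_ile1//= exprn_ge0.
Qed.

Lemma cvg_threshold_poly y : 0 <= y <= 1 ->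
  threshold_poly n y @[n --> \oo] --> ((2^-1 <= y)%R%:R : R).
Proof.
move=> /andP[y0 y1].
have z01 n : 0 <= 1 - y ^+ n <= 1.
  by rewrite subr_ge0 exprn_ile1//= gerBl exprn_ge0.
have e01 n : 0 <= y ^+ n <= 1 by rewrite exprn_ge0//= exprn_ile1.
have E n : (n * 2 ^ n)%:R * y ^+ n = n%:R * (2 * y) ^+ n :> R.
  by rewrite natrM natrX exprMn mulrA.
case: (leP 2^-1 y) => [y2|y2].
- rewrite -[X in _ --> X](subr0 1); apply: cvgB; first exact: cvg_cst.
  apply: (@squeeze_cvgr _ _ _ _ (cst 0) harmonic); [|exact: cvg_cst|exact: cvg_harmonic].
  apply: nearW => n; apply/andP; split; first by case/andP: (z01 n) => z0 _; exact: exprn_ge0.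
  set m := (n * 2 ^ n)%N.
  (* With [z = y^n]: [(1 - z)^m (1 + m z) <= (1 - z)^m (1 + z)^m = (1 - z^2)^m <= 1]. *)
  have H : (1 - y ^+ n) ^+ m * (1 + m%:R * y ^+ n) <= 1.
    have /andP[z0 z1] := z01 n.
    rewrite (le_trans (ler_wpM2l (exprn_ge0 _ z0) (Bernoulli_pos m _)))//.
      by rewrite exprn_ge0.
    rewrite -exprMn exprn_ile1//; last by rewrite -subr_sqr expr1n gerBl sqr_ge0.
    by rewrite mulr_ge0// addr_ge0// exprn_ge0.
  have H2 : n.+1%:R <= 1 + m%:R * y ^+ n.
    rewrite E -natr1 addrC lerD2l ler_peMr// exprn_ege1//; lra.
  rewrite /harmonic/= -(@ler_pM2r _ n.+1%:R)// mulVf// (le_trans _ H)// ler_wpM2l//.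
  by apply: exprn_ge0; case/andP: (z01 n).
- rewrite -[X in _ --> X](subrr 1); apply: cvgB; first exact: cvg_cst.
  apply: (@squeeze_cvgr _ _ _ _ (fun n => 1 - n%:R * (2 * y) ^+ n) (cst 1)); last exact: cvg_cst.
  + apply: nearW => n; apply/andP; split; last first.
      by case/andP: (z01 n) => *; exact: exprn_ile1.
    by rewrite -E; apply: Bernoulli_neg.
  + rewrite -[X in _ --> X](subr0 1); apply: cvgB; first exact: cvg_cst.
    by apply: cvg_mulrn_expr; apply/andP; split; lra.
Qed.

End limits.

Section cosine_class.
Context {R : realType}.
Variable C : set (R -> R).
Hypothesis C1 : C (cst 1).
Hypothesis Ccos : forall f l, C f -> C (fun x => f x * cos (l * x)).
Hypothesis Clin : forall f g a b, C f -> C g -> C (fun x => a * f x + b * g x).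
Hypothesis Clim : forall (F : nat -> R -> R) g, (forall n, C (F n)) ->
  (forall n x, `|F n x| <= 1) -> (forall x, F n x @[n --> \oo] --> g x) -> C g.

(** [C] itself is not assumed to be closed under products. Its multipliers form an algebra
    containing the constants and all [cos (l x)], hence every polynomial in [(1 + cos (l x)) / 2];
    the threshold 1/2 of this quantity is the condition [cos (l x) >= 0]. *)
Let M := [set g : R -> R | forall f, C f -> C (fun x => f x * g x)].

Let Mcst a : M (cst a).
Proof.
move=> f Cf; rewrite (_ : (fun x => _) = (fun x => a * f x + 0 * f x)); first exact: Clin.
by apply/funext => x; rewrite mul0r addr0 mulrC.
Qed.

Let Mlin g h a b : M g -> M h -> M (fun x => a * g x + b * h x).
Proof.
move=> Mg Mh f Cf.
rewrite (_ : (fun x => _) = (fun x => a * (f x * g x) + b * (f x * h x))).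
  by apply: Clin; [exact: Mg|exact: Mh].
by apply/funext => x; ring.
Qed.

Let MM g h : M g -> M h -> M (fun x => g x * h x).
Proof.
move=> Mg Mh f Cf; rewrite (_ : (fun x => _) = (fun x => (f x * g x) * h x)).
  exact/Mh/Mg.
by apply/funext => x; rewrite mulrA.
Qed.

Let MX g n : M g -> M (fun x => g x ^+ n).
Proof.
move=> Mg; elim: n => [|n IH]; first exact: Mcst.
by rewrite (_ : (fun x => _) = (fun x => g x * g x ^+ n)); [exact: MM|apply/funext => x; rewrite exprS].
Qed.

Let Mthreshold l n : M (fun x => threshold_poly n ((1 + cos (l * x)) / 2)).
Proof.
have My : M (fun x => (1 + cos (l * x)) / 2).
  rewrite (_ : (fun x => _) = (fun x => 2^-1 * cst 1 x + 2^-1 * cos (l * x))).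
    by apply: Mlin => //; move=> f; exact: Ccos.
  by apply/funext => x /=; field.
have Mz : M (fun x => 1 - ((1 + cos (l * x)) / 2) ^+ n).
  rewrite (_ : (fun x => _) = (fun x => 1 * cst 1 x + (-1) * ((1 + cos (l * x)) / 2) ^+ n)).
    by apply: Mlin => //; exact: MX.
  by apply/funext => x /=; ring.
rewrite (_ : (fun x => _) = (fun x => 1 * cst 1 x + (-1) * (1 - ((1 + cos (l * x)) / 2) ^+ n) ^+ (n * 2 ^ n))).
  by apply: Mlin => //; exact: MX.
by apply/funext => x /=; rewrite /threshold_poly; ring.
Qed.

Let Ccos_ge0 f l : C f -> (forall x, `|f x| <= 1) -> C (fun x => f x * (0 <= cos (l * x))%R%:R).
Proof.
move=> Cf f1.
have y01 x : 0 <= (1 + cos (l * x)) / 2 <= 1.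
  have := cos_geN1 (l * x); have := cos_le1 (l * x) => ? ?.
  by apply/andP; split; lra.
apply: (Clim (F := fun n x => f x * threshold_poly n ((1 + cos (l * x)) / 2))).
- by move=> n; exact: Mthreshold.
- move=> n x; rewrite normrM mulr_ile1//.
  by have /andP[? ?] := threshold_poly_itv n (y01 x); rewrite ger0_norm.
- move=> x; apply: cvgM; first exact: cvg_cst.
  have -> : (0 <= cos (l * x)) = (2^-1 <= (1 + cos (l * x)) / 2).
    by apply/idP/idP => ?; lra.
  exact: cvg_threshold_poly.
Qed.

(* The interval [|x| <= r] is where all the [cos (pi x / (2 r 2^k))] are nonnegative. Reaching
   indicators from cosines by products and bounded limits replaces the uniqueness theorem for
   characteristic functions. *)
Lemma cosine_class_indic (r : R) : 0 < r -> C (fun x => (`|x| <= r)%R%:R).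
Proof.
move=> r0; have p0 : 0 < pi :> R := pi_gt0 R.
have [th thr th0] : exists2 th, th * r = pi / 2 & 0 < th.
  by exists (pi / 2 / r); [rewrite divfK ?gt_eqF|rewrite !divr_gt0].
(* Since [th * r = pi / 2], for [|x| <= r] all the angles [th |x| / 2^k] stay below [pi / 2] and
   every factor is 1. *)
pose F n x := \prod_(k < n) (0 <= cos (th / 2 ^+ k * x))%R%:R : R.
have F1 n x : `|F n x| <= 1.
  rewrite /F; apply: (big_ind (fun z : R => `|z| <= 1)) => [|y z y1 z1|k _]; first by rewrite normr1.
    by rewrite normrM mulr_ile1.
  by case: (0 <= cos _); rewrite ?normr1 ?normr0.
have CF n : C (F n).
  elim: n => [|n IH].
    by rewrite (_ : F 0 = cst 1)//; apply/funext => x; rewrite /F big_ord0.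
  rewrite (_ : F n.+1 = fun x => F n x * (0 <= cos (th / 2 ^+ n * x))%R%:R).
    exact: Ccos_ge0.
  by apply/funext => x; rewrite /F big_ord_recr.
apply: (Clim CF F1) => x.
have [xr|xr] := leP `|x| r.
  rewrite (_ : F ^~ x = cst 1); first exact: cvg_cst.
  apply/funext => n; rewrite /F /= big1// => k _.
  rewrite -cos_norm cos_ge0_pihalf//; apply/andP; split.
    by rewrite (@le_trans _ _ 0)// oppr_le0 divr_ge0// ltW.
  have hk0 : 0 <= th / 2 ^+ k by rewrite divr_ge0 ?exprn_ge0 ?(ltW th0).
  have hk : th / 2 ^+ k <= th.
    by rewrite ler_pdivrMr ?exprn_gt0// ler_peMr ?(ltW th0)// exprn_ege1// ler1n.
  by rewrite -thr normrM ger0_norm// ler_pM.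
(* For [|x| > r] choose [k] with [2^k r < |x| <= 2^(k+1) r]: the angle [th |x| / 2^k] then lies in
   []pi / 2, pi]], so the factor of index [k] vanishes. *)
have exk : exists k, `|x| <= 2 ^+ k.+1 * r.
  exists (archi_bound (`|x| / r)).
  rewrite -ler_pdivrMr// ltW// upper_nthrootP//.
pose k := ex_minn exk.
have [kx kmin] : `|x| <= 2 ^+ k.+1 * r /\ 2 ^+ k * r < `|x|.
  rewrite /k; case: ex_minnP => m m1 m2; split => //.
  case: m m1 m2 => [|m] m1 m2; first by rewrite expr0 mul1r.
  by rewrite ltNge; apply/negP => /m2; rewrite ltnn.
have cneg : cos (th / 2 ^+ k * x) < 0.
  rewrite -cos_norm normrM ger0_norm ?divr_ge0 ?exprn_ge0 ?(ltW th0)//.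
  set y := _ * `|x|.
  have y1 : pi / 2 < y.
    rewrite -thr /y mulrAC ltr_pdivlMr ?exprn_gt0//.
    by rewrite -mulrA ltr_pM2l// mulrC.
  have y2 : y <= pi.
    have -> : pi = 2 * (th * r) by rewrite thr; field.
    rewrite /y mulrAC ler_pdivrMr ?exprn_gt0//.
    have -> : 2 * (th * r) * 2 ^+ k = th * (2 ^+ k.+1 * r) by rewrite exprS; ring.
    by rewrite ler_pM2l.
  have yI : y \in `[0, pi] by rewrite in_itv/=; apply/andP; split; lra.
  have pI : (pi / 2 : R) \in `[0, pi] by rewrite in_itv/=; apply/andP; split; lra.
  by rewrite -[X in _ < X](cos_pihalf R) ltr_cos.
have Fx0 : \forall n \near \oo, F n x = 0.
  exists k.+1 => // n /= kn.
  by rewrite /F (bigD1 (Ordinal kn))//= leNgt cneg/= mul0r.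
rewrite mulr0n; apply/cvgrPdist_lt => e e0; near=> n.
rewrite (_ : F n x = 0) ?subrr ?normr0//; near: n; exact: Fx0.
Unshelve. all: by end_near.
Qed.

End cosine_class.

Lemma cvg_Rintegral_bounded {R : realType} d (T : measurableType d)
    (P : probability T R) (f_ : nat -> T -> R) (f : T -> R) (C : R) :
  (forall n, measurable_fun setT (f_ n)) ->
  (forall n w, `|f_ n w| <= C) ->
  (forall w, f_ n w @[n --> \oo] --> f w) ->
  \int[P]_w f_ n w @[n --> \oo] --> \int[P]_w f w.
Proof.
move=> mf fC ff.
have mlim : measurable_fun setT f by apply: measurable_fun_cvg => // w _; exact: ff.
have fC' w : `|f w| <= C.
  rewrite -(cvg_lim _ (cvg_norm (ff w)))//; apply: limr_le.
    by apply: is_cvg_norm; apply/cvg_ex; exists (f w).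
  exact: nearW.
have If : P.-integrable setT (EFin \o f) by exact: bounded_integrable fC'.
have := @dominated_cvg _ _ _ P setT measurableT (fun n w => (f_ n w)%:E)
  (EFin \o f) (cst C%:E).
move=> H; apply: fine_cvg; rewrite fineK; last exact: integrable_fin_num.
apply: H => //.
- by move=> n; exact/measurable_EFinP.
- by move=> w _; apply: cvg_EFin; [exact: nearW|exact: ff].
- exact: finite_measure_integrable_cst.
- by move=> n w _; rewrite /= lee_fin.
Qed.

Lemma cos_mul_cos {R : realType} (a b : R) :
  cos a * cos b = (cos (a + b) + cos (a - b)) / 2.
Proof. by rewrite cosB cosD; field. Qed.

Section box_probability.
Context {R : realType} {d1 d2 : measure_display}.
Context {T1 : measurableType d1} {T2 : measurableType d2}.
Variables (P1 : probability T1 R) (P2 : probability T2 R) (J : finType).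
Variables (U : J -> T1 -> R) (V : J -> T2 -> R).
Hypothesis mU : forall j, measurable_fun setT (U j).
Hypothesis mV : forall j, measurable_fun setT (V j).
Hypothesis cosUV : forall c : J -> R,
  \int[P1]_w cos (\sum_j c j * U j w) = \int[P2]_w cos (\sum_j c j * V j w).

Let box (r : J -> R) (s : seq J) T (X : J -> T -> R) (w : T) : R :=
  \prod_(j <- s) (`|X j w| <= r j)%R%:R.

Let box_bound r s T (X : J -> T -> R) w : `|box r s X w| <= 1.
Proof.
apply: (big_ind (fun z : R => `|z| <= 1)) => [|y z y1 z1|k _].
- by rewrite normr1.
- by rewrite normrM mulr_ile1.
- by case: (`|X k w| <= r k); rewrite ?normr1 ?normr0.
Qed.

Let measurable_le_abs d (T : measurableType d) (X : T -> R) (r : R) :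
  measurable_fun setT X -> measurable_fun setT (fun w => (`|X w| <= r)%R%:R : R).
Proof.
move=> mX.
rewrite (_ : (fun w => _) = \1_(X @^-1` `[-r, r])).
  apply: measurable_indic; rewrite -[X in measurable X]setTI.
  exact: mX.
apply/funext => w; rewrite indicE; congr (_%:R); congr nat_of_bool.
by apply/idP/idP; rewrite inE /= in_itv/= ler_norml.
Qed.

Let measurable_box d (T : measurableType d) (X : J -> T -> R) r s :
  (forall j, measurable_fun setT (X j)) -> measurable_fun setT (box r s X).
Proof.
move=> mX; elim: s => [|j s IH].
  by rewrite (_ : box _ _ _ = cst 1)//; apply/funext => w; rewrite /box big_nil.
rewrite (_ : box _ _ _ = fun w => (`|X j w| <= r j)%R%:R * box r s X w).
  apply: measurable_funM => //; exact: measurable_le_abs.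
by apply/funext => w; rewrite /box big_cons.
Qed.

Let measurable_lin d (T : measurableType d) (X : J -> T -> R) (c : J -> R) :
  (forall j, measurable_fun setT (X j)) ->
  measurable_fun setT (fun w => cos (\sum_j c j * X j w)).
Proof.
move=> mX; apply: (@measurable_comp _ _ _ _ _ _ setT (cos : R -> R)) => //.
  by apply: continuous_measurable_fun; exact: continuous_cos.
by apply: measurable_sum => j; exact: measurable_funM.
Qed.

(** Induction on the coordinates already cut off by an indicator. For the next coordinate [j], the
    functions [g] for which the identity holds with [g (X j)] inserted form a cosine class. The
    statement is for all [c] at once because, by the product-to-sum formula, multiplying by
    [cos (l * X j)] only shifts the coefficient [c j] by [l] and by [- l]. *)
Lemma box_cos (r : J -> R) (s : seq J) (c : J -> R) : (forall j, 0 < r j) ->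
  \int[P1]_w (box r s U w * cos (\sum_j c j * U j w)) =
  \int[P2]_w (box r s V w * cos (\sum_j c j * V j w)).
Proof.
move=> r0; elim: s c => [c|j s IH c].
  under eq_Rintegral do rewrite /box big_nil mul1r.
  by under [RHS]eq_Rintegral do rewrite /box big_nil mul1r.
pose I d (T : measurableType d) (P : probability T R) (X : J -> T -> R) (c : J -> R) (g : R -> R) : R :=
  \int[P]_w (g (X j w) * (box r s X w * cos (\sum_j c j * X j w))).
pose C := [set g : R -> R | [/\ measurable_fun setT g,
   exists B : R, forall x : R, `|g x| <= B & forall c : J -> R, I _ _ P1 U c g = I _ _ P2 V c g]].
have Iint d (T : measurableType d) (P : probability T R) (X : J -> T -> R) (e : J -> R) (g : R -> R) (B : R) :
    (forall j, measurable_fun setT (X j)) -> measurable_fun setT g ->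
    (forall x, `|g x| <= B) ->
    P.-integrable setT (EFin \o (fun w => g (X j w) * (box r s X w * cos (\sum_j e j * X j w)))).
  move=> mX mg gB; apply: (@bounded_integrable _ _ _ P _ B).
    apply: measurable_funM; first exact: measurableT_comp.
    by apply: measurable_funM; [exact: measurable_box|exact: measurable_lin].
  move=> w; rewrite normrM -[leRHS]mulr1 ler_pM// normrM mulr_ile1//.
  exact: cos_max.
have Icos d (T : measurableType d) (P : probability T R) (X : J -> T -> R) (e : J -> R) (g : R -> R) (B l : R) :
    (forall j, measurable_fun setT (X j)) -> measurable_fun setT g ->
    (forall x, `|g x| <= B) ->
    I _ _ P X e (fun x => g x * cos (l * x)) =
    (I _ _ P X (fun i => e i + l * (i == j)%:R) g +
     I _ _ P X (fun i => e i - l * (i == j)%:R) g) / 2.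
  move=> mX mg gB; rewrite /I -RintegralD//; [|exact: Iint gB..].
  rewrite -RintegralZr//; last first.
    exact: (integrableD measurableT (Iint _ _ _ _ _ _ _ mX mg gB)
      (Iint _ _ _ _ _ _ _ mX mg gB)).
  apply: eq_Rintegral => w _.
  have E b : \sum_i (e i + b * (i == j)%:R) * X i w = \sum_i e i * X i w + b * X j w.
    under eq_bigr do rewrite mulrDl.
    rewrite big_split/=; congr (_ + _).
    rewrite (bigD1 j)//= eqxx mulr1 big1 ?addr0// => i /negbTE ->.
    by rewrite mulr0 mul0r.
  rewrite E; under [X in _ + _ * (_ * cos X)]eq_bigr do rewrite -mulNr.
  rewrite E mulNr -!mulrDr -!mulrA [in RHS]mulrDl -mulrDl -cos_mul_cos; ring.
have Cind : C (fun x => (`|x| <= r j)%R%:R).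
  apply: cosine_class_indic => //.
  - split; first exact: measurable_cst.
      by exists 1 => x; rewrite /= normr1.
    move=> e; rewrite /I.
    under eq_Rintegral do rewrite /= mul1r.
    by under [RHS]eq_Rintegral do rewrite /= mul1r.
  - move=> f l [mf [B fB] fI]; split.
    + apply: measurable_funM => //.
      apply: (@measurable_comp _ _ _ _ _ _ setT (cos : R -> R)) => //.
        by apply: continuous_measurable_fun; exact: continuous_cos.
    + exists B => x; rewrite normrM -[leRHS]mulr1 ler_pM//.
      exact: cos_max.
    + by move=> e; rewrite (Icos _ _ _ _ _ _ B)// (Icos _ _ _ _ _ _ B)// !fI.
  - move=> f g a b [mf [Bf fB] fI] [mg [Bg gB] gI]; split.
    + by apply: measurable_funD; apply: measurable_funM.
    + exists (`|a| * Bf + `|b| * Bg) => x.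
      by rewrite (le_trans (ler_normD _ _))// !normrM lerD// ler_pM.
    + have L d (T : measurableType d) (P : probability T R) (X : J -> T -> R) (e : J -> R) :
        (forall j, measurable_fun setT (X j)) ->
        I _ _ P X e (fun x => a * f x + b * g x) = a * I _ _ P X e f + b * I _ _ P X e g.
        move=> mX; rewrite /I -!RintegralZl//; [|exact: Iint gB|exact: Iint fB].
        rewrite -RintegralD//; last 2 first.
        * exact: integrableZl (Iint _ _ _ _ _ _ _ mX mf fB).
        * exact: integrableZl (Iint _ _ _ _ _ _ _ mX mg gB).
        by apply: eq_Rintegral => w _; ring.
      by move=> e; rewrite !L// fI gI.
  - move=> F g CF F1 Fg; split.
    + by apply: measurable_fun_cvg => [n|x _]; [case: (CF n)|exact: Fg].
    + exists 1 => x; rewrite -(cvg_lim _ (cvg_norm (Fg x)))//; apply: limr_le.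
        by apply: is_cvg_norm; apply/cvg_ex; exists (g x).
      exact: nearW.
    + have L d (T : measurableType d) (P : probability T R) (X : J -> T -> R) (e : J -> R) :
        (forall j, measurable_fun setT (X j)) ->
        I _ _ P X e (F n) @[n --> \oo] --> I _ _ P X e g.
        move=> mX; apply: (@cvg_Rintegral_bounded _ _ _ _ _ _ 1).
        * move=> n; apply: measurable_funM.
            by apply: measurableT_comp => //; case: (CF n).
          by apply: measurable_funM; [exact: measurable_box|exact: measurable_lin].
        * move=> n w; rewrite normrM mulr_ile1// normrM mulr_ile1//.
          exact: cos_max.
        * by move=> w; apply: cvgM; [exact: Fg|exact: cvg_cst].
      move=> e; rewrite -(cvg_lim _ (L _ _ P1 U e mU))// -(cvg_lim _ (L _ _ P2 V e mV))//.
      have E : (fun n => I _ _ P1 U e (F n)) = (fun n => I _ _ P2 V e (F n)).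
        by apply/funext => n; case: (CF n) => _ _; exact.
      by rewrite E.
case: Cind => _ _ /(_ c); rewrite /I => H.
under eq_Rintegral do rewrite /box big_cons -mulrA.
by under [RHS]eq_Rintegral do rewrite /box big_cons -mulrA.
Qed.

Lemma box_probability (A : {pred J}) (r : J -> R) : (forall j, 0 < r j) ->
  P1 [set w | forall j, j \in A -> `|U j w| <= r j] =
  P2 [set w | forall j, j \in A -> `|V j w| <= r j].
Proof.
move=> r0.
have L d (T : measurableType d) (P : probability T R) (X : J -> T -> R) :
   (forall j, measurable_fun setT (X j)) ->
   P [set w | forall j, j \in A -> `|X j w| <= r j] =
   (\int[P]_w (box r (enum A) X w * cos (\sum_j 0 * X j w)))%:E.
  move=> mX; set S := [set w | _].
  have boxE w : box r (enum A) X w = \1_S w.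
    rewrite /box indicE; case: (boolP (w \in S)) => [|/negP]; rewrite inE => Sw.
      by rewrite big1_seq// => j /=; rewrite mem_enum => /Sw ->.
    have [j jA jX] : exists2 j, j \in A & ~~ (`|X j w| <= r j).
      apply: contrapT => H; apply: Sw => j jA; apply/negP => /negP jX.
      by apply: H; exists j.
    apply/eqP; rewrite prodf_seq_eq0; apply/hasP; exists j; first by rewrite mem_enum.
    by rewrite /= (negbTE jX).
  have mS : measurable S.
    have -> : S = (box r (enum A) X) @^-1` [set 1].
      apply/seteqP; split => w /=; rewrite boxE indicE.
        by move=> Sw; rewrite mem_set.
      by case: (boolP (w \in S)) => [|_ /eqP]; [rewrite inE|rewrite eq_sym oner_eq0].
    rewrite -[X in measurable X]setTI; exact: (measurable_box _ _ mX).
  rewrite (@eq_Rintegral _ _ _ _ _ (\1_S)).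
    rewrite /Rintegral integral_indic// setIT fineK//.
    by rewrite fin_num_measure.
  move=> w _; rewrite boxE big1 ?cos0 ?mulr1// => j _; exact: mul0r.
by rewrite !L// box_cos.
Qed.

End box_probability.

(** * Fernique's inequality *)

Section product_probability.
Local Open Scope ereal_scope.
Context {R : realType} {d1 d2 : measure_display}.
Context {T1 : measurableType d1} {T2 : measurableType d2}.
Variables (P1 : probability T1 R) (P2 : probability T2 R).

Definition prod_probability : set (T1 * T2) -> \bar R := P1 \x P2.

HB.instance Definition _ := Measure.on prod_probability.

Let prod_probability_setT : prod_probability setT = 1.
Proof.
rewrite -setXTT [LHS]product_measure1E//.
by rewrite [X in X * _](@probability_setT _ _ _ P1) [X in _ * X](@probability_setT _ _ _ P2) mule1.
Qed.

HB.instance Definition _ :=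
  Measure_isProbability.Build _ _ _ prod_probability prod_probability_setT.

Lemma prod_probabilityE (A : set T1) (B : set T2) :
  measurable A -> measurable B -> prod_probability (A `*` B) = P1 A * P2 B.
Proof. exact: product_measure1E. Qed.

Local Open Scope ring_scope.

Lemma Rintegral_prod_cos (A : T1 -> R) (B : T2 -> R) :
  measurable_fun setT A -> measurable_fun setT B ->
  \int[prod_probability]_w cos (A w.1 + B w.2) =
  (\int[P1]_x cos (A x)) * (\int[P2]_y cos (B y)) -
  (\int[P1]_x sin (A x)) * (\int[P2]_y sin (B y)).
Proof.
move=> mA mB.
have mcosE d (T : measurableType d) (X : T -> R) : measurable_fun setT X ->
    measurable_fun setT (fun w => cos (X w)).
  move=> mX; apply: (@measurable_comp _ _ _ _ _ _ setT (cos : R -> R)) => //.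
  by apply: continuous_measurable_fun; exact: continuous_cos.
have msinE d (T : measurableType d) (X : T -> R) : measurable_fun setT X ->
    measurable_fun setT (fun w => sin (X w)).
  move=> mX; apply: (@measurable_comp _ _ _ _ _ _ setT (sin : R -> R)) => //.
  by apply: continuous_measurable_fun; exact: continuous_sin.
have mAB : measurable_fun setT (fun w : T1 * T2 => A w.1 + B w.2).
  by apply: measurable_funD; apply: measurableT_comp.
have I : prod_probability.-integrable setT (fun w => (cos (A w.1 + B w.2))%:E).
  apply: (@bounded_integrable _ _ _ prod_probability _ 1); first exact: mcosE.
  by move=> w; exact: cos_max.
have Ic2 : P2.-integrable setT (EFin \o (fun y => cos (B y))).
  by apply: (@bounded_integrable _ _ _ P2 _ 1) => [|w]; [exact: mcosE|exact: cos_max].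
have Is2 : P2.-integrable setT (EFin \o (fun y => sin (B y))).
  by apply: (@bounded_integrable _ _ _ P2 _ 1) => [|w]; [exact: msinE|exact: sin_max].
have Ic1 : P1.-integrable setT (EFin \o (fun y => cos (A y))).
  by apply: (@bounded_integrable _ _ _ P1 _ 1) => [|w]; [exact: mcosE|exact: cos_max].
have Is1 : P1.-integrable setT (EFin \o (fun y => sin (A y))).
  by apply: (@bounded_integrable _ _ _ P1 _ 1) => [|w]; [exact: msinE|exact: sin_max].
rewrite /Rintegral -(@integral12_prod_meas1 _ _ _ _ _ P1 P2 _ I) /fubini_F.
have IB (a b : R) : P2.-integrable setT
    (EFin \o (fun y => a * cos (B y) - b * sin (B y))).
  exact: (integrableB measurableT (integrableZl measurableT a Ic2) (integrableZl measurableT b Is2)).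
transitivity (\int[P1]_x (cos (A x) * \int[P2]_y cos (B y) - sin (A x) * \int[P2]_y sin (B y))).
  congr fine; apply: eq_integral => x _ /=.
  rewrite -RintegralZl// -RintegralZl// -RintegralB//; last 2 first.
  - exact: integrableZl Ic2.
  - exact: integrableZl Is2.
  rewrite /Rintegral fineK; last exact: (integrable_fin_num measurableT (IB _ _)).
  by apply: eq_integral => y _; rewrite cosD.
rewrite RintegralB//; last 2 first.
- exact: (integrableZr measurableT _ Ic1).
- exact: (integrableZr measurableT _ Is1).
by rewrite RintegralZr// RintegralZr.
Qed.

End product_probability.

Lemma measurable_abs_le_family {R : realType} d (T : measurableType d) (I : finType)
    (A : {pred I}) (r : I -> R) (X : I -> T -> R) :
  (forall i, measurable_fun setT (X i)) ->
  measurable [set w | forall i, i \in A -> `|X i w| <= r i].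
Proof.
move=> mX.
rewrite (_ : [set w | _] = \bigcap_(i in [set i | i \in A]) (X i @^-1` `[- r i, r i])).
  apply: fin_bigcap_measurable => // i _; rewrite -[X in measurable X]setTI.
  exact: mX.
by apply/seteqP; split => w /= H i iA; have := H i iA; rewrite /= in_itv/= -ler_norml.
Qed.

Section gaussian_family.
Context {R : realType} {dO : measure_display} {Omega : measurableType dO}.
Variables (P : probability Omega R) (I : finType) (Y : I -> Omega -> R).
Hypothesis gY : forall c : I -> R, centered_gaussian P (fun w => \sum_i c i * Y i w).

Let PP : probability (Omega * Omega)%type R := prod_probability P P.

Let gYi i : centered_gaussian P (Y i).
Proof.
have := gY (fun j => (j == i)%:R); congr centered_gaussian.
apply/funext => w; rewrite (bigD1 i)//= eqxx mul1r big1 ?addr0// => j /negbTE ->.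
by rewrite mul0r.
Qed.

Let mY i : measurable_fun setT (Y i). Proof. exact: cg_measurable (gYi i). Qed.

Let prod_cos (A B : Omega -> R) : centered_gaussian P A -> centered_gaussian P B ->
  \int[PP]_w cos (A w.1 + B w.2) =
  expR (- ((\int[P]_w (A w ^+ 2) + \int[P]_w (B w ^+ 2)) / 2)).
Proof.
move=> gA gB; rewrite Rintegral_prod_cos; [|exact: cg_measurable gA|exact: cg_measurable gB].
by rewrite (cg_sin gA) mul0r subr0 !cg_cos// -expRD; congr expR; field.
Qed.

Let r2 : R := Num.sqrt 2.
Let r2E : r2 ^+ 2 = 2. Proof. by rewrite sqr_sqrtr. Qed.
Let r20 : 0 < r2. Proof. by rewrite sqrtr_gt0. Qed.

Let lin (c : I -> R) w := \sum_i c i * Y i w.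

(** Rotating the pair [(Y, Y')] by 45 degrees preserves the total variance of every linear form. As
    [prod_cos] shows that the characteristic function depends on this variance alone, the rotated
    pair [U] and the pair [V] have equal characteristic functions. *)
Let parallelogram (a b : I -> R) :
  \int[P]_w (lin (fun i => (a i + b i) / r2) w ^+ 2) +
  \int[P]_w (lin (fun i => (b i - a i) / r2) w ^+ 2) =
  \int[P]_w (lin a w ^+ 2) + \int[P]_w (lin b w ^+ 2).
Proof.
rewrite -!RintegralD//; try exact: cg_sqr_integrable (gY _).
apply: eq_Rintegral => w _.
have -> : lin (fun i => (a i + b i) / r2) w = (lin a w + lin b w) / r2.
  by rewrite /lin -big_split/= mulr_suml; apply: eq_bigr => i _; ring.
have -> : lin (fun i => (b i - a i) / r2) w = (lin b w - lin a w) / r2.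
  by rewrite /lin -sumrB mulr_suml; apply: eq_bigr => i _; ring.
by rewrite !expr_div_n r2E; field.
Qed.

Let U (j : I + I) (w : Omega * Omega) : R := match j with
  | inl i => (Y i w.1 - Y i w.2) / r2
  | inr i => (Y i w.1 + Y i w.2) / r2 end.

Let V (j : I + I) (w : Omega * Omega) : R := match j with
  | inl i => Y i w.1 | inr i => Y i w.2 end.

Let mU j : measurable_fun setT (U j).
Proof.
by case: j => i; apply: measurable_funM => //;
  [apply: measurable_funB|apply: measurable_funD]; apply: measurableT_comp.
Qed.

Let mV j : measurable_fun setT (V j).
Proof. by case: j => i; apply: measurableT_comp. Qed.

Let cosUV (c : I + I -> R) :
  \int[PP]_w cos (\sum_j c j * U j w) = \int[PP]_w cos (\sum_j c j * V j w).
Proof.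
transitivity (\int[PP]_w cos (lin (fun i => (c (inl i) + c (inr i)) / r2) w.1 +
   lin (fun i => (c (inr i) - c (inl i)) / r2) w.2)).
  apply: eq_Rintegral => w _; congr cos.
  rewrite big_sumType/= /lin -!big_split/=; apply: eq_bigr => i _; ring.
transitivity (\int[PP]_w cos (lin (c \o inl) w.1 + lin (c \o inr) w.2)).
  rewrite !prod_cos; try exact: gY.
  by rewrite parallelogram.
by apply: eq_Rintegral => w _; congr cos; rewrite big_sumType.
Qed.

Let E t := [set w | forall i, `|Y i w| <= t].

(* For an independent copy [Y'], the pair [((Y - Y') / sqrt 2, (Y + Y') / sqrt 2)] has the law
   of [(Y, Y')]. *)
Lemma fernique_step (s t : R) : 0 < s -> 0 < t ->
  (P (E s) * P (~` (E t)) <= P (~` (E ((t - s) / r2)%R)) ^+ 2)%E.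
Proof.
move=> s0 t0; set tau := (t - s) / r2.
have mE u : measurable (E u).
  have := measurable_abs_le_family predT (fun=> u) mY.
  by congr measurable; apply/seteqP; split => w H i *; exact: H.
pose r (j : I + I) := match j with inl _ => s | inr _ => t end.
have rp j : 0 < r j by case: j.
(* The difference [S L V] minus [S predT V] says that the first copy is within [s] and the second is
   not within [t]: a product event. The same difference for [U] forces both copies out of the box of
   size [tau]. *)
pose L := [pred j : I + I | if j is inl _ then true else false].
have B1 := box_probability mU mV cosUV L rp.
have B2 := box_probability mU mV cosUV predT rp.
pose S (A : {pred I + I}) (X : I + I -> Omega * Omega -> R) : set (Omega * Omega) :=
  [set w | forall j, j \in A -> `|X j w| <= r j].
have mZ (X : I + I -> Omega * Omega -> R) (A : {pred I + I}) :
    (forall j, measurable_fun setT (X j)) -> measurable (S A X).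
  by move=> mX; exact: measurable_abs_le_family.
have D (X : I + I -> Omega * Omega -> R) : (forall j, measurable_fun setT (X j)) ->
    PP (S L X `\` S predT X) = (PP (S L X) - PP (S predT X))%E.
  move=> mX; rewrite measureD; [|exact: mZ..|]; last first.
    by rewrite -ge0_fin_numE ?fin_num_measure//; exact: mZ.
  rewrite (_ : _ `&` _ = S predT X)//.
  by apply/seteqP; split => [w []//|w H]; split => // j _; exact: H.
have -> : (P (E s) * P (~` E t))%E =
    PP (S L V `\` S predT V).
  rewrite -prod_probabilityE; [|exact: mE|exact/measurableC/mE].
  congr (PP _); apply/seteqP; split => [[x y] [/= Ex nEy]|[x y] [/= Ex nE]]; split => /=.
  - by case=> i // _; exact: Ex.
  - by move=> H; apply: nEy => i; exact: (H (inr i)).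
  - by move=> i; exact: (Ex (inl i)).
  - by move=> Ey; apply: nE => -[i|i] _; [exact: (Ex (inl i))|exact: Ey].
rewrite D// -[PP (S L V)]B1 -[PP (S predT V)]B2 -[X in (X <= _)%E]D//.
apply: (@le_trans _ _ (PP (~` E tau `*` ~` E tau))); last first.
  by rewrite [leLHS](prod_probabilityE P P (measurableC (mE tau)) (measurableC (mE tau))) expe2.
apply: le_measure; rewrite ?inE.
- by apply: measurableD; exact: mZ.
- by apply: measurableX; exact/measurableC/mE.
move=> [x y] [/= Ex nE].
have [i it] : exists i, t < `|(Y i x + Y i y) / r2|.
  apply: contrapT => H; apply: nE => -[i|i] _; first exact: (Ex (inl i)).
  by rewrite leNgt; apply/negP => it; apply: H; exists i.
have hs := Ex (inl i) isT; rewrite /= in hs.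
rewrite normrM in it; rewrite normrM in hs.
rewrite [`|r2^-1|]gtr0_norm ?invr_gt0// ltr_pdivlMr// in it.
rewrite [`|r2^-1|]gtr0_norm ?invr_gt0// ler_pdivrMr// in hs.
(* From [2 |a| >= |a + b| - |a - b| > (t - s) r2]; the roles of the two copies are symmetric. *)
have key (a b : R) : t * r2 < `|a + b| -> `|a - b| <= s * r2 -> tau < `|a|.
  move=> h1 h2; rewrite /tau ltr_pdivrMr//.
  have h3 : `|a + b| <= `|a| *+ 2 + `|a - b|.
    rewrite -normrMn (_ : a + b = a *+ 2 - (a - b)) ?ler_normB//.
    by rewrite mulr2n; ring.
  have h4 : (t - s) * r2 < `|a| *+ 2 by rewrite mulrBl; lra.
  have : (t - s) * r2 * r2 < `|a| *+ 2 * r2 by rewrite ltr_pM2r.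
  rewrite -[_ * r2 * r2]mulrA -expr2 r2E mulrnAl -[X in _ < X]mulr_natr; lra.
have i1 : tau < `|Y i x| by exact: key it hs.
have i2 : tau < `|Y i y| by rewrite addrC in it; rewrite distrC in hs; exact: key it hs.
by split => /= /(_ i); rewrite leNgt ?i1 ?i2.
Qed.

End gaussian_family.

(** Along [t_0 = s], [t_(k+1) = s + sqrt 2 * t_k] the hypothesis reads
    [(4/3) p t_(k+1) <= ((4/3) p t_k)^2], and the start is at most 1/3, whence [(1/3)^(2^k)]. As
    [t_k] grows like [2^(k/2)], this is Gaussian decay in [r / s]. *)
Lemma fernique_iteration {R : realType} (p : R -> R) (s r : R) : 0 < s -> 4 * s <= r ->
  (forall t, 0 <= p t) -> (forall t t', t <= t' -> p t' <= p t) ->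
  p s <= 1 / 4 ->
  (forall t, 0 < t -> 3 / 4 * p t <= p ((t - s) / Num.sqrt 2) ^+ 2) ->
  p r <= expR (- (r ^+ 2 / (64 * s ^+ 2))).
Proof.
move=> s0 sr p0 pmono ps pstep; pose r2 : R := Num.sqrt 2.
have r2E : r2 ^+ 2 = 2 :> R by rewrite sqr_sqrtr.
have r20 : 0 < r2 :> R by rewrite sqrtr_gt0.
have r243 : 4 / 3 <= r2 :> R.
  by rewrite -ler_sqr ?nnegrE ?(ltW r20)// r2E; lra.
pose tk := fix f k := if k is k'.+1 then s + r2 * f k' else s.
have tk0 k : 0 < tk k by elim: k => [//|k IH] /=; rewrite addr_gt0// mulr_gt0.
(* The term [- 3 * s] makes the induction close; it needs [4 <= 3 * sqrt 2]. *)
have tkle k : tk k <= 4 * s * r2 ^+ k - 3 * s.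
  elim: k => [|k IH] /=; first by rewrite expr0; lra.
  have : r2 * tk k <= r2 * (4 * s * r2 ^+ k - 3 * s) by rewrite ler_pM2l.
  have : 4 / 3 * s <= r2 * s by rewrite ler_pM2r.
  rewrite exprS; lra.
have pk k : 4 / 3 * p (tk k) <= (1 / 3) ^+ (2 ^ k).
  elim: k => [|k IH]; first by rewrite /= expn0 expr1; lra.
  have tkS : (tk k.+1 - s) / r2 = tk k.
    by rewrite /= addrAC subrr add0r mulrAC divff ?mul1r ?gt_eqF.
  have := pstep _ (tk0 k.+1); rewrite -/r2 tkS => H.
  rewrite expnS mulnC exprM (le_trans (_ : _ <= (4 / 3 * p (tk k)) ^+ 2))//.
    by rewrite exprMn; lra.
  by rewrite lerXn2r ?nnegrE ?mulr_ge0 ?exprn_ge0.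
(* [k] is the last index with [4 s r2^k <= r], which exists since [4 s <= r]. Then
   [r^2 < 32 s^2 2^k], and together with [1/3 <= exp (- 1/2)] this gives the constant 64. *)
have exk : exists k, r < 4 * s * r2 ^+ k.+1.
  exists (2 * archi_bound (r / (4 * s)))%N.
  rewrite exprSr exprM r2E -ltr_pdivrMl ?mulr_gt0// mulrC.
  have h := @upper_nthrootP R (r / (4 * s)) _ (leqnn _).
  apply: (lt_le_trans h); rewrite ler_peMr ?exprn_ge0//; lra.
have [k rk kr] : exists2 k, r < 4 * s * r2 ^+ k.+1 & 4 * s * r2 ^+ k <= r.
  case: (ex_minnP exk) => m m1 m2; exists m => //.
  case: m m1 m2 => [|m] m1 m2; first by rewrite expr0 mulr1.
  by rewrite leNgt; apply/negP => /m2; rewrite ltnn.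
have ptk : p r <= p (tk k) by apply: pmono; have := tkle k; lra.
apply: (le_trans ptk); apply: (@le_trans _ _ ((1 / 3) ^+ (2 ^ k))).
  by apply: le_trans (pk k); have := p0 (tk k); lra.
have h13 : 1 / 3 <= expR (- (1 / 2)) :> R.
  by rewrite (le_trans _ (expR_ge1Dx _))//; lra.
apply: (@le_trans _ _ (expR (- (1 / 2)) ^+ (2 ^ k))).
  by rewrite lerXn2r ?nnegrE ?expR_ge0//; lra.
rewrite -expRM_natl ler_expR natrX mulrN lerN2.
rewrite ler_pdivrMr; last by rewrite mulr_gt0// exprn_gt0.
have rr : r ^+ 2 <= (4 * s * r2 ^+ k.+1) ^+ 2.
  rewrite lerXn2r ?nnegrE ?(ltW rk)//; first by rewrite (le_trans _ sr)// mulr_ge0// ltW.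
  by rewrite mulr_ge0 ?exprn_ge0 ?(ltW r20)// mulr_ge0 ?(ltW s0).
apply: (le_trans rr); rewrite !exprMn -exprM mulnC exprM r2E [2 ^+ k.+1]exprS; lra.
Qed.

Section fernique.
Context {R : realType} {dO : measure_display} {Omega : measurableType dO}.
Variable (P : probability Omega R).

Lemma fernique_finite (I : finType) (Y : I -> Omega -> R) (s r : R) :
  (forall c : I -> R, centered_gaussian P (fun w => \sum_i c i * Y i w)) ->
  0 < s -> 4 * s <= r ->
  ((3 / 4)%:E <= P [set w | forall i, (`|Y i w| <= s)%R])%E ->
  (P (~` [set w | forall i, (`|Y i w| <= r)%R]) <=
    (expR (- (r ^+ 2 / (64 * s ^+ 2))))%:E)%E.
Proof.
move=> gY s0 sr Ps.
pose E t := [set w | forall i, `|Y i w| <= t].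
have mY i : measurable_fun setT (Y i).
  have := cg_measurable (gY (fun j => (j == i)%:R)); congr measurable_fun.
  apply/funext => w; rewrite (bigD1 i)//= eqxx mul1r big1 ?addr0// => j /negbTE ->.
  by rewrite mul0r.
have mE u : measurable (E u).
  have := measurable_abs_le_family predT (fun=> u) mY.
  by congr measurable; apply/seteqP; split => w H i *; exact: H.
have fP A : measurable A -> (fine (P A))%:E = P A.
  by move=> mA; rewrite fineK// fin_num_measure.
pose p t := fine (P (~` E t)).
have pE t : (p t)%:E = P (~` E t) by rewrite fP//; exact: measurableC.
rewrite -/(E r) -pE lee_fin; apply: (fernique_iteration s0 sr).
- by move=> t; rewrite /p fine_ge0.
- move=> t t' tt'; rewrite -lee_fin !pE le_measure ?inE//; try exact: measurableC.
  by move=> w /= nE Et; apply: nE => i; rewrite (le_trans (Et i)).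
- rewrite -lee_fin pE probability_setC//.
  rewrite -[P (E s)]fP// -EFinB lee_fin.
  by move: Ps; rewrite -/(E s) -[P (E s)]fP// lee_fin; lra.
- move=> t t0; have := fernique_step gY s0 t0; rewrite -/(E s) -/(E t) -/(E _).
  rewrite -!pE -[P (E s)]fP// -EFinM -EFin_expe lee_fin; apply: le_trans.
  rewrite ler_wpM2r// ?fine_ge0//.
  by move: Ps; rewrite -/(E s) -[P (E s)]fP// lee_fin.
Qed.

(** The bound for finite families does not depend on their size, and the exceptional events increase
    with the number of variables. *)
Lemma fernique (Y : nat -> Omega -> R) (s r : R) :
  (forall n (c : nat -> R), centered_gaussian P (fun w => \sum_(i < n) c i * Y i w)) ->
  0 < s -> 4 * s <= r ->
  ((3 / 4)%:E <= P [set w | forall i, (`|Y i w| <= s)%R])%E ->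
  (P (~` [set w | forall i, (`|Y i w| <= r)%R]) <=
    (expR (- (r ^+ 2 / (64 * s ^+ 2))))%:E)%E.
Proof.
move=> gY s0 sr Ps.
have mY i : measurable_fun setT (Y i).
  have := cg_measurable (gY i.+1 (fun j => (j == i)%:R)); congr measurable_fun.
  apply/funext => w; rewrite (bigD1 ord_max)//= eqxx mul1r big1 ?addr0// => j.
  by rewrite -val_eqE /= => /negbTE ->; rewrite mul0r.
pose E t n := [set w | forall i : 'I_n, `|Y i w| <= t].
have mE u n : measurable (E u n).
  have := measurable_abs_le_family predT (fun=> u) (fun i : 'I_n => mY i).
  by congr measurable; apply/seteqP; split => w H i *; exact: H.
have EE t : [set w | forall i, `|Y i w| <= t] = \bigcap_n E t n.
  apply/seteqP; split => w /=; first by move=> H n _ i; exact: H.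
  by move=> H i; exact: (H i.+1 Logic.I ord_max).
rewrite EE setC_bigcap.
have ndE : nondecreasing_seq (fun n => ~` E r n).
  move=> m n mn; apply/subsetPset => w /= nE En; apply: nE => i.
  exact: (En (widen_ord mn i)).
have := nondecreasing_cvg_mu (fun n => measurableC (mE r n))
  (bigcup_measurable (fun n _ => measurableC (mE r n))) ndE.
move=> /(_ _ P) /cvg_lim <-//; apply: lime_le.
  apply: ereal_nondecreasing_is_cvgn => m n mn; apply: le_measure; rewrite ?inE//; try exact: measurableC.
  exact/subsetPset/ndE.
apply: nearW => n; apply: (@fernique_finite _ (fun i : 'I_n => Y i) s r) => //.
- move=> c; have := gY n (fun k => if insub k is Some i then c i else 0).
  congr centered_gaussian; apply/funext => w; apply: eq_bigr => i _.
  by rewrite valK.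
- apply: (le_trans Ps); apply: le_measure; rewrite ?inE.
  + by rewrite EE; apply: bigcapT_measurable.
  + exact: mE.
  + by move=> w H i; exact: H.
Qed.

End fernique.

(** * Oscillation of a Gaussian field *)

Section compact_normed.
Context {R : realType} {V W : normedModType R}.
Implicit Types (A : set V) (f : V -> W).

Lemma compact_finite_net A (eta : R) : compact A -> 0 < eta ->
  exists s : seq V, (forall p, p \in s -> A p) /\
    forall t, A t -> exists2 p, p \in s & `|t - p| < eta.
Proof.
move=> cA eta0; move: cA; rewrite compact_cover => cA.
have [||D DA Acov] := cA V A (fun p => ball p eta).
- by move=> p _; exact: ball_open.
- by move=> t At; exists t => //; exact: ballxx.
exists (finmap.enum_fset D); split.
  by move=> p pD; have := DA p pD; rewrite inE.
move=> t /Acov [p /= pD]; rewrite -ball_normE /= distrC => tp.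
by exists p.
Qed.

Lemma within_continuousP A f : {within A, continuous f} <->
  forall t, A t -> forall eps : R, 0 < eps -> exists2 eta : R, 0 < eta &
    forall u, A u -> `|u - t| < eta -> `|f u - f t| < eps.
Proof.
split.
  move=> /subspace_continuousP cf t At eps eps0.
  have := cf t At; move=> /cvgrPdist_lt /(_ eps eps0).
  rewrite /prop_near1 /within /= => /nbhs_normP [eta eta0 H].
  exists eta => // u Au ut; rewrite distrC; apply: H => //=.
  by rewrite distrC.
move=> H; apply/subspace_continuousP => t At; apply/cvgrPdist_lt => eps eps0.
have [eta eta0 He] := H t At eps eps0.
rewrite /prop_near1 /within /=; apply/nbhs_normP; exists eta => //= u ut Au.
by rewrite distrC; apply: He => //; rewrite distrC.
Qed.

Lemma compact_unif_continuous A f (eps : R) :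
  compact A -> {within A, continuous f} -> 0 < eps ->
  exists2 eta : R, 0 < eta &
    forall u v, A u -> A v -> `|u - v| < eta -> `|f u - f v| < eps.
Proof.
move=> cA /within_continuousP cf eps0.
have eps20 : 0 < eps / 2 by rewrite divr_gt0.
(* [g t] is half a radius of control: if [u] is within [g p] of [p] and [v] within [eta <= g p] of
   [u], both lie in the controlled ball of radius [2 * g p]. *)
have [g gP] : exists g : V -> R, forall t, A t -> 0 < g t /\
    forall u, A u -> `|u - t| < 2 * g t -> `|f u - f t| < eps / 2.
  have H t : exists g : R, A t -> 0 < g /\
      forall u, A u -> `|u - t| < 2 * g -> `|f u - f t| < eps / 2.
    have [At|nAt] := pselect (A t); last by exists 0.
    have [e e0 eH] := cf t At _ eps20; exists (e / 2) => _.
    by split; [rewrite divr_gt0|move=> u Au; rewrite mulrC divfK//; exact: eH].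
  by have [g gP] := choice H; exists g.
move: cA; rewrite compact_cover => cA.
have [||D DA Acov] := cA V A (fun p => ball p (g p)).
- by move=> p _; exact: ball_open.
- by move=> t At; exists t => //; apply: ballxx; case: (gP t At).
pose s := finmap.enum_fset D.
have sA p : p \in s -> A p by move=> pD; have := DA p pD; rewrite inE.
have [eta eta0 etaP] : exists2 eta : R, 0 < eta & forall p, p \in s -> eta <= g p.
  elim: s sA => [|p s IH] sA; first by exists 1.
  have [|e e0 He] := IH; first by move=> q qs; apply: sA; rewrite inE qs orbT.
  have [gp _] := gP p (sA p (mem_head _ _)).
  exists (Num.min e (g p)); first by rewrite lt_min e0.
  move=> q; rewrite inE => /predU1P[->|/He]; first by rewrite ge_min lexx orbT.
  by rewrite ge_min => ->.
exists eta => // u v Au Av uv.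
have [p /= pD] := Acov u Au; rewrite -ball_normE /= => pu.
have [gp gpH] := gP p (sA p pD).
have h1 : `|f u - f p| < eps / 2 by apply: gpH => //; rewrite distrC; lra.
have h2 : `|f v - f p| < eps / 2.
  apply: gpH => //; rewrite -(subrKA u) (le_lt_trans (ler_normD _ _))//.
  rewrite [`|v - u|]distrC [`|u - p|]distrC.
  have := etaP p pD; lra.
rewrite -(subrKA (f p)) (le_lt_trans (ler_normD _ _))// [`|f p - _|]distrC; lra.
Qed.

Lemma compact_dense_seq A : compact A -> A !=set0 ->
  exists D : nat -> V, (forall i, A (D i)) /\
    forall t, A t -> forall eta : R, 0 < eta -> exists i, `|t - D i| < eta.
Proof.
move=> cA [a Aa].
have H n : exists s : seq V, (forall p, p \in s -> A p) /\
    forall t, A t -> exists2 p, p \in s & `|t - p| < n.+1%:R^-1.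
  by apply: compact_finite_net => //; rewrite invr_gt0.
have [s sP] := choice H.
pose D k := if @unpickle (nat * nat)%type k is Some (n, i) then nth a (s n) i else a.
exists D; split.
  move=> k; rewrite /D; case: unpickle => [[n i]|//].
  have [ii|ii] := ltnP i (size (s n)); last by rewrite nth_default.
  by apply: (sP n).1; exact: mem_nth.
move=> t At eta eta0.
have [n n0] : exists n, n.+1%:R^-1 < eta :> R.
  exists (archi_bound eta^-1); rewrite invf_plt ?posrE//.
  by rewrite (lt_trans (archi_boundP _))// ?invr_ge0 ?ltW// ltr_nat.
have [p ps tp] := (sP n).2 t At.
exists (pickle (n, index p (s n))); rewrite /D pickleK nth_index//.
exact: lt_trans tp n0.
Qed.

End compact_normed.

Section gaussian_field.
Context {R : realType} {d : nat} {dO : measure_display} {Omega : measurableType dO}.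
Variables (P : probability Omega R) (T : set 'rV[R]_d) (X : 'rV[R]_d -> Omega -> R).
Local Notation V := 'rV[R]_d.
Hypothesis gX : centered_gaussian_field P T X.

Definition points_in (s : seq (V * R)) := forall p, p \in s -> T p.1.

Lemma lin_comb_scale (c : R) (s : seq (V * R)) w :
  lin_comb X [seq (p.1, c * p.2) | p <- s] w = c * lin_comb X s w.
Proof.
rewrite /lin_comb big_map mulr_sumr; apply: eq_bigr => p _ /=.
by rewrite mulrA.
Qed.

Lemma lin_comb_cat (s1 s2 : seq (V * R)) w :
  lin_comb X (s1 ++ s2) w = lin_comb X s1 w + lin_comb X s2 w.
Proof. by rewrite /lin_comb big_cat. Qed.

Lemma points_in_scale (c : R) (s : seq (V * R)) :
  points_in s -> points_in [seq (p.1, c * p.2) | p <- s].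
Proof. by move=> sT p /mapP[q qs ->]; exact: (sT q). Qed.

Lemma points_in_cat (s1 s2 : seq (V * R)) :
  points_in s1 -> points_in s2 -> points_in (s1 ++ s2).
Proof. by move=> h1 h2 p; rewrite mem_cat => /orP[/h1|/h2]. Qed.

Lemma lin_comb_sum n (s : nat -> seq (V * R)) (c : nat -> R) :
  (forall i, points_in (s i)) ->
  exists2 s', points_in s' &
    (fun w => \sum_(i < n) c i * lin_comb X (s i) w) = lin_comb X s'.
Proof.
move=> sT; elim: n => [|n [s' s'T E]].
  by exists [::] => //; apply/funext => w; rewrite big_ord0 /lin_comb big_nil.
exists (s' ++ [seq (p.1, c n * p.2) | p <- s n]).
  by apply: points_in_cat => //; exact: points_in_scale.
by apply/funext => w; rewrite big_ord_recr/= lin_comb_cat -E lin_comb_scale.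
Qed.

Lemma lin_comb1 t w : lin_comb X [:: (t, 1)] w = X t w.
Proof. by rewrite /lin_comb big_seq1 mul1r. Qed.

Lemma lin_combB s t w : lin_comb X [:: (s, 1); (t, -1)] w = X s w - X t w.
Proof. by rewrite /lin_comb big_cons big_seq1 mul1r mulN1r. Qed.

Lemma field_gaussian t : T t -> centered_gaussian P (X t).
Proof.
move=> Tt; have := gX (s := [:: (t, 1)]); rewrite (_ : lin_comb _ _ = X t).
  by apply => p; rewrite inE => /eqP ->.
by apply/funext => w; exact: lin_comb1.
Qed.

Lemma increment_gaussian s t : T s -> T t -> centered_gaussian P (fun w => X s w - X t w).
Proof.
move=> Ts Tt; have := gX (s := [:: (s, 1); (t, -1)]); rewrite (_ : lin_comb _ _ = fun w => X s w - X t w).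
  by apply => p; rewrite !inE => /orP[]/eqP ->.
by apply/funext => w; exact: lin_combB.
Qed.

Hypothesis cT : compact T.
Hypothesis cX : forall w, {within T, continuous (fun t => X t w)}.

(** Reduces the oscillation of the field to a Gaussian sequence. Pairs of points of a countable
    dense set at distance less than [eta] are enumerated. Each sample path is uniformly continuous,
    so the events that all these increments are at most [eps] increase to the whole space as [eta]
    decreases, and some [eta] gives probability 3/4. *)
Lemma increments_sequence (eps : R) : T !=set0 -> 0 < eps ->
  exists (eta : R) (Y : nat -> Omega -> R), [/\ 0 < eta,
    forall n (c : nat -> R), centered_gaussian P (fun w => \sum_(i < n) c i * Y i w),
    ((3 / 4)%:E <= P [set w | forall i, (`|Y i w| <= eps)%R])%E &
    forall r w, (forall i, `|Y i w| <= r) ->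
      forall s t, T s -> T t -> `|s - t| < eta -> `|X s w - X t w| <= r].
Proof.
move=> T0 eps0.
have [D [DT Ddense]] := compact_dense_seq cT T0.
(* Codes of distant pairs, and indices coding no pair, get the empty combination, which is the
   variable 0 and violates no bound. *)
pose l eta k : seq (V * R) :=
  if @unpickle (nat * nat)%type k is Some (i, j) then
    if `|D i - D j| < eta then [:: (D i, 1); (D j, -1)] else [::] else [::].
have lT eta k : points_in (l eta k).
  rewrite /l; case: unpickle => [[i j]|//]; case: ifP => // _ p.
  by rewrite !inE => /orP[]/eqP ->; exact: DT.
pose Y eta k := lin_comb X (l eta k).
have YE eta k w : Y eta k w = 0 \/ exists i j, `|D i - D j| < eta /\
    Y eta k w = X (D i) w - X (D j) w.
  rewrite /Y /l; case: unpickle => [[i j]|]; last by left; rewrite /lin_comb big_nil.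
  case: ifP => ij; last by left; rewrite /lin_comb big_nil.
  by right; exists i, j; rewrite lin_combB.
have gY eta n (c : nat -> R) : centered_gaussian P (fun w => \sum_(i < n) c i * Y eta i w).
  have [s' s'T ->] := lin_comb_sum n c (lT eta).
  exact: gX.
have mY eta k : measurable_fun setT (Y eta k).
  by apply: cg_measurable (gX _) => p; exact: lT.
pose e n : R := n.+1%:R^-1.
have e0 n : 0 < e n by rewrite invr_gt0.
pose G n := [set w | forall i, `|Y (e n) i w| <= eps].
have mG n : measurable (G n).
  rewrite (_ : G n = \bigcap_i ((Y (e n) i) @^-1` `[- eps, eps])).
    apply: bigcapT_measurable => i; rewrite -[X in measurable X]setTI.
    exact: mY.
  by apply/seteqP; split => w /= H i; [move=> _|]; have := H i;
    rewrite /= in_itv/= -ler_norml//; apply.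
have ndG : nondecreasing_seq G.
  move=> m n mn; apply/subsetPset => w Gm i; rewrite /Y /l.
  have := Gm; rewrite /G /= /Y /l => /(_ i).
  case: unpickle => [[a b]|//]; case: ifP => // Dm; case: ifP => // Dn.
    by move=> _; rewrite /lin_comb big_nil normr0 ltW.
  move: Dm; rewrite (lt_le_trans Dn)//.
  by rewrite /e lef_pV2 ?posrE// ler_nat ltnS.
have GT : \bigcup_n G n = setT.
  apply/seteqP; split => // w _.
  have [eta eta0 He] := compact_unif_continuous cT (@cX w) eps0.
  have [n n0] : exists n, e n < eta.
    exists (archi_bound eta^-1); rewrite invf_plt ?posrE//.
    by rewrite (lt_trans (archi_boundP _))// ?invr_ge0 ?ltW// ltr_nat.
  exists n => // i; have [->|[a [b [ab ->]]]] := YE (e n) i w.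
    by rewrite normr0 ltW.
  by apply/ltW/He => //; exact: lt_trans n0.
have [n Pn] : exists n, ((3 / 4)%:E <= P (G n))%E.
  have := nondecreasing_cvg_mu mG (bigcup_measurable (fun n _ => mG n)) ndG.
  move=> /(_ _ P); rewrite GT [X in _ --> X](@probability_setT _ _ _ P) => /fine_cvgP[_].
  move=> /cvgrPdist_lt /(_ (1/4)) /= [|N _ /(_ N (leqnn _))]; first by lra.
  rewrite /comp /= => H; exists N.
  rewrite -[P (G N)]fineK ?fin_num_measure// lee_fin.
  by have := ler_norm (1 - fine (P (G N))); lra.
exists (e n), (Y (e n)); split => //.
move=> r w Yr s t Ts Tt st; rewrite leNgt; apply/negP => rX.
(* The bound passes from the dense set to all points by continuity: a violation by [2 * gap] at
   [(s, t)] would survive at nearby [D i], [D j], chosen close enough to remain at distance less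
   than [e n]. *)
pose gap := (`|X s w - X t w| - r) / 2.
have gap0 : 0 < gap by rewrite divr_gt0// subr_gt0.
have /within_continuousP cw := @cX w.
have [e1 e10 H1] := cw s Ts _ gap0.
have [e2 e20 H2] := cw t Tt _ gap0.
pose g := (e n - `|s - t|) / 2.
have g0 : 0 < g by rewrite divr_gt0// subr_gt0.
have e1g : 0 < Num.min e1 g by rewrite lt_min e10.
have [i] := Ddense s Ts _ e1g.
rewrite lt_min => /andP[si1 si2].
have e2g : 0 < Num.min e2 g by rewrite lt_min e20.
have [j] := Ddense t Tt _ e2g.
rewrite lt_min => /andP[tj1 tj2].
have ij : `|D i - D j| < e n.
  rewrite -(subrKA s) (le_lt_trans (ler_normD _ _))//.
  rewrite -[s - D j](subrKA t) (@le_lt_trans _ _ (`|D i - s| + (`|s - t| + `|t - D j|)))//.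
    by rewrite lerD2l ler_normD.
  by rewrite [`|D i - s|]distrC; move: si2 tj2; rewrite /g; lra.
have Yij : `|X (D i) w - X (D j) w| <= r.
  by have := Yr (pickle (i, j)); rewrite /Y /l pickleK ij lin_combB.
have h1 := H1 (D i) (DT i); rewrite distrC in h1; have {}h1 := h1 si1.
have h2 := H2 (D j) (DT j); rewrite distrC in h2; have {}h2 := h2 tj1.
have : `|X s w - X t w| <= `|X (D i) w - X s w| + `|X (D i) w - X (D j) w| + `|X (D j) w - X t w|.
  have -> : X s w - X t w = - (X (D i) w - X s w) + (X (D i) w - X (D j) w) + (X (D j) w - X t w) by ring.
  by rewrite (le_trans (ler_normD _ _))// lerD2r (le_trans (ler_normD _ _))// normrN.
by move: h1 h2 Yij; rewrite /gap; lra.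
Qed.

Lemma oscillation_bound (del K : R) : T !=set0 -> 0 < del -> 0 < K ->
  exists (eta U : R), [/\ 0 < eta, 0 < U &
    forall u, U <= u -> exists A : set Omega, [/\ measurable A,
      (P A <= (expR (- (K * u ^+ 2)))%:E)%E &
      forall w, ~ A w -> forall s t, T s -> T t -> `|s - t| < eta ->
        `|X s w - X t w| <= del * u]].
Proof.
move=> T0 del0 K0.
(* With this [eps] Fernique's exponent [(del u)^2 / (64 eps^2)] equals [(K + 1)^2 u^2]; the
   threshold [4 * eps / del] on [u] is its condition [4 s <= r]. *)
pose eps := del / (8 * (K + 1)).
have K10 : 0 < 8 * (K + 1) by rewrite mulr_gt0// addr_gt0.
have eps0 : 0 < eps by rewrite divr_gt0.
have [eta [Y [eta0 gY PY H]]] := increments_sequence T0 eps0.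
exists eta, (4 * eps / del); split => //; first by rewrite divr_gt0// mulr_gt0.
move=> u Uu.
have epsu : 4 * eps <= del * u by move: Uu; rewrite ler_pdivrMr// [u * _]mulrC.
exists (~` [set w | forall i, (`|Y i w| <= del * u)%R]); split.
- apply: measurableC.
  rewrite (_ : [set w | _] = \bigcap_i ((Y i) @^-1` `[- (del * u), del * u])).
    apply: bigcapT_measurable => i; rewrite -[X in measurable X]setTI.
    have mYi : measurable_fun setT (Y i).
      have := cg_measurable (gY i.+1 (fun j => (j == i)%:R)); congr measurable_fun.
      apply/funext => w; rewrite (bigD1 ord_max)//= eqxx mul1r big1 ?addr0// => j.
      by rewrite -val_eqE /= => /negbTE ->; rewrite mul0r.
    exact: mYi.
  by apply/seteqP; split => w /= HH i; [move=> _|]; have := HH i;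
    rewrite /= in_itv/= -ler_norml//; apply.
- apply: (le_trans (fernique gY eps0 epsu PY)).
  rewrite lee_fin ler_expR lerN2 exprMn.
  have -> : del ^+ 2 * u ^+ 2 / (64 * eps ^+ 2) = (K + 1) ^+ 2 * u ^+ 2.
    rewrite /eps; field; apply/andP; split; apply: lt0r_neq0 => //.
    by rewrite addr_gt0.
  by rewrite ler_wpM2r ?sqr_ge0// expr2; nra.
- by move=> w /contrapT Yw s t Ts Tt st; exact: H st.
Qed.

(** An increment which is small with probability 3/4 has [E cos (th D)] bounded away from 0; for a
    Gaussian [D] this equals [exp (- th^2 v / 2)], which bounds the variance [v]. *)
Lemma L2_modulus (eps : R) : T !=set0 -> 0 < eps ->
  exists2 eta : R, 0 < eta & forall s t, T s -> T t -> `|s - t| < eta ->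
    \int[P]_w ((X s w - X t w) ^+ 2) <= eps.
Proof.
move=> T0 eps0.
have [k k0 cosk] : exists2 k : R, 0 < k & forall x, `|x| <= k -> 2 / 3 <= cos x.
  have := @continuous_cos R 0; move=> /cvgrPdist_lt /(_ (1/3)) /= [|k k0 H]; first by lra.
  exists (k / 2); first by rewrite divr_gt0.
  move=> x xk; have := H x; rewrite /ball_ /= sub0r normrN cos0 => /(_ _).
  have xlk : `|x| < k by move: k0 xk; rewrite /=; lra.
  by move=> /(_ xlk); have := ler_norm (1 - cos x); lra.
(* The final bound on [v] is quadratic in [m]; the cap at 1 gives [m^2 <= m <= eps]. *)
pose m := Num.min 1 eps.
have m0 : 0 < m by rewrite lt_min ltr01.
have m1 : m <= 1 by rewrite ge_min lexx.
have meps : m <= eps by rewrite ge_min lexx orbT.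
pose e := k * m / 3.
have e0 : 0 < e by rewrite divr_gt0// mulr_gt0.
have [eta [Y [eta0 gY PY H]]] := increments_sequence T0 e0.
exists eta => // s t Ts Tt st.
set v := \int[P]_w _.
have gD := increment_gaussian Ts Tt.
have mD := cg_measurable gD.
pose th := k / e.
have th0 : 0 < th by rewrite divr_gt0.
have gthD : centered_gaussian P (fun w => th * (X s w - X t w)).
  have := gX (s := [:: (s, th); (t, - th)]).
  rewrite (_ : lin_comb _ _ = fun w => th * (X s w - X t w)).
    by apply => p; rewrite !inE => /orP[]/eqP ->.
  by apply/funext => w; rewrite /lin_comb big_cons big_seq1 /=; ring.
have := cg_cos gthD.
have -> : \int[P]_w ((th * (X s w - X t w)) ^+ 2) = th ^+ 2 * v.
  rewrite -RintegralZl//; last exact: cg_sqr_integrable.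
  by apply: eq_Rintegral => w _; rewrite exprMn.
pose S := [set w | `|X s w - X t w| <= e].
have mS : measurable S.
  rewrite (_ : S = (fun w => X s w - X t w) @^-1` `[- e, e]).
    by rewrite -[X in measurable X]setTI; exact: mD.
  by apply/seteqP; split => w /=; rewrite in_itv/= -ler_norml.
have PS : 3 / 4 <= fine (P S).
  rewrite -lee_fin fineK ?fin_num_measure// (le_trans PY)// le_measure ?inE//.
    rewrite (_ : [set w | _] = \bigcap_i ((Y i) @^-1` `[- e, e])).
      apply: bigcapT_measurable => i; rewrite -[X in measurable X]setTI.
      have mYi : measurable_fun setT (Y i).
        have := cg_measurable (gY i.+1 (fun j => (j == i)%:R)); congr measurable_fun.
        apply/funext => w; rewrite (bigD1 ord_max)//= eqxx mul1r big1 ?addr0// => j.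
        by rewrite -val_eqE /= => /negbTE ->; rewrite mul0r.
      exact: mYi.
    by apply/seteqP; split => w /= HH i; [move=> _|]; have := HH i;
      rewrite /= in_itv/= -ler_norml//; apply.
  by move=> w Yw; exact: H Yw _ _ Ts Tt st.
(* [cos (th D) >= (5/3) 1_S - 1], because it is at least 2/3 on [S] and at least -1 elsewhere; and
   [(5/3)(3/4) - 1 = 1/4]. *)
have lower : 1 / 4 <= \int[P]_w cos (th * (X s w - X t w)).
  apply: (@le_trans _ _ (\int[P]_w (5 / 3 * \1_S w - 1))).
    have IS : P.-integrable setT (EFin \o \1_S) by exact: integrable_indic.
    rewrite RintegralB//; first last.
    - exact: finite_measure_integrable_cst.
    - exact: integrableZl IS.
    rewrite RintegralZl// Rintegral_cstP.
    have -> : \int[P]_x \1_S x = fine (P S) by rewrite /Rintegral integral_indic// setIT.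
    lra.
  apply: le_Rintegral => //.
  - apply: (@bounded_integrable _ _ _ P _ (5/3+1)).
      by apply: measurable_funB => //; apply: measurable_funM => //; exact: measurable_indic.
    move=> w; rewrite (le_trans (ler_normB _ _))// normr1 lerD2r normrM.
    by rewrite ger0_norm// ler_piMr// indicE; case: (_ \in _); rewrite ?normr1 ?normr0.
  - apply: (@bounded_integrable _ _ _ P _ 1) => [|w]; last exact: cos_max.
    apply: (@measurable_comp _ _ _ _ _ _ setT (cos : R -> R)) => //.
      by apply: continuous_measurable_fun; exact: continuous_cos.
    exact: cg_measurable gthD.
  - move=> w _; rewrite indicE; case: (boolP (w \in S)) => [|_].
      rewrite inE /S /= => Dw; rewrite mulr1.
      have := cosk (th * (X s w - X t w)); rewrite normrM gtr0_norm//.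
      have -> : th * `|X s w - X t w| <= k.
        rewrite -[leRHS](@divfK _ e) ?gt_eqF// ler_pM2l//.
      by move=> /(_ isT); lra.
    by rewrite mulr0 sub0r cos_geN1.
move=> E; rewrite E in lower.
have v0 : 0 <= v by apply: Rintegral_ge0 => w _; exact: sqr_ge0.
set z := th ^+ 2 * v / 2 in lower.
have z0 : 0 <= z by rewrite divr_ge0// mulr_ge0// sqr_ge0.
have z3 : z <= 3.
  have h : expR z <= 4.
    rewrite -[expR z]invrK -expRN invf_ple ?posrE ?expR_gt0//.
    by move: lower; lra.
  by have := expR_ge1Dx z; lra.
have vE : v = 2 * z / th ^+ 2 by rewrite /z; field; rewrite gt_eqF.
have thE : th = 3 / m by rewrite /th /e; field; rewrite !gt_eqF.
rewrite vE thE (_ : _ / _ = 2 / 9 * z * m ^+ 2); last by field; rewrite gt_eqF.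
have : 2 / 9 * z <= 1 by lra.
have : 0 <= 2 / 9 * z by lra.
have : m ^+ 2 <= m by rewrite expr2 ler_piMr// ltW.
nra.
Qed.

End gaussian_field.

(** * Minimal energy of measures on the unit interval *)

Section uniform_pushforward.
Context {R : realType}.

(* The library's uniform law lives on [measurableTypeR R], whose display differs
   from the canonical one on [R] although the measurable sets coincide. *)
Definition U01 : set R -> \bar R := uniform_prob (@ltr01 R).

Let U010 : U01 set0 = 0%E. Proof. exact: measure0. Qed.
Let U01_ge0 A : (0 <= U01 A)%E. Proof. exact: measure_ge0. Qed.
Let U01_sigma_additive : semi_sigma_additive U01.
Proof. exact: (@measure_semi_sigma_additive _ _ _ (uniform_prob (@ltr01 R))). Qed.
HB.instance Definition _ := isMeasure.Build _ _ _ U01 U010 U01_ge0 U01_sigma_additive.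
Let U01_setT : U01 setT = 1%E.
Proof. exact: (@probability_setT _ _ _ (uniform_prob (@ltr01 R))). Qed.
HB.instance Definition _ := Measure_isProbability.Build _ _ _ U01 U01_setT.

Lemma U01E (A : set R) : measurable A -> U01 A = lebesgue_measure (A `&` `[0, 1]).
Proof.
move=> mA; rewrite /U01 /uniform_prob integral_uniform_pdf.
rewrite (eq_integral (fun=> 1%E)); last first.
  by move=> x /set_mem[_]; rewrite /= in_itv/= /uniform_pdf => ->; rewrite subr0 invr1.
by rewrite integral_cst ?mul1e//; apply: measurableI.
Qed.

Lemma U01_gt (a : R) : 0 <= a <= 1 -> U01 `]a, +oo[ = (1 - a)%:E.
Proof.
move=> /andP[a0 a1]; rewrite U01E// (_ : _ `&` _ = `]a, 1]%classic).
  rewrite lebesgue_measure_itv/= lte_fin; case: ltP => [|a1']; first by rewrite EFinB.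
  by rewrite (_ : a = 1) ?subrr//; apply/eqP; rewrite eq_le a1.
apply/seteqP; split => x /=; rewrite !in_itv/= andbT.
  by move=> [-> /andP[_ ->]].
by move=> /andP[ax ->]; rewrite ax (ltW (le_lt_trans a0 ax)).
Qed.

Lemma U01_itvco (a b : R) : 0 <= a -> a <= b -> b <= 1 -> U01 `[a, b[ = (b - a)%:E.
Proof.
move=> a0 ab b1; rewrite U01E// (_ : _ `&` _ = `[a, b[%classic).
  rewrite lebesgue_measure_itv/= lte_fin; case: ltP => [|ba]; first by rewrite EFinB.
  by rewrite (_ : a = b) ?subrr//; apply/eqP; rewrite eq_le ab.
apply/seteqP; split => x /=; rewrite !in_itv/=.
  by move=> [].
move=> /andP[ax xb]; rewrite ax xb; split => //.
by rewrite (le_trans a0 ax) (ltW (lt_le_trans xb b1)).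
Qed.

Lemma U01_fin (A : set R) (r : R) : U01 A = r%:E -> fine (U01 A) = r.
Proof. by move=> ->. Qed.

(** Each cell has its own oscillation bound [a i]. For compositions with a quantile function, which
    may jump, the cellwise bounds need not be small, but their sum telescopes. *)
Lemma Riemann_sum (g : R -> R) (B : R) (a : nat -> R) n : (0 < n)%N ->
  measurable_fun setT g -> (forall x, `|g x| <= B) ->
  (forall i x, (i < n)%N -> i%:R / n%:R <= x < i.+1%:R / n%:R ->
     `|g x - g (i%:R / n%:R)| <= a i) ->
  `|\int[U01]_x g x - n%:R^-1 * \sum_(i < n) g (i%:R / n%:R)| <=
  n%:R^-1 * \sum_(i < n) a i.
Proof.
move=> n0 mg gB ga.
have n0' : 0 < n%:R :> R by rewrite ltr0n.
have Ig (D : set R) : measurable D -> U01.-integrable D (EFin \o g).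
  move=> mD; apply: (@integrableS _ _ _ U01 setT) => //.
  exact: (@bounded_integrable _ _ _ U01 _ B).
have step m : (m <= n)%N ->
    `|\int[U01]_(x in `[0, m%:R / n%:R[) g x - n%:R^-1 * \sum_(i < m) g (i%:R / n%:R)| <=
    n%:R^-1 * \sum_(i < m) a i.
  elim: m => [_|m IH mn].
    by rewrite !big_ord0 mul0r set_itvco0 Rintegral_set0 mulr0 subr0 normr0.
  have m0 : 0 <= m%:R / n%:R :> R by rewrite divr_ge0.
  have mS : m%:R / n%:R <= m.+1%:R / n%:R :> R by rewrite ler_pM2r ?invr_gt0// ler_nat.
  have mS1 : m.+1%:R / n%:R <= 1 :> R by rewrite ler_pdivrMr// mul1r ler_nat.
  have cell : `|\int[U01]_(x in `[m%:R / n%:R, m.+1%:R / n%:R[) g x -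
      n%:R^-1 * g (m%:R / n%:R)| <= n%:R^-1 * a m.
    set C := `[_, _[%classic.
    have UC : fine (U01 C) = n%:R^-1.
      by apply: U01_fin; rewrite U01_itvco// -mulrBl -natr1 addrAC subrr add0r mul1r.
    have -> : n%:R^-1 * g (m%:R / n%:R) = \int[U01]_(x in C) g (m%:R / n%:R).
      transitivity (g (m%:R / n%:R) * fine (U01 C)); first by rewrite UC mulrC.
      by rewrite Rintegral_cst; [|exact: measurable_itv].
    have mC : measurable C by exact: measurable_itv.
    have Ic (c : R) : U01.-integrable C (EFin \o cst c).
      exact: finite_measure_integrable_cst.
    rewrite -RintegralB//; [|exact: Ig|exact: Ic].
    have Id : U01.-integrable C (EFin \o (fun x => g x - g (m%:R / n%:R))).
      apply: (@integrableS _ _ _ U01 setT) => //.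
      apply: (@bounded_integrable _ _ _ U01 _ (B + `|g (m%:R / n%:R)|)).
        by apply: measurable_funB.
      by move=> x; rewrite (le_trans (ler_normB _ _))// lerD2r.
    apply: (le_trans (le_normr_Rintegral mC Id)).
    apply: (@le_trans _ _ (\int[U01]_(x in C) (cst (a m) x))).
      apply: le_Rintegral => //; first exact: integrable_norm.
      by move=> x; rewrite /C /= in_itv/= => xC; exact: ga.
    by rewrite Rintegral_cst// [X in _ * X]UC mulrC.
  have -> : `[0, m.+1%:R / n%:R[%classic = `[0, m%:R / n%:R[%classic `|` `[m%:R / n%:R, m.+1%:R / n%:R[%classic :> set R.
    apply/seteqP; split => x /=; rewrite !in_itv/=.
      by move=> /andP[-> ->]; rewrite !andbT; case: (ltP x); [left|right].
    move=> [/andP[-> xm]|/andP[xm ->]]; first by rewrite (lt_le_trans xm).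
    by rewrite (le_trans m0).
  rewrite Rintegral_setU//; first last.
  - apply/disj_setPS => x /= []; rewrite !in_itv/= => /andP[_ h1] /andP[h2 _].
    by move: (lt_le_trans h1 h2); rewrite ltxx.
  - by apply: Ig; exact: measurableU.
  rewrite !big_ord_recr/= !mulrDr opprD addrACA.
  by rewrite (le_trans (ler_normD _ _))// lerD// IH// ltnW.
have := step n (leqnn n); rewrite divff ?gt_eqF//; congr (`|_ - _| <= _).
(* The induction covers [[0, 1[]; the complement, including the point 1, has [U01]-measure 0. *)
have mC : measurable (~` `[0, 1[%classic : set R) by apply: measurableC; exact: measurable_itv.
have C0 : U01 (~` `[0, 1[%classic) = 0%E.
  rewrite probability_setC; last exact: measurable_itv.
  by rewrite [X in (1 - X)%E](U01_itvco (lexx 0) ler01 (lexx 1)) subr0 -EFinB subrr.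
rewrite -[in RHS](setvU (`[0, 1[%classic : set R)) Rintegral_setU//; first last.
- by apply/disj_setPS => x [] /= h.
- by rewrite setvU; exact: Ig.
rewrite [X in _ = X + _](_ : _ = 0) ?add0r//.
rewrite /Rintegral null_set_integral//.
by have /measurable_int := Ig _ mC.
Qed.

End uniform_pushforward.

(** * Probability measures on the unit interval as laws of quantile functions *)

Section quantile_representation.
Context {R : realType}.
Implicit Types (q : R -> R) (mu : probability R R).

Definition law_of q mu := [/\ measurable_fun setT q, forall x, 0 <= q x <= 1 &
  forall A : set R, measurable A -> mu A = U01 (q @^-1` A)].

Lemma measurable_I01 : measurable (I01 : set R).
Proof. exact: measurable_itv. Qed.

Lemma law_of_exists q : measurable_fun setT q -> (forall x, 0 <= q x <= 1) ->
  exists2 mu, M1_01 mu & law_of q mu.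
Proof.
move=> mq q01.
pose qm := isMeasurableFun.Build _ _ _ _ q mq.
pose Q : {mfun R >-> R} := HB.pack q qm.
exists (distribution U01 Q) => //.
rewrite /M1_01; transitivity (U01 (q @^-1` I01)) => //.
rewrite (_ : q @^-1` I01 = setT).
  by rewrite [LHS](@probability_setT _ _ _ U01).
by apply/seteqP; split => x //= _; rewrite /I01 /= in_itv/=; exact: q01.
Qed.

(** [q] is the generalized inverse of the survival function [F t = mu ]t, +oo[]. Monotonicity is
    what makes Riemann sums along [q] converge at a rate independent of [mu]. *)
Lemma quantile_law mu : M1_01 mu -> exists2 q, {homo q : x y / x <= y} & law_of q mu.
Proof.
move=> mu1.
have fP (A : set R) : measurable A -> (fine (mu A))%:E = mu A.
  by move=> mA; rewrite fineK// fin_num_measure.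
pose F t := fine (mu `]t, +oo[%classic).
have FE t : (F t)%:E = mu `]t, +oo[%classic by apply: fP; exact: measurable_itv.
have F0 t : 0 <= F t by rewrite -lee_fin FE.
have F1 t : F t <= 1 by rewrite -lee_fin FE; apply: probability_le1; exact: measurable_itv.
have Fmono s t : s <= t -> F t <= F s.
  move=> st; rewrite -lee_fin !FE; apply: le_measure; rewrite ?inE; [exact: measurable_itv..|].
  by apply: subset_itvr; rewrite bnd_simp.
have muC (A : set R) : measurable A -> A `&` I01 = set0 -> mu A = 0%E.
  move=> mA AI; apply/eqP; rewrite -measure_le0.
  have <- : mu (~` I01) = 0%E.
    by rewrite probability_setC ?mu1 ?subee//; exact: measurable_I01.
  apply: le_measure; rewrite ?inE//; first by apply: measurableC; exact: measurable_I01.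
  by move=> x Ax Ix; have : (A `&` I01) x by []; rewrite AI.
have Fge1 t : 1 <= t -> mu `]t, +oo[%classic = 0%E.
  move=> t1; apply: muC; first exact: measurable_itv.
  apply/seteqP; split => x //=; rewrite /I01 /= !in_itv/= andbT => -[tx /andP[_ x1]].
  by move: (le_lt_trans t1 tx); rewrite ltNge x1.
have Flt0 t : t < 0 -> mu `]t, +oo[%classic = 1%E.
  move=> t0; apply/eqP; rewrite eq_le probability_le1 ?andTb/=; last exact: measurable_itv.
  rewrite -mu1; apply: le_measure; rewrite ?inE; [exact: measurable_I01|exact: measurable_itv|].
  by move=> x; rewrite /I01 /= !in_itv/= andbT => /andP[x0 _]; exact: lt_le_trans x0.
(* The alternative [t = 1] keeps the set nonempty for every real [x], so [q] is monotone and
   [[0, 1]]-valued on the whole line. *)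
pose S x := [set t : R | 0 <= t <= 1 /\ (F t <= 1 - x \/ t = 1)].
have S1 x : S x 1 by split; [rewrite ler01 lexx|right].
have infS x : has_inf (S x).
  by split; [exists 1|exists 0 => t [/andP[]]].
pose q x := inf (S x).
have q01 x : 0 <= q x <= 1.
  apply/andP; split; first by apply: lb_le_inf; [exists 1|move=> t [/andP[]]].
  by apply: ge_inf => //; case: (infS x).
have qmono : {homo q : x y / x <= y}.
  move=> x y xy; apply: lb_le_inf; first by exists 1.
  move=> t [t01 Ht]; apply: ge_inf; first by case: (infS x).
  by split => //; case: Ht => [Ft|->]; [left; rewrite (le_trans Ft)// lerB|right].
exists q => //.
have mq : measurable_fun setT q by exact: nondecreasing_measurable.
split => //.
(* The Galois connection between [q] and [F]; the implication from right to left is where the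
   right-continuity of [F] is needed. It identifies preimages of half-lines under [q]. *)
have galois x t : 0 <= t < 1 -> (t < q x) = (1 - F t < x).
  move=> /andP[t0 t1]; apply/idP/idP.
    move=> tq; rewrite ltNge; apply/negP => xF.
    move: tq; rewrite ltNge => /negP; apply.
    apply: ge_inf; first by case: (infS x).
    by split; [rewrite t0 ltW|left; lra].
  move=> Fx; rewrite ltNge; apply/negP => qt.
  suff : F t <= 1 - x by move: Fx; lra.
  have cF : F (t + n.+1%:R^-1) @[n --> \oo] --> F t.
    have inv_lt (e : R) : 0 < e -> exists n, n.+1%:R^-1 < e.
      move=> e0; exists (archi_bound e^-1); rewrite invf_plt ?posrE//.
      by rewrite (lt_trans (archi_boundP _))// ?invr_ge0 ?ltW// ltr_nat.
    have bigE : \bigcup_n (`]t + n.+1%:R^-1, +oo[%classic) = `]t, +oo[%classic :> set R.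
      apply/seteqP; split => y /=; rewrite in_itv/= andbT.
        move=> [n _]; rewrite /= in_itv/= andbT; apply: le_lt_trans.
        by rewrite lerDl invr_ge0.
      rewrite -subr_gt0 => /inv_lt[n ny]; exists n => //.
      by rewrite /= in_itv/= andbT -ltrBrDl.
    have mI n : measurable (`]t + n.+1%:R^-1, +oo[%classic : set R) by exact: measurable_itv.
    have nd : nondecreasing_seq (fun n => `]t + n.+1%:R^-1, +oo[%classic : set R).
      move=> m n mn; apply/subsetPset; apply: subset_itvr; rewrite bnd_simp lerD2l.
      by rewrite lef_pV2 ?posrE// ler_nat.
    have := nondecreasing_cvg_mu mI (bigcup_measurable (fun n _ => mI n)) nd.
    move=> /(_ _ mu); rewrite bigE.
    rewrite [X in _ --> X](_ : _ = (F t)%:E); last by rewrite FE.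
    by move=> /fine_cvg.
  rewrite -(cvg_lim _ cF)//; apply: limr_le; first by apply/cvg_ex; exists (F t).
  have : n.+1%:R^-1 @[n --> \oo] --> (0 : R) by exact: cvg_harmonic.
  have t1' : 0 < 1 - t by rewrite subr_gt0.
  move=> /cvgrPdist_lt /(_ _ t1'); apply: filterS => n.
  rewrite sub0r normrN ger0_norm// => nt.
  have qn : q x < t + n.+1%:R^-1 by rewrite (le_lt_trans qt)// ltrDl invr_gt0.
  have /(inf_adherent (_ : 0 < t + n.+1%:R^-1 - q x)) := infS x.
  rewrite subr_gt0 => /(_ qn)[s [/andP[s0 s1] Hs]].
  rewrite -/(q x) addrC subrK => st.
  case: Hs => [Fs|s1']; first by rewrite (le_trans (Fmono _ _ (ltW st))).
  by move: st; rewrite s1' -ltrBlDl ltNge (ltW nt).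
move=> A mA.
(* Half-lines []t, +oo[] form a generating family closed under intersection, so agreement on them
   suffices. *)
pose g n : set R := `]- n%:R, +oo[%classic.
have Gg n : RGenOInfty.G (g n) by exists (- n%:R).
have gcover : \bigcup_n g n = setT.
  apply/seteqP; split => // x _; exists (archi_bound `|x|) => //.
  rewrite /g /= in_itv/= andbT ltrNl (le_lt_trans (ler_norm _))// normrN.
  exact: archi_boundP.
have setIG : setI_closed (@RGenOInfty.G R).
  move=> _ _ [x ->] [y ->]; exists (Num.max x y).
  by apply/seteqP; split => z /=; rewrite !in_itv/= !andbT gt_max => /andP.
have mG : (@measurable _ R) = <<s @RGenOInfty.G R >> by exact: RGenOInfty.measurableE.
have [nu _ [_ _ nuE]] := law_of_exists mq q01.
rewrite -nuE//.
apply: (measure_unique (@RGenOInfty.G R) g mG setIG Gg gcover mu nu) => //.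
- move=> _ [t ->]; apply: (etrans _ (esym (nuE _ (measurable_itv _)))).
  rewrite -[LHS]/(mu `]t, +oo[%classic).
  have [t0|t0] := ltP t 0.
    rewrite Flt0// (_ : _ @^-1` _ = setT) ?[RHS](@probability_setT _ _ _ U01)//.
    apply/seteqP; split => x //= _; rewrite in_itv/= andbT.
    by have /andP[h _] := q01 x; exact: lt_le_trans h.
  have [t1|t1] := leP 1 t.
    rewrite Fge1// (_ : _ @^-1` _ = set0) ?measure0//.
    apply/seteqP; split => x //=; rewrite in_itv/= andbT.
    by have /andP[_ h] := q01 x; rewrite ltNge (le_trans h).
  rewrite (_ : _ @^-1` _ = `]1 - F t, +oo[%classic).
    rewrite U01_gt ?subr_ge0 ?F1//= ?gerBl ?F0//.
    by rewrite opprB addrC subrK FE.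
  by apply/seteqP; split => x /=; rewrite !in_itv/= !andbT galois// t0.
- by move=> n; rewrite -ge0_fin_numE// fin_num_measure//; exact: measurable_itv.
Qed.

Lemma integrable_law_of q mu (f : R -> R) (B : R) : law_of q mu ->
  measurable_fun I01 f -> (forall x, I01 x -> `|f x| <= B) ->
  (\int[mu]_(x in I01) (f x)%:E = (\int[U01]_x f (q x))%:E)%E.
Proof.
move=> [mq q01 muq] mf fB.
have qI x : I01 (q x) by rewrite /I01 /= in_itv/=; exact: q01.
have mfq : measurable_fun setT (f \o q).
  apply: (@measurable_comp _ _ _ _ _ _ I01) => //; first exact: measurable_I01.
  by move=> _ [x _ <-]; exact: qI.
pose f' := f \_ I01.
have mf' : measurable_fun setT f' by apply/(measurable_restrictT f measurable_I01).
have f'q : f' \o q = f \o q.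
  by apply/funext => x; rewrite /f' /= patchE mem_set.
have Ifq : U01.-integrable setT (EFin \o (f \o q)).
  by apply: (@bounded_integrable _ _ _ U01 _ B) => // x; exact: fB.
have -> : (\int[mu]_(x in I01) (f x)%:E = \int[mu]_x (f' x)%:E)%E.
  rewrite integral_mkcond; apply: eq_integral => x _.
  by rewrite /f' !patchE; case: ifP.
have If'q : U01.-integrable (q @^-1` setT) ((EFin \o f') \o q).
  by rewrite preimage_setT -[X in U01.-integrable _ X]/(EFin \o (f' \o q)) f'q.
have mEf' : measurable_fun setT (EFin \o f') by exact/measurable_EFinP.
have := integral_pushforward mq mEf' If'q measurableT.
rewrite preimage_setT (@eq_measure_integral _ _ _ setT mu); last first.
  by move=> A mA _; exact: (esym (muq _ mA)).
move=> ->; rewrite /Rintegral fineK; last exact: (integrable_fin_num measurableT Ifq).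
by apply: eq_integral => x _; rewrite /= -[f' (q x)]/((f' \o q) x) f'q.
Qed.

End quantile_representation.

Section almost_lipschitz.
Context {R : realType}.
Implicit Types (f q : R -> R) (mu : probability R R) (n : nat).

(* Modulus of continuity in the form [eps + L t]: it is affine in the increments of
   a monotone function, so that errors of Riemann sums telescope. *)
Definition almost_lipschitz f := forall eps : R, 0 < eps -> exists2 L : R, 0 <= L &
  forall u v, I01 u -> I01 v -> `|f u - f v| <= eps + L * `|u - v|.

Definition almost_lipschitz2 (k : R -> R -> R) :=
  forall eps : R, 0 < eps -> exists2 L : R, 0 <= L &
  forall u u' v v', I01 u -> I01 u' -> I01 v -> I01 v' ->
    `|k u v - k u' v'| <= eps + L * (`|u - u'| + `|v - v'|).

Lemma I010 : I01 (0 : R).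
Proof. by rewrite /I01 /= in_itv/= lexx ler01. Qed.

Lemma I01P (x : R) : I01 x <-> 0 <= x <= 1.
Proof. by rewrite /I01 /= in_itv. Qed.

Lemma almost_lipschitz_measurable f : almost_lipschitz f -> measurable_fun I01 f.
Proof.
move=> fL; apply: subspace_continuous_measurable_fun; first exact: measurable_I01.
apply/(@within_continuousP R R R) => t It eps eps0.
have eps20 : 0 < eps / 2 by rewrite divr_gt0.
have [L L0 HL] := fL _ eps20.
have L10 : 0 < 2 * (L + 1) by rewrite mulr_gt0// ltr_wpDl.
exists (eps / (2 * (L + 1))); first by rewrite divr_gt0.
move=> u Iu; rewrite ltr_pdivlMr// => ut.
rewrite (le_lt_trans (HL _ _ Iu It))//.
have : 0 <= `|u - t| by [].
nra.
Qed.

Lemma almost_lipschitz_bounded f : almost_lipschitz f ->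
  exists B, forall x, I01 x -> `|f x| <= B.
Proof.
move=> fL; have [L L0 HL] := fL 1 ltr01.
exists (`|f 0| + (1 + L)) => x Ix.
rewrite -[f x](subrK (f 0)) addrC (le_trans (ler_normD _ _))// lerD2l.
rewrite (le_trans (HL _ _ Ix I010))// lerD2l subr0 ler_piMr//.
by move/I01P : Ix => /andP[x0 x1]; rewrite ger0_norm.
Qed.

(** On a cell the error is at most [eps + L * (c i.+1 - c i)] by monotonicity of [q], and the
    increments add up to at most 1. The bound does not involve [mu]. *)
Lemma law_of_Riemann q mu f (eps L B : R) n : (0 < n)%N ->
  law_of q mu -> {homo q : x y / x <= y} -> measurable_fun I01 f -> 0 <= L ->
  (forall x, I01 x -> `|f x| <= B) ->
  (forall u v, I01 u -> I01 v -> `|f u - f v| <= eps + L * `|u - v|) ->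
  `|\int[U01]_x f (q x) - n%:R^-1 * \sum_(i < n) f (q (i%:R / n%:R))| <= eps + L / n%:R.
Proof.
move=> n0 [mq q01 _] qmono mf L0 fB fL.
have n0' : 0 < n%:R :> R by rewrite ltr0n.
have qI x : I01 (q x) by exact/I01P/q01.
have mfq : measurable_fun setT (f \o q).
  apply: (@measurable_comp _ _ _ _ _ _ I01) => //; first exact: measurable_I01.
  by move=> _ [x _ <-]; exact: qI.
pose c i : R := q (i%:R / n%:R).
have := @Riemann_sum R (f \o q) B (fun i => eps + L * (c i.+1 - c i)) n n0 mfq
  (fun x => fB _ (qI x)).
move=> /(_ _)/le_trans; apply.
- move=> i x ni /andP[ix xi]; rewrite /= (le_trans (fL _ _ (qI _) (qI _)))//.
  by rewrite lerD2l ler_wpM2l// ger0_norm ?subr_ge0 ?qmono// lerD2r /c qmono// ltW.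
- rewrite big_split/= sumr_const card_ord -mulr_sumr.
  rewrite -(big_mkord xpredT (fun i => c i.+1 - c i)) telescope_sumr//.
  rewrite mulrDr -[eps *+ n]mulr_natl mulKf ?gt_eqF// lerD2l mulrC ler_pM2r ?invr_gt0//.
  rewrite ler_piMr//; have /andP[_ h1] := q01 (n%:R / n%:R); have /andP[h2 _] := q01 (0%:R / n%:R).
  by rewrite /c; lra.
Qed.

End almost_lipschitz.

(** * Energies and their double Riemann sums *)

Section quadratic_functional.
Context {R : realType}.
Variable k : R -> R -> R.
Hypothesis kL : almost_lipschitz2 k.
Implicit Types (q : R -> R) (mu : probability R R) (n : nat) (s : seq R).

Definition quadk mu : \bar R := (\int[mu]_(v in I01) \int[mu]_(u in I01) (k u v)%:E)%E.

(** The energy of the measure giving equal weight to the entries of [s], repetitions counted. *)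
Definition quad_seq s : R := (size s)%:R ^- 2 * \sum_(p <- s) \sum_(r <- s) k p r.

Lemma al2_bounded : exists2 B, 0 <= B & forall u v, I01 u -> I01 v -> `|k u v| <= B.
Proof.
have [L L0 HL] := kL ltr01; exists (`|k 0 0| + (1 + L * 2)).
  by rewrite !addr_ge0// mulr_ge0.
move=> u v Iu Iv; rewrite -[k u v](subrK (k 0 0)) addrC (le_trans (ler_normD _ _))// lerD2l.
rewrite (le_trans (HL _ _ _ _ Iu I010 Iv I010))// lerD2l ler_wpM2l// !subr0.
move/I01P : Iu => /andP[u0 u1]; move/I01P : Iv => /andP[v0 v1].
by rewrite !ger0_norm//; lra.
Qed.

Lemma al_left v : I01 v -> almost_lipschitz (k ^~ v).
Proof.
move=> Iv eps eps0; have [L L0 HL] := kL eps0; exists L => // u u' Iu Iu'.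
by rewrite (le_trans (HL _ _ _ _ Iu Iu' Iv Iv))// subrr normr0 addr0.
Qed.

Let Ileft q v : measurable_fun setT q -> (forall x, 0 <= q x <= 1) -> I01 v ->
  U01.-integrable setT (EFin \o (fun x => k (q x) v)).
Proof.
move=> mq q01 Iv; have [B B0 kB] := al2_bounded.
have qI x : I01 (q x) by exact/I01P/q01.
apply: (@bounded_integrable _ _ _ U01 _ B) => [|x]; last exact: kB.
apply: (@measurable_comp _ _ _ _ _ _ I01 (k ^~ v)) => //.
- exact: measurable_I01.
- by move=> _ [x _ <-]; exact: qI.
- exact: (almost_lipschitz_measurable (al_left Iv)).
Qed.

(** Averaging in one variable keeps the modulus with the same [eps] and [L], so the outer integral
    can be discretized with the same error as the inner one. *)
Let inner_lip q (eps L : R) : measurable_fun setT q -> (forall x, 0 <= q x <= 1) ->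
  (forall u u' v v', I01 u -> I01 u' -> I01 v -> I01 v' ->
    `|k u v - k u' v'| <= eps + L * (`|u - u'| + `|v - v'|)) ->
  forall v v', I01 v -> I01 v' ->
  `|\int[U01]_x k (q x) v - \int[U01]_x k (q x) v'| <= eps + L * `|v - v'|.
Proof.
move=> mq q01 HL v v' Iv Iv'.
have qI x : I01 (q x) by exact/I01P/q01.
rewrite -RintegralB//; [|exact: Ileft..].
have Id : U01.-integrable setT (EFin \o (fun x => k (q x) v - k (q x) v')).
  exact: (integrableB measurableT (Ileft mq q01 Iv) (Ileft mq q01 Iv')).
rewrite (le_trans (le_normr_Rintegral measurableT Id))//.
rewrite -[leRHS](Rintegral_cstP U01); apply: le_Rintegral => //.
- exact: integrable_norm.
- exact: finite_measure_integrable_cst.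
- move=> x _; rewrite (le_trans (HL _ _ _ _ (qI x) (qI x) Iv Iv'))//.
  by rewrite subrr normr0 add0r.
Qed.

Let inner_al q : measurable_fun setT q -> (forall x, 0 <= q x <= 1) ->
  almost_lipschitz (fun v => \int[U01]_x k (q x) v).
Proof.
move=> mq q01 eps eps0; have [L L0 HL] := kL eps0; exists L => // v v' Iv Iv'.
exact: inner_lip.
Qed.

Lemma quadk_law q mu : law_of q mu ->
  quadk mu = (\int[U01]_y \int[U01]_x k (q x) (q y))%:E.
Proof.
move=> qmu; have [mq q01 _] := qmu.
have [B B0 kB] := al2_bounded.
rewrite /quadk (eq_integral (fun v => (\int[U01]_x k (q x) v)%:E)); last first.
  move=> v /set_mem Iv; apply: (integrable_law_of qmu (B := B)).
    exact: (almost_lipschitz_measurable (al_left Iv)).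
  by move=> x Ix; exact: kB.
have [B' HB'] := almost_lipschitz_bounded (inner_al mq q01).
by rewrite (integrable_law_of qmu (almost_lipschitz_measurable (inner_al mq q01)) HB').
Qed.

Lemma quad_seq_map q n : (0 < n)%N ->
  quad_seq [seq q (i%:R / n%:R) | i <- iota 0 n] =
  n%:R^-1 * \sum_(j < n) (n%:R^-1 * \sum_(i < n) k (q (i%:R / n%:R)) (q (j%:R / n%:R))).
Proof.
move=> n0; rewrite /quad_seq size_map size_iota big_map.
under eq_bigr do rewrite big_map.
rewrite -[X in iota 0 X]subn0 exchange_big/= -/(index_iota 0 n) big_mkord.
rewrite -mulr_sumr mulrA -expr2 exprVn; congr (_ * _); apply: eq_bigr => j _.
by rewrite big_mkord.
Qed.

Lemma quadk_Riemann q mu (eps L : R) n : (0 < n)%N -> law_of q mu ->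
  {homo q : x y / x <= y} -> 0 <= L ->
  (forall u u' v v', I01 u -> I01 u' -> I01 v -> I01 v' ->
    `|k u v - k u' v'| <= eps + L * (`|u - u'| + `|v - v'|)) ->
  `|fine (quadk mu) - quad_seq [seq q (i%:R / n%:R) | i <- iota 0 n]| <= 2 * (eps + L / n%:R).
Proof.
move=> n0 qmu qmono L0 HL; have [mq q01 _] := qmu.
have n0' : 0 < n%:R :> R by rewrite ltr0n.
have qI x : I01 (q x) by exact/I01P/q01.
rewrite (quadk_law qmu) /= quad_seq_map//.
set G := fun v => \int[U01]_x k (q x) v.
have [B' HB'] := almost_lipschitz_bounded (inner_al mq q01).
have h1 := law_of_Riemann n0 qmu qmono (almost_lipschitz_measurable (inner_al mq q01)) L0 HB'
  (inner_lip mq q01 HL).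
have h2 j : `|G (q (j%:R / n%:R)) - n%:R^-1 * \sum_(i < n) k (q (i%:R / n%:R)) (q (j%:R / n%:R))|
    <= eps + L / n%:R.
  have [B B0 kB] := al2_bounded.
  apply: (@law_of_Riemann R q mu (k ^~ (q (j%:R / n%:R))) eps L B n n0 qmu qmono _ L0).
  - exact: (almost_lipschitz_measurable (al_left (qI _))).
  - by move=> x Ix; exact: kB.
  - move=> u v Iu Iv; rewrite (le_trans (HL _ _ _ _ Iu Iv (qI _) (qI _)))//.
    by rewrite subrr normr0 addr0.
rewrite -(subrKA (n%:R^-1 * \sum_(j < n) G (q (j%:R / n%:R)))).
rewrite (le_trans (ler_normD _ _))// mulrDl mul1r lerD//.
rewrite -mulrBr -sumrB normrM ger0_norm ?invr_ge0// mulrC ler_pdivrMr//.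
rewrite (le_trans (ler_norm_sum _ _ _))//.
apply: (@le_trans _ _ (\sum_(j < n) (eps + L / n%:R))); first by apply: ler_sum => j _; exact: h2.
by rewrite sumr_const card_ord mulr_natr.
Qed.

(** The equal-weight measure on [s] is the law of a step function, for which the cellwise
    oscillation is 0 and the Riemann sums are exact. No monotonicity is involved here, so [s] may be
    in any order. *)
Lemma quadk_step s : s != [::] -> (forall p, p \in s -> I01 p) ->
  exists2 mu, M1_01 mu & quadk mu = (quad_seq s)%:E.
Proof.
move=> s0 sI; set n := size s.
have n0 : (0 < n)%N by rewrite lt0n size_eq0.
have n0' : 0 < n%:R :> R by rewrite ltr0n.
pose cell i (x : R) := (i%:R / n%:R <= x) && (x < i.+1%:R / n%:R).
pose q x := \sum_(i < n) s`_i * (cell i x)%:R.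
have qE i x : (i < n)%N -> cell i x -> q x = s`_i.
  move=> ni cx; rewrite /q (bigD1 (Ordinal ni))//= cx mulr1 big1 ?addr0// => j ji.
  case: (boolP (cell j x)) => [cj|_]; last by rewrite mulr0.
  exfalso; move/eqP: ji; apply; apply: val_inj => /=.
  move: cx cj; rewrite /cell => /andP[i1 i2] /andP[j1 j2].
  have h1 : i%:R < j.+1%:R :> R by rewrite -(@ltr_pM2r _ n%:R^-1) ?invr_gt0// (le_lt_trans i1).
  have h2 : j%:R < i.+1%:R :> R by rewrite -(@ltr_pM2r _ n%:R^-1) ?invr_gt0// (le_lt_trans j1).
  by apply/eqP; rewrite eqn_leq -ltnS -(ltr_nat R) h2/= -ltnS -(ltr_nat R).
have sI' i : (i < n)%N -> 0 <= s`_i <= 1.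
  by move=> ni; apply/I01P/sI/mem_nth.
have q01 x : 0 <= q x <= 1.
  have [[i [ni cx]]|H] := pselect (exists i, (i < n)%N /\ cell i x).
    by rewrite (qE i)//; exact: sI'.
  rewrite /q big1 ?lexx ?ler01// => i _.
  case: (boolP (cell i x)) => [ci|_]; last by rewrite mulr0.
  by exfalso; apply: H; exists i.
have mq : measurable_fun setT q.
  apply: measurable_sum => i; apply: measurable_funM => //.
  rewrite (_ : (fun x => _) = \1_(`[i%:R / n%:R, i.+1%:R / n%:R[%classic)).
    by apply: measurable_indic; exact: measurable_itv.
  apply/funext => x; rewrite indicE; congr (_%:R); congr nat_of_bool.
  by apply/idP/idP; rewrite inE /= in_itv.
have [mu mu1 qmu] := law_of_exists mq q01.
exists mu => //.
have qI x : I01 (q x) by exact/I01P/q01.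
have exact_sum f : almost_lipschitz f -> \int[U01]_x f (q x) = n%:R^-1 * \sum_(i < n) f s`_i.
  move=> fL; have [B HB] := almost_lipschitz_bounded fL.
  have mfq : measurable_fun setT (f \o q).
    apply: (@measurable_comp _ _ _ _ _ _ I01) => //; first exact: measurable_I01.
      by move=> _ [x _ <-]; exact: qI.
    exact: almost_lipschitz_measurable.
  have := @Riemann_sum R (f \o q) B (fun=> 0) n n0 mfq (fun x => HB _ (qI x)).
  have ci i : cell i (i%:R / n%:R).
    by rewrite /cell lexx ltr_pM2r ?invr_gt0// ltr_nat ltnSn.
  have Hc i x : (i < n)%N -> cell i x -> `|(f \o q) x - (f \o q) (i%:R / n%:R)| <= 0.
    by move=> ni cx; rewrite /= (qE i x)// (qE i (i%:R / n%:R))// subrr normr0.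
  move=> /(_ Hc).
  rewrite [X in _ <= _ * X]big1// mulr0 normr_le0 subr_eq0 => /eqP ->.
  by congr (_ * _); apply: eq_bigr => i _; rewrite /= (qE i).
rewrite (quadk_law qmu); congr (_%:E).
rewrite (exact_sum (fun v => \int[U01]_x k (q x) v)); last exact: inner_al.
rewrite /quad_seq -/n -exprVn expr2 -mulrA; congr (_ * _).
rewrite exchange_big/= mulr_sumr (big_nth 0) big_mkord; apply: eq_bigr => j _.
rewrite (exact_sum (k ^~ s`_j)); last by apply/al_left/I01P/sI'.
by rewrite (big_nth 0) big_mkord.
Qed.

End quadratic_functional.

(** * The minimum of the energy and its first-order condition *)

Section minimal_energy.
Context {R : realType}.
Variable k : R -> R -> R.
Hypothesis kL : almost_lipschitz2 k.
Hypothesis kpos : forall s : seq R, (forall p, p \in s -> I01 p) -> 0 <= quad_seq k s.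
Hypothesis ksym : forall u v, k u v = k v u.
Implicit Types (q : R -> R) (mu : probability R R) (n : nat) (s : seq R).

Definition quadk_min : \bar R := ereal_inf [set quadk k mu | mu in [set mu | M1_01 mu]].

Lemma quadk_min_le_seq s : s != [::] -> (forall p, p \in s -> I01 p) ->
  (quadk_min <= (quad_seq k s)%:E)%E.
Proof.
move=> s0 sI; have [mu mu1 <-] := quadk_step kL s0 sI.
by apply: ereal_inf_lbound; exists mu.
Qed.

Lemma quadk_fin mu : M1_01 mu -> quadk k mu = (fine (quadk k mu))%:E.
Proof. by move=> /quantile_law[q _ qmu]; rewrite (quadk_law kL qmu). Qed.

Lemma Riemann_error (eps L : R) : 0 < eps -> 0 <= L ->
  exists2 n, (0 < n)%N & forall m, (n <= m)%N -> 2 * (eps / 4 + L / m%:R) <= eps.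
Proof.
move=> eps0 L0; pose n := (archi_bound (4 * L / eps)).+1.
exists n => // m nm.
have m0 : 0 < m%:R :> R by rewrite ltr0n (leq_trans _ nm).
suff : L / m%:R <= eps / 4 by lra.
rewrite ler_pdivrMr//.
have h : 4 * L / eps < m%:R.
  apply: lt_le_trans (archi_boundP _) _; first by rewrite !mulr_ge0 ?invr_ge0// ltW.
  by rewrite ler_nat (leq_trans _ nm).
by move: h; rewrite ltr_pdivrMr//; lra.
Qed.

Lemma quad_seq_approx mu (eps : R) : M1_01 mu -> 0 < eps ->
  exists s, [/\ s != [::], forall p, p \in s -> I01 p &
    quad_seq k s <= fine (quadk k mu) + eps /\ fine (quadk k mu) <= quad_seq k s + eps].
Proof.
move=> mu1 eps0; have [q qmono qmu] := quantile_law mu1.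
have eps40 : 0 < eps / 4 by rewrite divr_gt0.
have [L L0 HL] := kL eps40.
have [n n0 Hn] := Riemann_error eps0 L0.
exists [seq q (i%:R / n%:R) | i <- iota 0 n]; split.
- by rewrite -size_eq0 size_map size_iota -lt0n.
- by move=> p /mapP[i _ ->]; apply/I01P; case: qmu.
- have := quadk_Riemann kL n0 qmu qmono L0 HL.
  have := Hn n (leqnn n) => h1 h2; move: (le_trans h2 h1); rewrite ler_norml => /andP[].
  by move=> *; split; lra.
Qed.

Lemma quadk_ge0 mu : M1_01 mu -> (0 <= quadk k mu)%E.
Proof.
move=> mu1; rewrite quadk_fin// lee_fin leNgt; apply/negP => neg.
have eps0 : 0 < - fine (quadk k mu) / 2 by rewrite divr_gt0// oppr_gt0.
have [s [_ sI [h _]]] := quad_seq_approx mu1 eps0.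
have := kpos sI; lra.
Qed.

Lemma quadk_min_fin : exists2 m : R, 0 <= m & quadk_min = m%:E.
Proof.
have ge0 : (0 <= quadk_min)%E.
  by apply: le_ereal_inf_tmp => _ [mu mu1 <-]; exact: quadk_ge0.
have s0 : [:: (0 : R)] != [::] by [].
have sI p : p \in [:: (0 : R)] -> I01 p by rewrite inE => /eqP ->; exact: I010.
have := quadk_min_le_seq s0 sI.
move: ge0; case: quadk_min => // m m0 _.
by exists m => //; rewrite -lee_fin.
Qed.

Lemma quadk_min_seq (m eps : R) : quadk_min = m%:E -> 0 < eps ->
  exists s, [/\ s != [::], forall p, p \in s -> I01 p & quad_seq k s <= m + eps].
Proof.
move=> mE eps0; have eps20 : 0 < eps / 2 by rewrite divr_gt0.
have fin : quadk_min \is a fin_num by rewrite mE.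
have [_ [mu mu1 <-]] := lb_ereal_inf_adherent eps20 fin.
rewrite -/quadk_min mE quadk_fin// -EFinD lte_fin => h.
have [s [s0 sI [hs _]]] := quad_seq_approx mu1 eps20.
by exists s; split => //; lra.
Qed.

Let sum_mix s n N u (F : R -> R) :
  \sum_(p <- flatten (nseq N s) ++ nseq n u) F p = N%:R * \sum_(p <- s) F p + n%:R * F u.
Proof.
rewrite big_cat/=; congr (_ + _).
  elim: N => [|N IH]; first by rewrite /= big_nil mul0r.
  by rewrite /= big_cat/= IH -natr1 mulrDl mul1r addrC.
by rewrite big_nseq iter_addr addr0 mulr_natl.
Qed.

(* Moving a small mass of a nearly minimal configuration to [u] cannot lower its energy. *)
Lemma quadk_min_equilibrium (m eps : R) : quadk_min = m%:E -> 0 < eps ->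
  exists s, [/\ s != [::], forall p, p \in s -> I01 p, quad_seq k s <= m + eps &
    forall u, I01 u -> m - eps <= (size s)%:R^-1 * \sum_(p <- s) k p u].
Proof.
move=> mE eps0.
have m0 : 0 <= m.
  by have [m' m'0] := quadk_min_fin; rewrite mE => -[->].
have [B B0 kB] := al2_bounded kL.
(* Moving mass of order [1 / N] has a second-order cost of order [N^-2]; the configuration must
   therefore be minimal up to [N^-2], and the resulting loss [(1 + B) / (2 N)] in the potential is
   at most [eps]. *)
pose N := (archi_bound ((1 + B) / eps)).+1.
have N0 : 0 < N%:R :> R by rewrite ltr0n.
have N1 : 1 <= N%:R :> R by rewrite ler1n.
have Neps : (1 + B) <= N%:R * eps.
  rewrite -ler_pdivrMr// ltW// (lt_le_trans (archi_boundP _))//.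
    by rewrite divr_ge0 ?addr_ge0// ltW.
  by rewrite ler_nat.
have eta0 : 0 < N%:R ^- 2 :> R by rewrite invr_gt0 exprn_gt0.
have [s [s0 sI hs]] := quadk_min_seq mE eta0.
set n := size s.
have n0' : (0 < n)%N by rewrite lt0n size_eq0.
have n0 : 0 < n%:R :> R by rewrite ltr0n.
exists s; split => //.
  rewrite (le_trans hs)// lerD2l -[leLHS]mul1r ler_pdivrMr ?exprn_gt0// expr2.
  by have := ltW eps0; nra.
move=> u Iu; set w := _ * _.
(* [N] copies of [s] and [n] copies of [u]: the equal-weight form of the mixture giving mass
   [1 / (N + 1)] to [u]. *)
pose s' := flatten (nseq N s) ++ nseq n u.
have size_s' : size s' = (N.+1 * n)%N.
  by rewrite size_cat size_flatten /shape map_nseq sumn_nseq size_nseq -/n mulnC mulSn addnC.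
have s'0 : s' != [::] by rewrite -size_eq0 size_s' muln_eq0 /= -lt0n.
have s'I p : p \in s' -> I01 p.
  rewrite mem_cat => /orP[/flattenP[t]|]; last by rewrite mem_nseq => /andP[_ /eqP ->].
  by rewrite mem_nseq => /andP[_ /eqP ->]; exact: sI.
have := quadk_min_le_seq s'0 s'I; rewrite mE lee_fin.
have kuu : k u u <= B by rewrite (le_trans (ler_norm _))// kB.
pose S := \sum_(p <- s) \sum_(r <- s) k p r.
pose W := \sum_(p <- s) k p u.
have SE : quad_seq k s = S / n%:R ^+ 2 by rewrite /quad_seq -/n mulrC.
have wE : w = W / n%:R by rewrite /w mulrC.
have -> : quad_seq k s' = (N%:R ^+ 2 * quad_seq k s + 2 * N%:R * w + k u u) / (N%:R + 1) ^+ 2.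
  rewrite /quad_seq size_s' sum_mix.
  under [X in _ * (_ * X + _)]eq_bigr do rewrite sum_mix.
  rewrite sum_mix big_split/= -!mulr_sumr.
  under [X in _ * (_ + _ * (_ * X + _))]eq_bigr do rewrite ksym.
  rewrite -/S -/W -/(quad_seq k s) SE wE natrM -natr1; field.
  by rewrite !gt_eqF// addr_gt0.
rewrite ler_pdivlMr ?exprn_gt0 ?addr_gt0// => h.
have h2 : N%:R ^+ 2 * quad_seq k s <= N%:R ^+ 2 * m + 1.
  rewrite (le_trans (ler_wpM2l _ hs)) ?sqr_ge0// mulrDr lerD2l mulfV//.
  by rewrite expf_neq0// gt_eqF.
have h3 : 2 * (N%:R * m) <= 2 * (N%:R * w) + 1 + B by nra.
have h4 : N%:R * (m - eps) <= N%:R * w by nra.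
by rewrite -(ler_pM2l N0).
Qed.

(** Compactness in Helly's style: a limit of quantile functions of a minimizing sequence is again
    monotone, and the energies converge because the Riemann error is uniform over monotone
    functions. *)
Lemma quadk_min_attained : exists2 mu, M1_01 mu & quadk k mu = quadk_min.
Proof.
have [m m0 mE] := quadk_min_fin.
have fin : quadk_min \is a fin_num by rewrite mE.
have ex j : exists muq : probability R R * (R -> R), [/\ M1_01 muq.1,
    {homo muq.2 : x y / x <= y}, law_of muq.2 muq.1 & fine (quadk k muq.1) <= m + j.+1%:R^-1].
  have j0 : 0 < j.+1%:R^-1 :> R by rewrite invr_gt0.
  have [_ [mu mu1 <-]] := lb_ereal_inf_adherent j0 fin.
  rewrite -/quadk_min mE quadk_fin// -EFinD lte_fin => /ltW h.
  by have [q qmono qmu] := quantile_law mu1; exists (mu, q).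
have [muq muqP] := choice ex.
pose q j := (muq j).2.
(* Along an ultrafilter the bounded sequences [q j x] converge for all real [x] simultaneously, with
   no subsequence to extract. *)
have [G [GU sFG]] := ultraFilterLemma (eventually_filter : ProperFilter \oo).
have GF : ProperFilter G by exact: ultra_proper.
have lim_q x : exists y : R, 0 <= y <= 1 /\ q j x @[j --> G] --> y.
  have [y [yI ycl]] : (`[0, 1]%classic `&` cluster (q j x @[j --> G])) !=set0.
    apply: segment_compact; apply: sFG; exists 0%N => // j _ /=; rewrite in_itv/=.
    by have [_ _ [_ h _] _] := muqP j; exact: h.
  exists y; split; first by move: yI; rewrite /= in_itv.
  move=> U yU; have [//|nG] := in_ultra_setVsetC (q ^~ x @^-1` U) GU.
  by have [z []] := ycl (~` U) U nG yU.
have [ql qlP] := choice lim_q.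
have qlmono : {homo ql : x y / x <= y}.
  move=> x y xy; have [_ cx] := qlP x; have [_ cy] := qlP y.
  rewrite -(cvg_lim _ cx)// -(cvg_lim _ cy)//; apply: ler_lim.
  - by apply/cvg_ex; exists (ql x).
  - by apply/cvg_ex; exists (ql y).
  - by apply: nearW => j; have [_ h _ _] := muqP j; exact: h.
have ql01 x : 0 <= ql x <= 1 by case: (qlP x).
have mql : measurable_fun setT ql by exact: nondecreasing_measurable.
have [mu mu1 qmu] := law_of_exists mql ql01.
exists mu => //; apply/eqP; rewrite eq_le; apply/andP; split; last first.
  by apply: ereal_inf_lbound; exists mu.
rewrite mE quadk_fin// lee_fin; apply/ler_addgt0Pr => e e0.
pose eps := e / 8; have eps0 : 0 < eps by rewrite divr_gt0.
have eps40 : 0 < eps / 4 by rewrite divr_gt0.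
have [L L0 HL] := kL eps40.
have [n n0 Hn] := Riemann_error eps0 L0.
have n0' : 0 < n%:R :> R by rewrite ltr0n.
pose del := eps / (2 * (L + 1)).
have del0 : 0 < del by rewrite divr_gt0// mulr_gt0// ltr_wpDl.
(* Closeness is needed only at the [n] nodes of the Riemann sum, hence at finitely many points. *)
have close : G [set j | forall i : 'I_n, `|q j (i%:R / n%:R) - ql (i%:R / n%:R)| < del].
  apply: filter_forall => i; have [_ /cvgrPdist_lt /(_ _ del0)] := qlP (i%:R / n%:R).
  by apply: filterS => j; rewrite distrC.
have big : G [set j | j.+1%:R^-1 < eps].
  apply: sFG; have : j.+1%:R^-1 @[j --> \oo] --> (0 : R) by exact: cvg_harmonic.
  move=> /cvgrPdist_lt /(_ _ eps0); apply: filterS => j.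
  by rewrite sub0r normrN ger0_norm.
have [j [/= jclose jbig]] := filter_ex (filterI close big).
have [mu1j qmonoj qmuj fj] := muqP j; rewrite -/(q j) in qmonoj qmuj.
have h1 := quadk_Riemann kL n0 qmu qlmono L0 HL.
have h2 := quadk_Riemann kL n0 qmuj qmonoj L0 HL.
have hn := Hn n (leqnn n).
have qI x : I01 (ql x) by exact/I01P/ql01.
have qjI x : I01 (q j x) by apply/I01P; case: qmuj.
have h3 : `|quad_seq k [seq ql (i%:R / n%:R) | i <- iota 0 n] -
            quad_seq k [seq q j (i%:R / n%:R) | i <- iota 0 n]| <= eps / 4 + L * (del + del).
  rewrite !quad_seq_map// -mulrBr -sumrB normrM ger0_norm ?invr_ge0// mulrC ler_pdivrMr//.
  rewrite (le_trans (ler_norm_sum _ _ _))//.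
  apply: (@le_trans _ _ (\sum_(i < n) (eps / 4 + L * (del + del)))); last first.
    by rewrite sumr_const card_ord mulr_natr.
  apply: ler_sum => a _; rewrite -mulrBr -sumrB normrM ger0_norm ?invr_ge0// mulrC ler_pdivrMr//.
  rewrite (le_trans (ler_norm_sum _ _ _))//.
  apply: (@le_trans _ _ (\sum_(i < n) (eps / 4 + L * (del + del)))); last first.
    by rewrite sumr_const card_ord mulr_natr.
  apply: ler_sum => b _; rewrite (le_trans (HL _ _ _ _ (qI _) (qjI _) (qI _) (qjI _)))//.
  by rewrite lerD2l ler_wpM2l// lerD// distrC ltW.
have h4 : L * (del + del) <= eps.
  have -> : L * (del + del) = eps * (L / (L + 1)).
    by rewrite /del; field; rewrite gt_eqF// ltr_wpDl.
  rewrite ler_piMr ?(ltW eps0)// ler_pdivrMr ?ltr_wpDl// mul1r lerDl//.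
move: (le_trans h1 hn) (le_trans h2 hn) h3; rewrite !ler_norml => /andP[_ a1] /andP[a2 _] /andP[_ a3].
have eE : e = 8 * eps by rewrite /eps; field.
move: fj jbig a1 a2 a3 h4 eps0; rewrite eE.
by move: (_ ^-1) (L * _) (quad_seq _ _) (quad_seq _ _) => *; lra.
Qed.

End minimal_energy.

(** * Large deviations of excursion probabilities *)

Section L2_algebra.
Context {R : realType} {dO : measure_display} {Omega : measurableType dO}.
Variable P : probability Omega R.
Implicit Types f g h : Omega -> R.

Definition L2 f := measurable_fun setT f /\ P.-integrable setT (EFin \o (fun w => f w ^+ 2)).

Definition inner f g := \int[P]_w (f w * g w).

Lemma L2_mul f g : L2 f -> L2 g -> P.-integrable setT (EFin \o (fun w => f w * g w)).
Proof.
move=> [mf If] [mg Ig].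
apply: (le_integrable _ _ _ (integrableD measurableT If Ig)) => //.
  by apply/measurable_EFinP; exact: measurable_funM.
move=> w _; rewrite /= lee_fin normrM [leRHS]ger0_norm ?addr_ge0 ?sqr_ge0//.
rewrite -[f w ^+ 2]real_normK ?num_real// -[g w ^+ 2]real_normK ?num_real//.
have : 0 <= (`|f w| - `|g w|) ^+ 2 by exact: sqr_ge0.
have : 0 <= `|f w| ^+ 2 by exact: sqr_ge0.
have : 0 <= `|g w| ^+ 2 by exact: sqr_ge0.
by rewrite sqrrB; lra.
Qed.

Lemma L2_add f g : L2 f -> L2 g -> L2 (fun w => f w + g w).
Proof.
move=> Lf Lg; split; first by apply: measurable_funD; [case: Lf|case: Lg].
have Ifg := integrableZl measurableT 2 (L2_mul Lf Lg).
have := integrableD measurableT (integrableD measurableT Lf.2 Lg.2) Ifg.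
congr (P.-integrable setT _); apply/funext => w.
apply: (@congr1 _ _ EFin (f w ^+ 2 + g w ^+ 2 + 2 * (f w * g w)) ((f w + g w) ^+ 2)).
by ring.
Qed.

Lemma L2_scale a f : L2 f -> L2 (fun w => a * f w).
Proof.
move=> [mf If]; split; first exact: measurable_funM.
have := integrableZl measurableT (a ^+ 2) If.
congr (P.-integrable setT _); apply/funext => w.
by apply: (@congr1 _ _ EFin (a ^+ 2 * f w ^+ 2) ((a * f w) ^+ 2)); rewrite exprMn.
Qed.

Lemma L2_sub f g : L2 f -> L2 g -> L2 (fun w => f w - g w).
Proof.
move=> Lf /(L2_scale (-1)) Lg; have := L2_add Lf Lg.
by congr L2; apply/funext => w; rewrite mulN1r.
Qed.

Lemma L2_cg f : centered_gaussian P f -> L2 f.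
Proof. by move=> gf; split; [exact: cg_measurable gf|exact: cg_sqr_integrable]. Qed.

Lemma innerC f g : inner f g = inner g f.
Proof. by apply: eq_Rintegral => w _; rewrite mulrC. Qed.

Lemma inner_addr f g h : L2 f -> L2 g -> L2 h ->
  inner f (fun w => g w + h w) = inner f g + inner f h.
Proof.
move=> Lf Lg Lh; rewrite /inner -(RintegralD measurableT (L2_mul Lf Lg) (L2_mul Lf Lh)).
by apply: eq_Rintegral => w _; rewrite mulrDr.
Qed.

Lemma inner_scaler a f g : L2 f -> L2 g -> inner f (fun w => a * g w) = a * inner f g.
Proof.
move=> Lf Lg; rewrite /inner -(RintegralZl _ measurableT (L2_mul Lf Lg)).
by apply: eq_Rintegral => w _; rewrite mulrCA.
Qed.

Lemma L2_0 : L2 (fun=> 0).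
Proof.
split; first exact: measurable_cst.
by apply: (@bounded_integrable _ _ _ P _ 0) => // w; rewrite expr0n normr0.
Qed.

Lemma L2_sum (I : eqType) (s : seq I) (c : I -> R) (g : I -> Omega -> R) :
  (forall i, i \in s -> L2 (g i)) -> L2 (fun w => \sum_(i <- s) c i * g i w).
Proof.
elim: s => [|i s IH] Lg.
  by rewrite (_ : (fun w => _) = (fun=> 0)); [exact: L2_0|apply/funext => w; rewrite big_nil].
rewrite (_ : (fun w => _) = (fun w => c i * g i w + \sum_(i <- s) c i * g i w)).
  apply: L2_add; first by apply/L2_scale/Lg; rewrite mem_head.
  by apply: IH => j js; apply: Lg; rewrite inE js orbT.
by apply/funext => w; rewrite big_cons.
Qed.

Lemma inner_sumr (I : eqType) (s : seq I) (c : I -> R) (g : I -> Omega -> R) f :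
  L2 f -> (forall i, i \in s -> L2 (g i)) ->
  inner f (fun w => \sum_(i <- s) c i * g i w) = \sum_(i <- s) c i * inner f (g i).
Proof.
move=> Lf; elim: s => [|i s IH] Lg.
  rewrite big_nil -[RHS](Rintegral_cstP P); apply: eq_Rintegral => w _.
  by rewrite big_nil mulr0.
have Lgi : L2 (g i) by apply: Lg; rewrite mem_head.
have Lgs j : j \in s -> L2 (g j) by move=> js; apply: Lg; rewrite inE js orbT.
rewrite big_cons -IH// -inner_scaler// -inner_addr//; last 2 first.
- exact: L2_scale.
- exact: L2_sum.
by apply: eq_Rintegral => w _; rewrite big_cons.
Qed.

Lemma inner_ge0 f : 0 <= inner f f.
Proof. by apply: Rintegral_ge0 => w _; rewrite -expr2 sqr_ge0. Qed.

Lemma inner_sqr f : inner f f = \int[P]_w (f w ^+ 2).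
Proof. by apply: eq_Rintegral => w _; rewrite expr2. Qed.

Lemma inner_add_sqr a f g : L2 f -> L2 g ->
  inner (fun w => f w + a * g w) (fun w => f w + a * g w) =
  inner f f + 2 * a * inner f g + a ^+ 2 * inner g g.
Proof.
move=> Lf Lg; have Lag := L2_scale a Lg; have Lfag := L2_add Lf Lag.
rewrite inner_addr// inner_scaler// !(innerC (fun w => f w + a * g w)).
by rewrite !inner_addr// !inner_scaler// (innerC g f); ring.
Qed.

(** Expansion of [0 <= |f + a g|^2] for [a = 1 / c] and [a = - 1 / c]. It replaces the
    Cauchy-Schwarz inequality without square roots; [c] balances a small factor against a bounded
    one. *)
Lemma inner_young c f g : 0 < c -> L2 f -> L2 g ->
  `|inner f g| <= (c * inner f f + c^-1 * inner g g) / 2.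
Proof.
move=> c0 Lf Lg.
have h a : a ^+ 2 = c^-1 ^+ 2 -> 0 <= c * (inner f f + 2 * a * inner f g + a ^+ 2 * inner g g).
  by move=> _; rewrite -inner_add_sqr// mulr_ge0 ?inner_ge0// ltW.
have h1 := h c^-1 erefl; have := h (- c^-1); rewrite sqrrN => /(_ erefl) h2.
have E (a : R) : c * (inner f f + 2 * a * inner f g + c^-1 ^+ 2 * inner g g) =
   c * inner f f + 2 * (c * a) * inner f g + c^-1 * inner g g.
  by field; rewrite gt_eqF.
rewrite E mulfV ?gt_eqF// in h1; rewrite E mulrN mulfV ?gt_eqF// in h2.
by rewrite ler_norml; apply/andP; split; lra.
Qed.

End L2_algebra.

Section covariance.
Context {R : realType} {d : nat} {dO : measure_display} {Omega : measurableType dO}.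
Variables (P : probability Omega R) (T : set 'rV[R]_d) (X : 'rV[R]_d -> Omega -> R).
Local Notation V := 'rV[R]_d.
Hypothesis gX : centered_gaussian_field P T X.

Lemma covE s t : cov P X s t = inner P (X s) (X t). Proof. by []. Qed.

Lemma covC s t : cov P X s t = cov P X t s. Proof. by rewrite !covE innerC. Qed.

Lemma L2_field t : T t -> L2 P (X t).
Proof. by move=> /(field_gaussian gX)/L2_cg. Qed.

Lemma L2_lin_comb s : points_in T s -> L2 P (lin_comb X s).
Proof. by move=> sT; apply/L2_cg/gX. Qed.

Lemma inner_lin_comb f s : L2 P f -> points_in T s ->
  inner P f (lin_comb X s) = \sum_(p <- s) p.2 * inner P f (X p.1).
Proof.
move=> Lf sT; rewrite -(inner_sumr (fun p => p.2) Lf)//.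
by move=> p ps; apply/L2_field/sT.
Qed.

Definition avg (s : seq V) : seq (V * R) := [seq (p, (size s)%:R^-1) | p <- s].

Definition quad_points (s : seq V) : R :=
  (size s)%:R ^- 2 * \sum_(p <- s) \sum_(r <- s) cov P X p r.

Lemma points_in_avg (s : seq V) : (forall p, p \in s -> T p) -> points_in T (avg s).
Proof. by move=> sT p /mapP[r rs ->]; exact: (sT r). Qed.

Lemma lin_comb_avg (s : seq V) w :
  lin_comb X (avg s) w = (size s)%:R^-1 * \sum_(p <- s) X p w.
Proof. by rewrite /lin_comb big_map mulr_sumr. Qed.

Lemma inner_avg f (s : seq V) : L2 P f -> (forall p, p \in s -> T p) ->
  inner P f (lin_comb X (avg s)) = (size s)%:R^-1 * \sum_(p <- s) inner P f (X p).
Proof.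
by move=> Lf sT; rewrite inner_lin_comb// ?big_map ?mulr_sumr//; exact: points_in_avg.
Qed.

Lemma inner_avg_avg (s : seq V) : (forall p, p \in s -> T p) ->
  inner P (lin_comb X (avg s)) (lin_comb X (avg s)) = quad_points s.
Proof.
move=> sT; have La := L2_lin_comb (points_in_avg sT).
rewrite inner_avg// /quad_points -exprVn expr2 -mulrA; congr (_ * _).
rewrite mulr_sumr big_seq [RHS]big_seq; apply: eq_bigr => p ps.
by rewrite innerC inner_avg//; exact/L2_field/sT.
Qed.

Hypothesis cT : compact T.
Hypothesis cX : forall w, {within T, continuous (fun t => X t w)}.
Hypothesis T0 : T !=set0.

(** Every [X t] is within distance 1 in [L2] of [X p] for some [p] in a finite net. *)
Lemma cov_diag_bounded : exists2 M, 0 < M & forall t, T t -> cov P X t t <= M.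
Proof.
have [eta eta0 H] := L2_modulus gX cT cX T0 ltr01.
have [s [sT sP]] := compact_finite_net cT eta0.
have [B B0 HB] : exists2 B : R, 0 < B & forall p, p \in s -> cov P X p p <= B.
  elim: s sT {sP} => [|p s IH] sT; first by exists 1.
  have [|B B0 HB] := IH; first by move=> q qs; apply: sT; rewrite inE qs orbT.
  exists (Num.max B (cov P X p p)); first by rewrite lt_max B0.
  move=> q; rewrite inE => /predU1P[->|/HB]; first by rewrite le_max lexx orbT.
  by rewrite le_max => ->.
exists (2 + 2 * B); first by rewrite addr_gt0// mulr_gt0.
move=> t Tt; have [p ps tp] := sP t Tt.
have Tp := sT p ps; have := H t p Tt Tp tp => h.
have Lt := L2_field Tt; have Lp := L2_field Tp.
have Ld := L2_sub Lt Lp.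
have -> : cov P X t t = inner P (fun w => (X t w - X p w) + 1 * X p w)
    (fun w => (X t w - X p w) + 1 * X p w).
  by apply: eq_Rintegral => w _; rewrite mul1r subrK.
rewrite inner_add_sqr//.
have := inner_young ltr01 Ld Lp; rewrite ler_norml => /andP[_].
rewrite invr1 !mul1r => hy.
have hd : inner P (fun w => X t w - X p w) (fun w => X t w - X p w) <= 1.
  by rewrite inner_sqr.
have := HB p ps; rewrite covE => hp.
by rewrite expr1n mulr1 mul1r; lra.
Qed.

Lemma cov_modulus (eps : R) : 0 < eps -> exists2 eta : R, 0 < eta &
  forall s s' t t', T s -> T s' -> T t -> T t' -> `|s - s'| < eta -> `|t - t'| < eta ->
    `|cov P X s t - cov P X s' t'| <= eps.
Proof.
move=> eps0; have [M M0 HM] := cov_diag_bounded.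
(* Balances Young's inequality: both [c * (eps / (2 c))] and [M / c] equal [eps / 2]. *)
pose c := 2 * M / eps.
have c0 : 0 < c by rewrite divr_gt0// mulr_gt0.
have del0 : 0 < eps / (2 * c) by rewrite divr_gt0// mulr_gt0.
have [eta eta0 H] := L2_modulus gX cT cX T0 del0.
have half s s' t : T s -> T s' -> T t -> `|s - s'| < eta ->
    `|inner P (X t) (fun w => X s w - X s' w)| <= eps / 2.
  move=> Ts Ts' Tt ss'.
  have Ld := L2_sub (L2_field Ts) (L2_field Ts').
  rewrite innerC (le_trans (inner_young c0 Ld (L2_field Tt)))//.
  have h1 : c * inner P (fun w => X s w - X s' w) (fun w => X s w - X s' w) <= eps / 2.
    rewrite inner_sqr (le_trans (ler_wpM2l (ltW c0) (H _ _ Ts Ts' ss')))//.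
    by rewrite le_eqVlt; apply/orP; left; apply/eqP; field; rewrite gt_eqF.
  have h2 : c^-1 * inner P (X t) (X t) <= eps / 2.
    rewrite (le_trans (ler_wpM2l _ (HM t Tt))) ?invr_ge0 ?(ltW c0)//.
    by rewrite le_eqVlt; apply/orP; left; apply/eqP; rewrite /c; field; rewrite !gt_eqF.
  lra.
exists eta => // s s' t t' Ts Ts' Tt Tt' ss' tt'.
have -> : cov P X s t - cov P X s' t' =
    inner P (X t) (fun w => X s w - X s' w) + inner P (X s') (fun w => X t w - X t' w).
  have L u : T u -> L2 P (fun w => -1 * X u w) by move=> Tu; apply/L2_scale/L2_field.
  have E a b : (fun w => X a w - X b w) = (fun w => X a w + -1 * X b w).
    by apply/funext => w; rewrite mulN1r.
  rewrite !E !inner_addr//; try exact: L2_field; try exact: L.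
  rewrite !inner_scaler; try exact: L2_field.
  by rewrite !covE (innerC P (X t) (X s)) (innerC P (X t) (X s')); ring.
rewrite (le_trans (ler_normD _ _))//.
have := half _ _ _ Ts Ts' Tt ss'; have := half _ _ _ Tt Tt' Ts' tt'; lra.
Qed.

Lemma cov_bounded : exists2 M, 0 < M & forall s t, T s -> T t -> `|cov P X s t| <= M.
Proof.
have [M M0 HM] := cov_diag_bounded; exists M => // s t Ts Tt.
have := inner_young ltr01 (L2_field Ts) (L2_field Tt); rewrite invr1 !mul1r.
have := HM s Ts; have := HM t Tt; rewrite !covE; lra.
Qed.

(** Small increments are covered by uniform continuity and absorbed in [eps]. If one increment is at
    least [e], the trivial bound [2 M] is at most [2 M / e] times that increment. *)
Lemma cov_path_almost_lipschitz (xi : R -> V) :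
  {within I01, continuous xi} -> xi @` I01 `<=` T ->
  almost_lipschitz2 (fun u v => cov P X (xi u) (xi v)).
Proof.
move=> cxi xiT eps eps0.
have xT u : I01 u -> T (xi u) by move=> Iu; apply: xiT; exists u.
have [M M0 HM] := cov_bounded.
have [eta eta0 H] := cov_modulus eps0.
have cI : compact (I01 : set R) by exact: segment_compact.
have [e e0 He] := @compact_unif_continuous R R V _ _ _ cI cxi eta0.
exists (2 * M / e); first by rewrite divr_ge0 ?mulr_ge0// ltW.
move=> u u' v v' Iu Iu' Iv Iv'.
have [ue|ue] := ltP `|u - u'| e; last first.
  apply: (@le_trans _ _ (2 * M)).
    by rewrite (le_trans (ler_normB _ _))// mulrDl mul1r lerD// HM//; exact: xT.
  apply: (@le_trans _ _ (2 * M / e * (`|u - u'| + `|v - v'|))); last by rewrite lerDr ltW.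
  rewrite mulrAC ler_pdivlMr// ler_pM2l ?mulr_gt0// (le_trans ue)// lerDl//.
have [ve|ve] := ltP `|v - v'| e; last first.
  apply: (@le_trans _ _ (2 * M)).
    by rewrite (le_trans (ler_normB _ _))// mulrDl mul1r lerD// HM//; exact: xT.
  apply: (@le_trans _ _ (2 * M / e * (`|u - u'| + `|v - v'|))); last by rewrite lerDr ltW.
  rewrite mulrAC ler_pdivlMr// ler_pM2l ?mulr_gt0// (le_trans ve)// lerDr//.
rewrite (le_trans (H _ _ _ _ _ _ _ _ _ _))//; try exact: xT; try exact: He.
by rewrite lerDl mulr_ge0 ?addr_ge0// divr_ge0 ?mulr_ge0// ltW.
Qed.

Lemma quad_seq_points (xi : R -> V) (s : seq R) :
  quad_seq (fun u v => cov P X (xi u) (xi v)) s = quad_points (map xi s).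
Proof.
rewrite /quad_seq /quad_points size_map big_map; congr (_ * _).
by apply: eq_bigr => p _; rewrite big_map.
Qed.

Lemma quad_points_ge0 (s : seq V) : (forall p, p \in s -> T p) -> 0 <= quad_points s.
Proof. by move=> sT; rewrite -inner_avg_avg// inner_ge0. Qed.

End covariance.

(** * Exponential upper bound for excursion probabilities *)

Section upper_bound.
Context {R : realType}.

Lemma exp_sqr_small (g M eps : R) : 0 < g -> 0 <= M -> 0 < eps ->
  exists2 U : R, 1 <= U & forall u, U <= u -> M * expR (- (g * u ^+ 2)) <= eps.
Proof.
move=> g0 M0 eps0; exists (1 + M / (eps * g)).
  by rewrite lerDl divr_ge0// mulr_ge0// ltW.
move=> u Uu.
have u1 : 1 <= u by apply: le_trans Uu; rewrite lerDl divr_ge0// mulr_ge0// ltW.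
have uu : u <= u ^+ 2 by rewrite expr2 ler_peMr// (le_trans ler01).
have gu : M <= eps * (g * u ^+ 2).
  rewrite mulrA mulrC -ler_pdivrMr ?mulr_gt0// (le_trans _ uu)//.
  by apply: le_trans Uu; rewrite lerDr.
rewrite expRN ler_pdivrMr ?expR_gt0// (le_trans gu)// ler_pM2l//.
by rewrite (le_trans _ (expR_ge1Dx _))// lerDr.
Qed.

Lemma union_bound {dO} {Omega : measurableType dO} (P : probability Omega R)
    (I : Type) (s : seq I) (E : I -> set Omega) (e : R) :
  (forall i, measurable (E i)) -> (forall i, P (E i) <= e%:E)%E ->
  measurable (\big[setU/set0]_(i <- s) E i) /\
  (P (\big[setU/set0]_(i <- s) E i) <= ((size s)%:R * e)%:E)%E.
Proof.
move=> mE PE; elim: s => [|i s [mU PU]].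
  by rewrite big_nil measure0 mul0r; split.
rewrite big_cons; split; first exact: measurableU.
apply: (le_trans (measureU2 _ (mE i) mU)).
by rewrite /= -natr1 mulrDl mul1r addrC EFinD leeD.
Qed.

Context {d : nat} {dO : measure_display} {Omega : measurableType dO}.
Variables (P : probability Omega R) (T : set 'rV[R]_d) (X : 'rV[R]_d -> Omega -> R).
Local Notation V := 'rV[R]_d.
Hypothesis gX : centered_gaussian_field P T X.
Hypothesis cT : compact T.
Hypothesis cX : forall w, {within T, continuous (fun t => X t w)}.
Hypothesis T0 : T !=set0.

(* The cells of a fine net visited by [S] determine up to an oscillation of the field
   whether [X > u] on [S]; only finitely many sets of cells are visited, and each is
   handled by a Chernoff bound for one average of the field. *)
Lemma excursion_upper_bound (FF : set (set V)) (q q' : R) : 0 < q -> q < q' ->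
  (forall S, FF S -> S `<=` T /\
     exists s : seq V, [/\ s != [::], forall p, p \in s -> S p & quad_points P X s <= q]) ->
  exists2 U : R, 0 < U & forall u, U <= u -> exists A : set Omega, [/\ measurable A,
    (P A <= (expR (- (u ^+ 2 / (2 * q'))))%:E)%E &
    [set w | exists2 S, FF S & forall t, S t -> u < X t w] `<=` A].
Proof.
move=> q0 qq' HF; have q'0 : 0 < q' by exact: lt_trans qq'.
pose rho := q / q'.
have rho0 : 0 < rho by rewrite divr_gt0.
have rho1 : rho < 1 by rewrite ltr_pdivrMr// mul1r.
(* The loss from oscillation must fit between [q] and [q']: [(1 - del)^2 >= (1 + rho) / 2], and
   [(1 + rho) / 2] times [1 / (2 q)] is [1 / (2 q') + gam]. The surplus [gam] then absorbs the
   number [M] of patterns. *)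
pose del := (1 - rho) / 4.
have del0 : 0 < del by rewrite divr_gt0// subr_gt0.
pose K := (2 * q')^-1 + 1.
have K0 : 0 < K by rewrite addr_gt0// invr_gt0 mulr_gt0.
have [eta [U0 [eta0 U00 Hosc]]] := oscillation_bound gX cT cX T0 del0 K0.
have eta20 : 0 < eta / 2 by rewrite divr_gt0.
have [net [netT netP]] := compact_finite_net cT eta20.
pose N := size net.
pose vis (S : set V) : {ffun 'I_N -> bool} :=
  [ffun i : 'I_N => `[< exists2 t, S t & `|t - nth 0 net i| < eta / 2 >]].
pose M : R := (size (enum {ffun 'I_N -> bool}))%:R.
pose gam := (1 - rho) / (4 * q).
have gam0 : 0 < gam by rewrite divr_gt0 ?subr_gt0// mulr_gt0.
have M0 : 0 <= M by rewrite /M.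
have half0 : 0 < 1 / 2 :> R by rewrite divr_gt0.
have [U1 U11 HU1] := exp_sqr_small ltr01 (ler01 : 0 <= 1 :> R) half0.
have [U2 U21 HU2] := exp_sqr_small gam0 M0 half0.
exists (Num.max U0 (Num.max U1 U2)); first by rewrite !lt_max U00.
move=> u; rewrite !ge_max => /andP[uU0 /andP[uU1 uU2]].
have u0 : 0 < u by rewrite (lt_le_trans U00).
have [Ao [mAo PAo HAo]] := Hosc u uU0.
pose e := expR (- (((1 - del) * u) ^+ 2 / (2 * q))).
(* One representative [S0] of each pattern [v] supplies the averaged points. Any other [S] with this
   pattern has a point within [eta] of each of them, so off [Ao] the field exceeds [(1 - del) u] at
   all points of the average. Patterns that do not occur get the empty event. *)
have HE (v : {ffun 'I_N -> bool}) : exists E : set Omega, [/\ measurable E, (P E <= e%:E)%E &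
    forall S w, FF S -> vis S = v -> ~ Ao w -> (forall t, S t -> u < X t w) -> E w].
  have [[S0 [FS0 visS0]]|none] := pselect (exists S, FF S /\ vis S = v); last first.
    exists set0; split => //; first by rewrite measure0 lee_fin expR_ge0.
    by move=> S w FS visS; exfalso; apply: none; exists S.
  have [S0T [s [s0 sS0 qs]]] := HF S0 FS0.
  have sT p : p \in s -> T p by move=> /sS0/S0T.
  have gs : centered_gaussian P (lin_comb X (avg s)) by apply: gX; exact: points_in_avg.
  exists [set w | (1 - del) * u <= lin_comb X (avg s) w]; split.
  - rewrite -[X in measurable X]setTI.
    have := cg_measurable gs measurableT (measurable_itv `[(1 - del) * u, +oo[).
    by congr measurable; congr setI; apply/seteqP; split => w /=; rewrite in_itv/= andbT.
  - apply: (cg_tail gs) => //.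
      by rewrite mulr_ge0 ?(ltW u0)// /del; lra.
    by rewrite -inner_sqr (inner_avg_avg gX)//.
  - move=> S w FS visS nAo Su /=.
    have ns : 0 < (size s)%:R :> R by rewrite ltr0n lt0n size_eq0.
    rewrite lin_comb_avg [_^-1 * _]mulrC ler_pdivlMr//.
    have -> : (1 - del) * u * (size s)%:R = \sum_(p <- s) ((1 - del) * u).
      by rewrite big_const_seq count_predT iter_addr addr0 mulr_natr.
    rewrite big_seq [leRHS]big_seq; apply: ler_sum => p ps.
    have [r rnet pr] := netP p (sT p ps).
    have ri : (index r net < N)%N by rewrite index_mem.
    have vr : vis S0 (Ordinal ri).
      by rewrite ffunE; apply/asboolP; exists p; [exact: sS0|rewrite /= nth_index].
    rewrite visS0 -visS ffunE in vr; move/asboolP: vr => [t St]; rewrite /= nth_index// => tr.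
    have tp : `|t - p| < eta.
      rewrite -(subrKA r) (le_lt_trans (ler_normD _ _))// [`|r - p|]distrC; lra.
    have Tt : T t by apply: (HF S FS).1.
    have := HAo w nAo t p Tt (sT p ps) tp; have := Su t St.
    have := ler_norm (X t w - X p w); lra.
have [E HEP] := choice HE.
have mE v : measurable (E v) by case: (HEP v).
have PE v : (P (E v) <= e%:E)%E by case: (HEP v).
have [mU PU] := union_bound (enum {ffun 'I_N -> bool}) mE PE.
exists (Ao `|` \big[setU/set0]_(v <- enum {ffun 'I_N -> bool}) E v); split.
- exact: measurableU.
- apply: (le_trans (measureU2 _ mAo mU)); apply: (le_trans (leeD PAo PU)).
  rewrite -EFinD lee_fin -/M.
  pose D := expR (- (u ^+ 2 / (2 * q'))); rewrite -/D; have -> : expR (- (K * u ^+ 2)) = D * expR (- (1 * u ^+ 2)).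
    by rewrite /D -expRD; congr expR; rewrite /K; field; rewrite gt_eqF.
  have D0 : 0 < D by exact: expR_gt0.
  have he : e <= D * expR (- (gam * u ^+ 2)).
    rewrite /e /D -expRD ler_expR -opprD lerN2.
    have -> : u ^+ 2 / (2 * q') + gam * u ^+ 2 = (1 + rho) / 2 * (u ^+ 2 / (2 * q)).
      by rewrite /gam /rho; field; rewrite !gt_eqF.
    rewrite exprMn -[_ ^+ 2 * _ / _]mulrA ler_wpM2r//; first by rewrite divr_ge0 ?sqr_ge0// mulr_ge0// ltW.
    have : 0 <= del ^+ 2 by exact: sqr_ge0.
    by rewrite sqrrB expr1n mul1r /del; lra.
  have h1 := HU1 u uU1; have h2 := HU2 u uU2; rewrite mul1r in h1.
  have h3 : M * e <= D * (M * expR (- (gam * u ^+ 2))).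
    by rewrite mulrCA ler_wpM2l.
  have h4 : D * expR (- (1 * u ^+ 2)) <= D * (1 / 2) by rewrite ler_pM2l.
  have h5 : D * (M * expR (- (gam * u ^+ 2))) <= D * (1 / 2) by rewrite ler_pM2l.
  lra.
- move=> w [S FS Su]; have [Aow|nAow] := pselect (Ao w); [by left|right].
  have [_ _ HS] := HEP (vis S).
  rewrite (big_rem (vis S))/= ?mem_enum//; left; exact: HS Su.
Qed.

End upper_bound.

Section Rintegral_sums.
Context {R : realType} {dO : measure_display} {Omega : measurableType dO}.
Variable mu : {measure set Omega -> \bar R}.

Lemma integrable_add2 (f g : Omega -> R) :
  mu.-integrable setT (EFin \o f) -> mu.-integrable setT (EFin \o g) ->
  mu.-integrable setT (EFin \o (fun w => f w + g w)).
Proof. by move=> If Ig; exact: (integrableD measurableT If Ig). Qed.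

Lemma Rintegral_seq_sum (I : eqType) (s : seq I) (f : I -> Omega -> R) :
  (forall i, i \in s -> mu.-integrable setT (EFin \o f i)) ->
  mu.-integrable setT (EFin \o (fun w => \sum_(i <- s) f i w)) /\
  \int[mu]_w (\sum_(i <- s) f i w) = \sum_(i <- s) \int[mu]_w f i w.
Proof.
elim: s => [|i s IH] If.
  have E : (fun w : Omega => \sum_(i <- [::]) f i w) = cst 0.
    by apply/funext => w; rewrite big_nil.
  by rewrite E big_nil; split; [exact: integrable0|rewrite /Rintegral integral0].
have Ifi : mu.-integrable setT (EFin \o f i) by apply: If; rewrite mem_head.
have [j js|Is Es] := IH; first by apply: If; rewrite inE js orbT.
have E : (fun w => \sum_(j <- i :: s) f j w) = (fun w => f i w + \sum_(j <- s) f j w).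
  by apply/funext => w; rewrite big_cons.
by rewrite E RintegralD// big_cons Es; split => //; exact: integrable_add2.
Qed.

End Rintegral_sums.

Lemma cg_expR_shift {R : realType} {dO : measure_display} {Omega : measurableType dO}
    (P : probability Omega R) (Z : Omega -> R) (c : R) : centered_gaussian P Z ->
  P.-integrable setT (EFin \o (fun w => expR (Z w + c))) /\
  \int[P]_w expR (Z w + c) = expR (inner P Z Z / 2 + c).
Proof.
move=> gZ; have IZ := cg_expR_integrable gZ 1.
have E : (fun w => expR (Z w + c)) = (fun w => expR c * expR (1 * Z w)).
  by apply/funext => w; rewrite mul1r expRD mulrC.
rewrite E; split; first exact: (integrableZl measurableT (expR c) IZ).
rewrite (RintegralZl _ measurableT IZ) (cg_mgf gZ) expr1n mul1r -expRD.
by rewrite inner_sqr addrC.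
Qed.

(** * Exponential lower bound by tilting *)

Section lower_bound.
Context {R : realType} {d : nat} {dO : measure_display} {Omega : measurableType dO}.
Variables (P : probability Omega R) (T : set 'rV[R]_d) (X : 'rV[R]_d -> Omega -> R).
Local Notation V := 'rV[R]_d.
Hypothesis gX : centered_gaussian_field P T X.
Hypothesis cT : compact T.
Hypothesis cX : forall w, {within T, continuous (fun t => X t w)}.
Hypothesis T0 : T !=set0.

(* Cameron-Martin tilting by [exp (u H - u^2 E H^2 / 2)]: under the tilted measure the
   field has mean [u w_H > u] on [S]; only exponential moments of linear combinations
   of the field are needed. *)
Lemma excursion_lower_bound (S : set V) (s : seq (V * R)) (del eps : R) :
  points_in T s -> compact S -> S `<=` T -> 0 < del -> 0 < eps ->
  (forall t, S t -> 1 + 3 * del <= inner P (lin_comb X s) (X t)) ->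
  exists2 U : R, 0 < U & forall u, U <= u -> exists B : set Omega, [/\ measurable B,
    ((expR (- (u ^+ 2 * (inner P (lin_comb X s) (lin_comb X s) / 2 + eps))))%:E <= P B)%E &
    B `<=` [set w | forall t, S t -> u < X t w]].
Proof.
move=> sT cS ST del0 eps0 wS; set H := lin_comb X s in wS *.
have gH : centered_gaussian P H by exact: gX.
have LH : L2 P H by exact: L2_cg.
set s2 := inner P H H.
have s20 : 0 <= s2 by exact: inner_ge0.
(* [L] is chosen so that the second moment of the tilting density is at most [exp (L u^2)] times
   [exp (- u^2)], with room to spare; [K = L + 1] makes [exp (L u^2) P A] small as well. *)
pose L := 2 * s2 + 1.
pose K := L + 1.
have K0 : 0 < K by rewrite /K /L; lra.
have [eta [U0 [eta0 U00 Hosc]]] := oscillation_bound gX cT cX T0 del0 K0.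
have [net [netS netP]] := compact_finite_net cS eta0.
have [M M0 HM] := cov_diag_bounded gX cT cX T0.
pose e1 := eps / 2; have e10 : 0 < e1 by rewrite divr_gt0.
(* Chernoff parameters under the tilted law: [kap] minimizes [- kap * del + kap^2 * M / 2], with
   minimum [- g1]; [kap'] ensures [kap' * s2 <= e1], which leaves the rate [g2] for [H]. *)
pose kap := del / M; have kap0 : 0 < kap by rewrite divr_gt0.
pose kap' := e1 / (s2 + 1); have kap'0 : 0 < kap' by rewrite divr_gt0// ltr_wpDl.
pose g1 := del ^+ 2 / (2 * M); have g10 : 0 < g1 by rewrite divr_gt0 ?exprn_gt0// mulr_gt0.
pose g2 := e1 * kap' / 2; have g20 : 0 < g2 by rewrite divr_gt0// mulr_gt0.
have e60 : 0 < 1 / 6 :> R by lra.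
have N0 : 0 <= (size net)%:R :> R by [].
have h20 : 0 < 1 / 2 :> R by lra.
have [U1 U11 HU1] := exp_sqr_small ltr01 (ler01 : 0 <= 1 :> R) e60.
have [U2 U21 HU2] := exp_sqr_small g10 N0 e60.
have [U3 U31 HU3] := exp_sqr_small g20 (ler01 : 0 <= 1 :> R) e60.
have [U4 U41 HU4] := exp_sqr_small e10 (ler01 : 0 <= 1 :> R) h20.
exists (Num.max U0 (Num.max U1 (Num.max U2 (Num.max U3 U4)))); first by rewrite !lt_max U00.
move=> u; rewrite !ge_max => /andP[uU0 /andP[uU1 /andP[uU2 /andP[uU3 uU4]]]].
have u0 : 0 < u by rewrite (lt_le_trans U00).
have [A [mA PA HA]] := Hosc u uU0.
(* The tilted mean on [S] is at least [(1 + 3 del) u]: one [del] is spent on fluctuations at the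
   net, one on oscillation, and one remains. The bound on [H] caps the tilting density on [B]. *)
pose good w := (forall p, p \in net -> (1 + 2 * del) * u <= X p w) /\ H w <= (s2 + e1) * u.
pose B := ~` A `&` [set w | good w].
have mge Z c : centered_gaussian P Z -> measurable [set w | c <= Z w].
  move=> gZ; rewrite -[X in measurable X]setTI.
  have := cg_measurable gZ measurableT (measurable_itv `[c, +oo[).
  by congr measurable; congr setI; apply/seteqP; split => w /=; rewrite in_itv/= andbT.
have mle Z c : centered_gaussian P Z -> measurable [set w | Z w <= c].
  move=> gZ; rewrite -[X in measurable X]setTI.
  have := cg_measurable gZ measurableT (measurable_itv `]-oo, c]).
  by congr measurable; congr setI; apply/seteqP; split => w /=; rewrite in_itv/=.
have mgood : measurable [set w | good w].
  have -> : [set w | good w] =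
     (\bigcap_(p in [set` net]) [set w | (1 + 2 * del) * u <= X p w]) `&`
     [set w | H w <= (s2 + e1) * u].
    by apply/seteqP; split => w [h1 h2]; split => //; exact: h1.
  apply: measurableI; last exact: mle.
  apply: fin_bigcap_measurable; first exact: finite_seq.
  by move=> p pnet; apply: mge; apply: (field_gaussian gX); exact/ST/netS.
have mB : measurable B by apply: measurableI => //; exact: measurableC.
exists B; split => //; last first.
  move=> w [nAw [gnet _]] t St.
  have [p pnet tp] := netP t St.
  have := HA w nAw t p (ST t St) (ST p (netS p pnet)) tp.
  rewrite ler_norml => /andP[h _]; have := gnet p pnet.
  have : 0 < del * u by rewrite mulr_gt0.
  lra.
pose a0 := - (u ^+ 2 * s2 / 2).
have gsc a : centered_gaussian P (fun w => a * H w).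
  have := gX (@points_in_scale _ _ T a s sT); congr centered_gaussian.
  by apply/funext => w; exact: lin_comb_scale.
have sc2 a : inner P (fun w => a * H w) (fun w => a * H w) = a ^+ 2 * s2.
  have La := L2_cg (gsc a).
  by rewrite inner_scaler// innerC inner_scaler// -/s2; ring.
have gcomb p : p \in net -> centered_gaussian P (fun w => u * H w + - (kap * u) * X p w).
  move=> pnet; have pT : points_in T [:: (p, - (kap * u))].
    by move=> r; rewrite inE => /eqP -> /=; exact/ST/netS.
  have := gX (points_in_cat (@points_in_scale _ _ T u s sT) pT); congr centered_gaussian.
  apply/funext => w; rewrite lin_comb_cat lin_comb_scale; congr (_ + _).
  by rewrite /lin_comb big_seq1.
have [ID ED] := cg_expR_shift a0 (gsc u).
pose c3 := a0 + kap * u * ((1 + 2 * del) * u).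
pose c4 := a0 - kap' * u * ((s2 + e1) * u).
pose t1 w := expR (u ^+ 2 * (s2 / 2 + e1)) * \1_B w.
pose t2 w := 1 / 2 * expR (2 * u * H w + (a0 - L * u ^+ 2)).
pose t2' w := 1 / 2 * expR (L * u ^+ 2 + a0) * \1_A w.
pose t3 w := \sum_(p <- net) expR ((u * H w + - (kap * u) * X p w) + c3).
pose t4 w := expR ((1 + kap') * u * H w + c4).
(* The change of measure is never formed. The density is bounded pointwise by terms for the
   successful event [B] ([t1]), for large oscillation ([t2], [t2']), for a low value at a net point
   ([t3]) and for large [H] ([t4]), and then integrated with respect to [P]. *)
have pointwise w : expR (u * H w + a0) <= t1 w + (t2 w + (t2' w + (t3 w + t4 w))).
  have t10 : 0 <= t1 w by rewrite mulr_ge0 ?expR_ge0.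
  have t20 : 0 <= t2 w by rewrite mulr_ge0 ?expR_ge0.
  have t2'0 : 0 <= t2' w by rewrite mulr_ge0 ?mulr_ge0 ?expR_ge0.
  have t30 : 0 <= t3 w by apply: sumr_ge0 => p _; exact: expR_ge0.
  have t40 : 0 <= t4 w by exact: expR_ge0.
  have [Aw|nAw] := pselect (A w).
    (* On [A] the inequality [x y <= (x^2 + y^2) / 2] separates the density from the indicator of
       [A], in place of the Cauchy-Schwarz inequality. *)
    suff : expR (u * H w + a0) <= t2 w + t2' w by lra.
    rewrite /t2' indicE mem_set// mulr1 /t2.
    pose x := expR (u * H w + (a0 / 2 - L * u ^+ 2 / 2)); pose y := expR (L * u ^+ 2 / 2 + a0 / 2).
    have -> : expR (u * H w + a0) = x * y by rewrite /x /y -expRD; congr expR; field.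
    have -> : expR (2 * u * H w + (a0 - L * u ^+ 2)) = x ^+ 2.
      by rewrite /x -expRM_natl; congr expR; field.
    have -> : expR (L * u ^+ 2 + a0) = y ^+ 2.
      by rewrite /y -expRM_natl; congr expR; field.
    have := sqr_ge0 (x - y); rewrite sqrrB; lra.
  have [gw|ngw] := pselect (good w).
    suff : expR (u * H w + a0) <= t1 w by lra.
    rewrite /t1 indicE (mem_set (conj nAw gw : B w)) mulr1 ler_expR.
    have := ler_wpM2l (ltW u0) gw.2; rewrite /a0; lra.
  have [Hw|Hw] := ltP ((s2 + e1) * u) (H w).
    suff : expR (u * H w + a0) <= t4 w by lra.
    rewrite /t4 ler_expR /c4.
    have : kap' * u * ((s2 + e1) * u) <= kap' * u * H w.
      by rewrite ler_wpM2l ?(ltW Hw)// mulr_ge0// ltW.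
    lra.
  have [p pnet pw] : exists2 p, p \in net & X p w < (1 + 2 * del) * u.
    apply: contrapT => nex; apply: ngw; split => // p pnet.
    by rewrite leNgt; apply/negP => pw; apply: nex; exists p.
  suff : expR (u * H w + a0) <= t3 w by lra.
  rewrite /t3 (big_rem p)//= (@le_trans _ _ (expR ((u * H w + - (kap * u) * X p w) + c3)))//.
    rewrite ler_expR /c3.
    have : kap * u * X p w <= kap * u * ((1 + 2 * del) * u).
      by rewrite ler_wpM2l ?(ltW pw)// mulr_ge0// ltW.
    lra.
  by rewrite lerDl; apply: sumr_ge0 => r _; exact: expR_ge0.
have IB : P.-integrable setT (EFin \o \1_B) by exact: integrable_indic.
have IA : P.-integrable setT (EFin \o \1_A) by exact: integrable_indic.
have I1 : P.-integrable setT (EFin \o t1).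
  exact: (integrableZl measurableT (expR (u ^+ 2 * (s2 / 2 + e1))) IB).
have E1 : \int[P]_w t1 w = expR (u ^+ 2 * (s2 / 2 + e1)) * fine (P B).
  rewrite (RintegralZl _ measurableT IB).
  by congr (_ * _); rewrite /Rintegral integral_indic// setIT.
have [I2a E2a] := cg_expR_shift (a0 - L * u ^+ 2) (gsc (2 * u)).
have I2 : P.-integrable setT (EFin \o t2).
  exact: (integrableZl measurableT (1 / 2) I2a).
have E2 : \int[P]_w t2 w <= 1 / 2 * expR (- (1 * u ^+ 2)).
  rewrite (RintegralZl _ measurableT I2a) E2a ler_pM2l// ler_expR sc2 /a0 /L.
  have : 0 <= u ^+ 2 * s2 by rewrite mulr_ge0 ?sqr_ge0.
  lra.
have I2' : P.-integrable setT (EFin \o t2').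
  exact: (integrableZl measurableT (1 / 2 * expR (L * u ^+ 2 + a0)) IA).
have E2' : \int[P]_w t2' w <= 1 / 2 * expR (- (1 * u ^+ 2)).
  rewrite (RintegralZl _ measurableT IA).
  have -> : \int[P]_w \1_A w = fine (P A) by rewrite /Rintegral integral_indic// setIT.
  have PA' : fine (P A) <= expR (- (K * u ^+ 2)).
    by rewrite -lee_fin fineK// fin_num_measure.
  rewrite -[leLHS]mulrA ler_pM2l// (le_trans (ler_wpM2l (expR_ge0 _) PA'))// -expRD ler_expR.
  have : 0 <= u ^+ 2 * s2 by rewrite mulr_ge0 ?sqr_ge0.
  rewrite /a0 /K; lra.
have I3p p : p \in net -> P.-integrable setT
    (EFin \o (fun w => expR ((u * H w + - (kap * u) * X p w) + c3))).
  by move=> pnet; case: (cg_expR_shift c3 (gcomb p pnet)).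
have [I3 E3] := Rintegral_seq_sum I3p.
have {}E3 : \int[P]_w t3 w <= (size net)%:R * expR (- (g1 * u ^+ 2)).
  rewrite E3.
  have -> : (size net)%:R * expR (- (g1 * u ^+ 2)) = \sum_(p <- net) expR (- (g1 * u ^+ 2)).
    by rewrite big_const_seq count_predT iter_addr addr0 mulr_natl.
  rewrite big_seq [leRHS]big_seq; apply: ler_sum => p pnet.
  have [_ ->] := cg_expR_shift c3 (gcomb p pnet).
  have Tp : T p by exact/ST/netS.
  have Lp : L2 P (X p) by exact: L2_field Tp.
  have Lu : L2 P (fun w => u * H w) by exact: L2_scale.
  rewrite inner_add_sqr// sc2 ler_expR (innerC P (fun w => u * H w)) inner_scaler// innerC.
  have hM := HM p Tp; rewrite covE in hM.
  have hw := wS p (netS p pnet).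
  set wp := inner P H (X p) in hw *; set Rp := inner P (X p) (X p) in hM *.
  have -> : (u ^+ 2 * s2 + 2 * - (kap * u) * (u * wp) + (- (kap * u)) ^+ 2 * Rp) / 2 + c3 =
     u ^+ 2 * (kap * (1 + 2 * del - wp) + kap ^+ 2 * Rp / 2).
    by rewrite /c3 /a0; field.
  have -> : - (g1 * u ^+ 2) = u ^+ 2 * (- g1) by rewrite mulrN mulrC.
  rewrite ler_wpM2l ?sqr_ge0//.
  have b1 : kap * (1 + 2 * del - wp) <= kap * - del by rewrite ler_pM2l//; lra.
  have b2 : kap ^+ 2 * Rp <= kap ^+ 2 * M by rewrite ler_wpM2l ?sqr_ge0.
  have b3 : kap ^+ 2 * M = kap * del by rewrite /kap; field; rewrite gt_eqF.
  have -> : g1 = kap * del / 2 by rewrite /g1 /kap; field; rewrite gt_eqF.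
  lra.
have [I4 E4a] := cg_expR_shift c4 (gsc ((1 + kap') * u)).
have E4 : \int[P]_w t4 w <= expR (- (g2 * u ^+ 2)).
  rewrite E4a sc2 ler_expR.
  have -> : ((1 + kap') * u) ^+ 2 * s2 / 2 + c4 = u ^+ 2 * (kap' * (kap' * s2 / 2 - e1)).
    by rewrite /c4 /a0; field.
  have -> : - (g2 * u ^+ 2) = u ^+ 2 * (kap' * - (e1 / 2)) by rewrite /g2; field.
  rewrite ler_wpM2l ?sqr_ge0// ler_pM2l//.
  suff : kap' * s2 <= e1 by lra.
  rewrite /kap' mulrAC ler_pdivrMr ?ltr_wpDl//.
  by rewrite ler_pM2l//; lra.
have I34 := integrable_add2 I3 I4.
have I234 := integrable_add2 I2' I34.
have I1234 := integrable_add2 I2 I234.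
have := le_Rintegral measurableT ID (integrable_add2 I1 I1234) (fun w _ => pointwise w).
rewrite ED sc2 (_ : u ^+ 2 * s2 / 2 + a0 = 0); last by rewrite /a0; ring.
rewrite expR0 (RintegralD measurableT I1 I1234) (RintegralD measurableT I2 I234).
rewrite (RintegralD measurableT I2' I34) (RintegralD measurableT I3 I4).
rewrite -/(Rintegral P setT t3) E1 => main.
have h1 := HU1 u uU1; have h2 := HU2 u uU2; have h3 := HU3 u uU3; have h4 := HU4 u uU4.
rewrite !mul1r in h1 h3 h4 E2 E2'.
have {}main : 1 <= expR (u ^+ 2 * (s2 / 2 + e1)) * fine (P B) + (\int[P]_w t2 w +
  (\int[P]_w t2' w + (\int[P]_w t3 w + \int[P]_w t4 w))) by exact: main.
set Q := expR (u ^+ 2 * (s2 / 2 + e1)) in main.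
have Q0 : 0 < Q by exact: expR_gt0.
(* The error terms contribute at most 1/6 for [t2] and [t2'] together and 1/6 for each of [t3] and
   [t4]; the remaining factor 1/2 is absorbed by [exp (- e1 u^2)]. *)
have QB : 2^-1 <= Q * fine (P B) by lra.
rewrite -[P B]fineK ?fin_num_measure// lee_fin -(ler_pM2l Q0) (le_trans _ QB)//.
rewrite (le_trans _ h4)// /Q -expRD ler_expR /e1.
by rewrite le_eqVlt; apply/orP; left; apply/eqP; field.
Qed.

End lower_bound.

(** * The variational formula *)

Section rates.
Context {R : realType}.
Implicit Types (m M eps c : R) (A Z : set (\bar R)).

Lemma einv0 : einv (0 : R)%:E = +oo%E.
Proof. by rewrite /einv eqxx. Qed.

Lemma einv_gt0 m : 0 < m -> einv m%:E = (m^-1)%:E.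
Proof. by move=> m0; rewrite /einv eqe gt_eqF. Qed.

Lemma le_einv m M : 0 <= m -> m <= M -> (einv M%:E <= einv m%:E)%E.
Proof.
move=> m0 mM; move: m0; rewrite [X in is_true X -> _]le_eqVlt => /orP[/eqP <-|m0]; first by rewrite einv0 leey.
by rewrite !einv_gt0 ?(lt_le_trans m0)// lee_fin lef_pV2 ?posrE// (lt_le_trans m0).
Qed.

Lemma inv_approx M eps : 0 < M -> 0 < eps ->
  exists r : R, [/\ 0 < r, r < M & forall m, r < m -> m^-1 <= M^-1 + eps].
Proof.
move=> M0 eps0; have S0 : 0 < M^-1 + eps by rewrite addr_gt0 ?invr_gt0.
exists (M^-1 + eps)^-1; rewrite invr_gt0; split => //.
  by rewrite -[ltRHS]invrK ltf_pV2 ?posrE ?invr_gt0// ltrDl.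
move=> m rm; rewrite -[leRHS]invrK lef_pV2 ?posrE ?invr_gt0 ?(ltW rm)//.
by rewrite (lt_trans _ rm)// invr_gt0.
Qed.

(** Applied with [A] the minimal energies of paths and [Z] the norms of admissible [H] or [h]. If
    the supremum is 0, the value is [+oo] and only the lower bound on [Z] has content. *)
Lemma ereal_inf_einv A Z M : ereal_sup A = M%:E -> 0 <= M ->
  (forall y, A y -> exists2 m, 0 <= m & y = m%:E) ->
  (forall z, Z z -> exists2 y, A y & (einv y <= z)%E) ->
  (forall m eps, A m%:E -> 0 < m -> 0 < eps -> exists2 z, Z z & (z <= (m^-1 + eps)%:E)%E) ->
  ereal_inf Z = einv M%:E.
Proof.
move=> AM M0 Afin Zge Zle; apply/eqP; rewrite eq_le; apply/andP; split; last first.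
  apply: le_ereal_inf_tmp => z /Zge[y Ay]; apply: le_trans; have [m m0 ym] := Afin y Ay.
  by rewrite ym le_einv// -lee_fin -ym -AM; exact: ereal_sup_ubound.
move: M0; rewrite [X in is_true X -> _]le_eqVlt => /orP[/eqP M0|M0]; first by rewrite -M0 einv0 leey.
rewrite einv_gt0//; apply/lee_addgt0Pr => eps eps0.
have [|r [r0 rM rP]] := inv_approx M0 (_ : 0 < eps / 2); first by rewrite divr_gt0.
have [|y Ay ry] := @ereal_sup_gt _ A r%:E; first by rewrite AM lte_fin.
have [m _ ym] := Afin y Ay; rewrite ym in Ay ry; rewrite lte_fin in ry.
have [|z Zz zle] := Zle m (eps / 2) Ay (lt_trans r0 ry); first by rewrite divr_gt0.
apply: (le_trans (ereal_inf_lbound Zz)); apply: (le_trans zle).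
by rewrite -EFinD lee_fin; have := rP m ry; lra.
Qed.

Lemma rate_le (f : R -> R) u c : 0 < u -> 0 <= f u ->
  f u <= expR (- (u ^+ 2 * c)) -> (rate f u <= (- c)%:E)%E.
Proof.
move=> u0 fu0 fu; have u20 : 0 < u ^+ 2 by rewrite exprn_gt0.
rewrite /rate /elog; case: ifPn => [_|fne].
  by rewrite gt0_muleNy ?leNye// lte_fin invr_gt0.
have {fne}fu0 : 0 < f u by rewrite lt_neqAle eq_sym fne.
rewrite -EFinM lee_fin mulrC ler_pdivrMr// -[leRHS]expRK ler_ln ?posrE ?expR_gt0//.
by rewrite mulNr [c * _]mulrC.
Qed.

Lemma rate_ge (f : R -> R) u c : 0 < u ->
  expR (- (u ^+ 2 * c)) <= f u -> ((- c)%:E <= rate f u)%E.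
Proof.
move=> u0 fu; have u20 : 0 < u ^+ 2 by rewrite exprn_gt0.
have fu0 : 0 < f u by rewrite (lt_le_trans _ fu)// expR_gt0.
rewrite /rate /elog gt_eqF// -EFinM lee_fin mulrC ler_pdivlMr// -[leLHS]expRK.
by rewrite ler_ln ?posrE ?expR_gt0// mulNr [c * _]mulrC.
Qed.

(** The upper estimate is uniform over all paths, with [q] slightly above the supremum [M]; the
    lower one uses a single path of energy close to [M]. For [M = 0] the limit is [-oo] and the
    upper estimate alone gives it. *)
Lemma rate_cvg (f : R -> \bar R) A M : ereal_sup A = M%:E -> 0 <= M ->
  (forall y, A y -> exists2 m, 0 <= m & y = m%:E) ->
  (forall q, M < q -> exists U : R, forall u, U <= u -> (f u <= (- (2 * q)^-1)%:E)%E) ->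
  (forall m eps, A m%:E -> 0 < m -> 0 < eps ->
    exists U : R, forall u, U <= u -> ((- (m^-1 / 2 + eps))%:E <= f u)%E) ->
  f u @[u --> +oo] --> (- (1 / 2)%:E * einv M%:E)%E.
Proof.
move=> AM M0 Afin fle fge; move: (M0); rewrite [X in is_true X -> _]le_eqVlt => /orP[/eqP M00|{}M0].
  rewrite -M00 einv0 -EFinN lt0_muley ?lte_fin; last by lra.
  apply/cvgeNyPle => B; pose q : R := (2 * (`|B| + 1))^-1.
  have B0 : 0 <= `|B| by [].
  have [|U HU] := fle q; first by rewrite -M00 invr_gt0; lra.
  near=> u.
  have uU : U <= u by near: u; apply: nbhs_pinfty_ge; exact: num_real.
  apply: (le_trans (HU u uU)).
  rewrite lee_fin /q invfM invrK.
  have : - B <= `|B| by rewrite ler_normr lexx orbT.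
  lra.
rewrite einv_gt0// -EFinN -EFinM.
have fbnd eps : 0 < eps -> \forall u \near +oo,
    ((- (1 / 2) * M^-1 - eps)%:E <= f u <= (- (1 / 2) * M^-1 + eps)%:E)%E.
  move=> eps0.
  have [r [r0 rM rP]] := inv_approx M0 eps0.
  have [|y Ay ry] := @ereal_sup_gt _ A r%:E; first by rewrite AM lte_fin.
  have [m _ ym] := Afin y Ay; rewrite ym in Ay ry; rewrite lte_fin in ry.
  have [|U1 HU1] := fge m (eps / 2) Ay (lt_trans r0 ry); first by rewrite divr_gt0.
  (* If [1 / M <= eps] the requirement on [q] is void; otherwise [q] is the inverse of
     [M^-1 - eps]. *)
  have [q Mq qle] : exists2 q, M < q & M^-1 - eps <= q^-1.
    have [h|h] := lerP (M^-1) (eps).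
      by exists (M + 1); rewrite ?ltrDl// (@le_trans _ _ 0) ?subr_le0// invr_ge0; lra.
    exists (M^-1 - eps)^-1; last by rewrite invrK.
    by rewrite -[ltLHS]invrK ltf_pV2 ?posrE ?invr_gt0 ?subr_gt0// gtrBl.
  have [U2 HU2] := fle q Mq.
  near=> u; apply/andP; split.
    apply: le_trans (HU1 u _); last by near: u; apply: nbhs_pinfty_ge; exact: num_real.
    by rewrite lee_fin; have := rP m ry; lra.
  apply: le_trans (HU2 u _) _; first by near: u; apply: nbhs_pinfty_ge; exact: num_real.
  by rewrite lee_fin invfM; lra.
apply/fine_cvgP; split.
  near=> u; have /andP[h1 h2] : ((- (1 / 2) * M^-1 - 1)%:E <= f u <= (- (1 / 2) * M^-1 + 1)%:E)%E.
    by near: u; exact: fbnd.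
  by rewrite fin_numE; apply/andP; split; apply/eqP => fE; move: h1 h2; rewrite fE ?leeNy_eq ?leye_eq.
apply/cvgrPdist_le => eps eps0; near=> u.
have /andP[h1 h2] : ((- (1 / 2) * M^-1 - eps)%:E <= f u <= (- (1 / 2) * M^-1 + eps)%:E)%E.
  by near: u; exact: fbnd.
rewrite /=; move: h1 h2; case: (f u) => [x| |] /=; rewrite ?leeNy_eq ?leye_eq// !lee_fin => h1 h2.
by rewrite ler_norml; apply/andP; split; lra.
Unshelve. all: end_near. Qed.

End rates.

Section energy_duality.
Context {R : realType}.
Variable k : R -> R -> R.
Hypothesis kL : almost_lipschitz2 k.
Hypothesis kpos : forall s : seq R, (forall p, p \in s -> I01 p) -> 0 <= quad_seq k s.
Hypothesis ksym : forall u v, k u v = k v u.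

(** By the equilibrium property the potential of a nearly minimal configuration is at least
    [m (1 - tau)] on the whole path. Scaling by [c = (1 + tau) / (m (1 - tau))] lifts it above
    [1 + tau], while the energy is at most [(1 + tau)^3 / (1 - tau)^2 / m], close to [1 / m]. *)
Lemma quadk_min_witness (m eps : R) : quadk_min k = m%:E -> 0 < m -> 0 < eps ->
  exists s (c del : R), [/\ s != [::], forall p, p \in s -> I01 p, 0 < del,
    c ^+ 2 * quad_seq k s <= m^-1 + eps &
    forall u, I01 u -> 1 + 3 * del <= c * ((size s)%:R^-1 * \sum_(p <- s) k p u)].
Proof.
move=> mE m0 eps0.
have [tau [tau0 tau4 taue]] : exists tau : R, [/\ 0 < tau, tau <= 1 / 4 & 12 * tau <= m * eps].
  exists (Num.min (1 / 4) (m * eps / 12)).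
  rewrite lt_min ge_min lexx divr_gt0//= divr_gt0 ?mulr_gt0//=; split => //.
  have : Num.min (1 / 4) (m * eps / 12) <= m * eps / 12 by rewrite ge_min lexx orbT.
  lra.
have [s [s0 sI sq su]] := quadk_min_equilibrium kL kpos ksym mE (mulr_gt0 m0 tau0).
have tau1 : 0 < 1 - tau by lra.
have d0 : 0 < m - m * tau by rewrite -[X in X - _]mulr1 -mulrBr mulr_gt0.
exists s, ((1 + tau) / (m - m * tau)), (tau / 3); split => //.
- by rewrite divr_gt0.
- apply: (le_trans (ler_wpM2l (sqr_ge0 _) sq)).
  have -> : ((1 + tau) / (m - m * tau)) ^+ 2 * (m + m * tau) =
     (1 + tau) ^+ 3 / (1 - tau) ^+ 2 / m.
    by field; rewrite (gt_eqF m0) (gt_eqF tau1) (gt_eqF d0).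
  have h : (1 + tau) ^+ 3 / (1 - tau) ^+ 2 <= 1 + 12 * tau.
    rewrite ler_pdivrMr ?exprn_gt0//; nra.
  rewrite ler_pdivrMr; last exact: m0.
  rewrite mulrDl mulVf ?gt_eqF// (le_trans h)// lerD2l (le_trans taue)//.
  by rewrite mulrC.
- move=> u Iu; have := su u Iu; set w := _ * _ => hw.
  rewrite mulrAC ler_pdivlMr//.
  have -> : 3 * (tau / 3) = tau by field.
  by rewrite ler_pM2l//; lra.
Qed.

(** The hypothesis is what [0 <= |H - lam Y|^2] yields for averages [Y]; it is shared by the
    probabilistic and the spectral version. The best choice is [lam = 1 / m]. If [m = 0], letting
    [lam] grow contradicts the finiteness of [z]. *)
Lemma einv_quadk_min_le (z m : R) : quadk_min k = m%:E -> 0 <= m ->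
  (forall s lam, s != [::] -> (forall p, p \in s -> I01 p) -> 0 <= lam ->
    2 * lam - lam ^+ 2 * quad_seq k s <= z) ->
  (einv m%:E <= z%:E)%E.
Proof.
move=> mE m0 H.
have {}H (lam e : R) : 0 <= lam -> 0 < e -> 2 * lam - lam ^+ 2 * (m + e) <= z.
  move=> lam0 e0; have [s [s0 sI sq]] := quadk_min_seq kL mE e0.
  apply: le_trans (H s lam s0 sI lam0).
  by rewrite lerD2l lerN2 ler_wpM2l ?sqr_ge0.
have [M0|M0] := eqVneq m 0.
  have z0 : 0 <= z by have := H 0 1 (lexx _) ltr01; rewrite expr0n /= !mul0r mulr0 subr0.
  have z1 : 0 < z + 1 by lra.
  have := H (z + 1) ((z + 1) ^- 2) (ltW z1); rewrite invr_gt0 exprn_gt0// => /(_ isT).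
  by rewrite M0 add0r divff ?expf_neq0 ?gt_eqF//; move=> h; exfalso; clear mE; lra.
have {}m0 : 0 < m by rewrite lt_neqAle eq_sym M0.
rewrite einv_gt0// lee_fin; apply/ler_addgt0Pr => e e0.
have := H m^-1 (m ^+ 2 * e); rewrite invr_ge0 ltW// mulr_gt0 ?exprn_gt0// => /(_ isT isT).
have -> : m^-1 ^+ 2 * (m + m ^+ 2 * e) = m^-1 + e by field.
by lra.
Qed.

End energy_duality.

(** * Energies, tilts and rates along paths *)

Section paths.
Context {R : realType} {d : nat} {dO : measure_display} {Omega : measurableType dO}.
Variables (P : probability Omega R) (T : set 'rV[R]_d) (X : 'rV[R]_d -> Omega -> R).
Local Notation V := 'rV[R]_d.
Hypothesis gX : centered_gaussian_field P T X.
Hypothesis cX : forall w, {within T, continuous (fun t => X t w)}.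

Definition pathk (xi : R -> V) (u v : R) := cov P X (xi u) (xi v).

Section one_path.
Variable xi : R -> V.
Hypothesis cxi : {within I01, continuous xi}.
Hypothesis xiT : xi @` I01 `<=` T.
Let S := xi @` I01.

(** The image of a path is a compact index set of its own. Restricting to it makes the results for
    compact index sets available also when [T] is the whole space. *)
Lemma gaussian_field_sub (T' : set V) : T' `<=` T -> centered_gaussian_field P T' X.
Proof. by move=> TT s sT; apply: gX => p ps; exact/TT/sT. Qed.

Lemma compact_path : compact S.
Proof. by apply: continuous_compact => //; exact: segment_compact. Qed.

Lemma path_neq0 : S !=set0.
Proof. by exists (xi 0); exists 0 => //; exact: I010. Qed.

Lemma path_continuous w : {within S, continuous (fun t => X t w)}.
Proof. exact: (continuous_subspaceW xiT (@cX w)). Qed.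

Lemma pathk_lipschitz : almost_lipschitz2 (pathk xi).
Proof.
apply: (cov_path_almost_lipschitz (gaussian_field_sub xiT) compact_path path_continuous) => //.
exact: path_neq0.
Qed.

Lemma pathk_ge0 (s : seq R) : (forall p, p \in s -> I01 p) -> 0 <= quad_seq (pathk xi) s.
Proof.
move=> sI; rewrite quad_seq_points; apply: (quad_points_ge0 gX).
by move=> p /mapP[q qs ->]; apply: xiT; exists q => //; exact: sI.
Qed.

Lemma pathk_sym u v : pathk xi u v = pathk xi v u.
Proof. exact: covC. Qed.

Lemma path_quad_min_fin : exists2 m : R, 0 <= m & quad_min (cov P X) xi = m%:E.
Proof. exact: (quadk_min_fin pathk_lipschitz pathk_ge0). Qed.

Lemma path_is_min_quad : is_min_quad (cov P X) xi.
Proof. exact: (quadk_min_attained pathk_lipschitz pathk_ge0). Qed.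

Lemma path_quad_min_le : (quad_min (cov P X) xi <= (cov P X (xi 0) (xi 0))%:E)%E.
Proof.
have := quadk_min_le_seq pathk_lipschitz (s := [:: 0 : R]) isT.
rewrite /quad_seq !big_seq1 /= expr1n invr1 mul1r; apply => p; rewrite inE => /eqP ->.
exact: I010.
Qed.

Lemma path_tilt_inner (s : seq R) c : (forall p, p \in s -> I01 p) ->
  exists s' : seq (V * R), [/\ points_in S s',
    inner P (lin_comb X s') (lin_comb X s') = c ^+ 2 * quad_seq (pathk xi) s &
    forall t, T t ->
      inner P (lin_comb X s') (X t) = c * ((size s)%:R^-1 * \sum_(p <- s) cov P X (xi p) t)].
Proof.
move=> sI; have sS p : p \in map xi s -> S p.
  by move=> /mapP[q qs ->]; exists q => //; exact: sI.
have sT p : p \in map xi s -> T p by move=> /sS/xiT.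
pose a := avg (map xi s).
have LA : L2 P (lin_comb X a) by apply: (L2_lin_comb gX); exact: points_in_avg.
exists [seq (p.1, c * p.2) | p <- a]; split.
- by apply: points_in_scale; exact: points_in_avg.
- rewrite (_ : lin_comb X _ = fun w => c * lin_comb X a w); last first.
    by apply/funext => w; exact: lin_comb_scale.
  rewrite inner_scaler//; last exact: L2_scale.
  rewrite innerC inner_scaler// (inner_avg_avg gX)// -quad_seq_points; ring.
- move=> t Tt; have Lt := L2_field gX Tt.
  rewrite (_ : lin_comb X _ = fun w => c * lin_comb X a w); last first.
    by apply/funext => w; exact: lin_comb_scale.
  rewrite innerC inner_scaler// (inner_avg gX)// size_map big_map.
  by congr (_ * (_ * _)); apply: eq_bigr => p _; rewrite innerC.
Qed.

Lemma path_tilt (m eps : R) : quad_min (cov P X) xi = m%:E -> 0 < m -> 0 < eps ->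
  exists (s : seq (V * R)) (del : R), [/\ points_in S s, 0 < del,
    inner P (lin_comb X s) (lin_comb X s) <= m^-1 + eps &
    forall t, S t -> 1 + 3 * del <= inner P (lin_comb X s) (X t)].
Proof.
move=> mE m0 eps0.
have [s [c [del [_ sI del0 sq su]]]] :=
  quadk_min_witness pathk_lipschitz pathk_ge0 pathk_sym mE m0 eps0.
have [s' [s'S E1 E2]] := path_tilt_inner c sI.
exists s', del; split => //; first by rewrite E1.
by move=> _ [u Iu <-]; rewrite E2; [exact: su|apply: xiT; exists u].
Qed.

Lemma path_rate_ge (E : R -> set Omega) (m eps : R) :
  quad_min (cov P X) xi = m%:E -> 0 < m -> 0 < eps ->
  (forall u, measurable (E u)) ->
  (forall u, [set w | forall v, I01 v -> u < X (xi v) w] `<=` E u) ->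
  exists U : R, forall u, U <= u ->
    ((- (m^-1 / 2 + eps))%:E <= rate (fun u => fine (P (E u))) u)%E.
Proof.
move=> mE m0 eps0 mE' HE.
have [s [del [sS del0 sle su]]] := path_tilt mE m0 eps0.
have eps20 : 0 < eps / 2 by rewrite divr_gt0.
have [U U0 HU] := excursion_lower_bound (gaussian_field_sub xiT) compact_path path_continuous
  path_neq0 sS compact_path (@subset_refl _ S) del0 eps20 su.
exists U => u Uu; have [B [mB PB BS]] := HU u Uu.
have u0 : 0 < u by exact: lt_le_trans Uu.
apply: rate_ge => //; rewrite -lee_fin fineK ?fin_num_measure//.
apply: (@le_trans _ _ (P B)); last first.
  apply: le_measure; rewrite ?inE//; apply: (subset_trans BS) => w h; apply: HE => v Iv.
  by apply: h; exists v.
apply: le_trans PB; rewrite lee_fin ler_expR lerN2 ler_wpM2l ?sqr_ge0//; lra.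
Qed.

Lemma einv_quad_min_le_norm (H : Omega -> R) (m : R) : L2 P H ->
  quad_min (cov P X) xi = m%:E -> 0 <= m ->
  (forall v, I01 v -> 1 <= inner P (X (xi v)) H) -> (einv m%:E <= (inner P H H)%:E)%E.
Proof.
move=> LH mE m0 wH; apply: (einv_quadk_min_le pathk_lipschitz mE m0) => s lam s0 sI lam0.
have sT p : p \in map xi s -> T p.
  by move=> /mapP[q qs ->]; apply: xiT; exists q => //; exact: sI.
have LA : L2 P (lin_comb X (avg (map xi s))).
  by apply: (L2_lin_comb gX); exact: points_in_avg.
(* The duality step: the average of the field over the sampled points pairs with [H] to at least
   1. *)
have := inner_ge0 P (fun w => H w + - lam * lin_comb X (avg (map xi s)) w).
rewrite inner_add_sqr// sqrrN (inner_avg_avg gX)// -quad_seq_points.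
suff : 1 <= inner P H (lin_comb X (avg (map xi s))) by rewrite -/(pathk xi); nra.
rewrite (inner_avg gX)// size_map big_map ler_pdivlMl; last by rewrite ltr0n lt0n size_eq0.
rewrite mulr1 -[leLHS]mulr_natl mulr1 -[leLHS]mulr1 mulr_natl.
rewrite -[leLHS]addr0 -iter_addr -count_predT -big_const_seq big_seq [leRHS]big_seq.
by apply: ler_sum => p ps; rewrite innerC; exact/wH/sI.
Qed.

End one_path.

Lemma path_quad_points_le (xi : R -> V) (M q : R) :
  {within I01, continuous xi} -> xi @` I01 `<=` T ->
  (quad_min (cov P X) xi <= M%:E)%E -> M < q ->
  exists s : seq V, [/\ s != [::], forall p, p \in s -> (xi @` I01) p & quad_points P X s <= q].
Proof.
move=> cxi xiT; have [m m0 mE] := path_quad_min_fin cxi xiT.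
rewrite mE lee_fin => mM Mq.
have eps0 : 0 < q - m by rewrite subr_gt0 (le_lt_trans mM).
have [s [s0 sI sq]] := quadk_min_seq (pathk_lipschitz cxi xiT) mE eps0.
exists (map xi s); split.
- by rewrite -size_eq0 size_map size_eq0.
- by move=> p /mapP[v vs ->]; exists v => //; exact: sI.
- by rewrite -quad_seq_points -/(pathk xi) (le_trans sq)// addrC subrK.
Qed.

Lemma L2_integral_sqr (H : Omega -> R) : L2 P H ->
  (\int[P]_w ((H w) ^+ 2)%:E)%E = (inner P H H)%:E.
Proof.
by move=> [_ IH]; rewrite inner_sqr /Rintegral fineK// integrable_fin_num.
Qed.

Lemma sq_integrable_L2 (H : Omega -> R) : sq_integrable P H <-> L2 P H.
Proof.
split=> [[mH IH]|[mH IH]]; split=> //.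
  apply/integrableP; split; first by apply/measurable_EFinP; exact: measurable_funX.
  by under eq_integral => w _ do rewrite /= ger0_norm ?sqr_ge0//.
by rewrite L2_integral_sqr// ltry.
Qed.

Lemma lin_comb_in_L (s : seq (V * R)) : points_in T s -> in_L P T X (lin_comb X s).
Proof.
move=> sT; split; first exact/sq_integrable_L2/(L2_lin_comb gX).
move=> eps eps0; exists s; split => //.
by under eq_integral => w _ do rewrite subrr expr0n; rewrite integral0 lte_fin.
Qed.

Section path_family.
Variable paths : set (R -> V).
Variable x0 : V.
Hypothesis pathsT : forall xi, paths xi ->
  [/\ {within I01, continuous xi}, xi @` I01 `<=` T & xi 0 = x0].
Hypothesis paths0 : paths !=set0.
Let A := [set quad_min (cov P X) xi | xi in paths].

(** The point mass at time 0 is a competitor in every minimum, so the common starting point [x0]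
    bounds all energies by its variance. *)
Lemma paths_sup : exists2 M : R, 0 <= M & ereal_sup A = M%:E.
Proof.
have ub : (ereal_sup A <= (cov P X x0 x0)%:E)%E.
  apply: ge_ereal_sup => _ [xi /pathsT[cxi xiT <-] <-]; exact: path_quad_min_le.
have lb : (0 <= ereal_sup A)%E.
  have [xi pxi] := paths0; have [cxi xiT _] := pathsT pxi.
  have [m m0 mE] := path_quad_min_fin cxi xiT.
  apply: (@le_trans _ _ m%:E); first by rewrite lee_fin.
  by apply: ereal_sup_ubound; exists xi.
by move: ub lb; case: (ereal_sup A) => [M| |]//=; exists M.
Qed.

Lemma paths_fin y : A y -> exists2 m : R, 0 <= m & y = m%:E.
Proof. by move=> [xi /pathsT[cxi xiT _] <-]; exact: path_quad_min_fin. Qed.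

Lemma paths_rate_cvg (E : R -> set Omega) :
  (forall u, E u = [set w | exists xi, paths xi /\ forall v, I01 v -> u < X (xi v) w]) ->
  (forall u, measurable (E u)) ->
  (forall M q : R, ereal_sup A = M%:E -> M < q -> exists2 U : R, 0 < U & forall u, U <= u ->
    exists B : set Omega, [/\ measurable B, (P B <= (expR (- (u ^+ 2 / (2 * q))))%:E)%E &
      E u `<=` B]) ->
  rate (fun u => fine (P (E u))) u @[u --> +oo] --> (- (1 / 2)%:E * einv (ereal_sup A))%E.
Proof.
move=> EE mE up; have [M M0 ME] := paths_sup; rewrite ME.
apply: (rate_cvg ME M0 paths_fin) => [q Mq|m eps [xi pxi mxi] m0 eps0].
  have [U U0 HU] := up M q ME Mq; exists U => u Uu.
  have [B [mB PB EB]] := HU u Uu.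
  apply: rate_le; [exact: lt_le_trans Uu|exact: fine_ge0|].
  rewrite -lee_fin fineK ?fin_num_measure//; apply: le_trans PB.
  by apply: le_measure; rewrite ?inE.
have [cxi xiT _] := pathsT pxi; apply: path_rate_ge mxi m0 eps0 mE _ => // u w h.
by rewrite EE; exists xi.
Qed.

End path_family.

End paths.

Section compact_field.
Context {R : realType} {d : nat} {dO : measure_display} {Omega : measurableType dO}.
Variables (P : probability Omega R) (T : set 'rV[R]_d) (X : 'rV[R]_d -> Omega -> R).
Local Notation V := 'rV[R]_d.
Variables a b : V.
Hypothesis gX : centered_gaussian_field P T X.
Hypothesis cT : compact T.
Hypothesis cX : forall w, {within T, continuous (fun t => X t w)}.
Let paths := [set xi : R -> V | path_in T xi a b].
Hypothesis paths0 : paths !=set0.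
Let A := [set quad_min (cov P X) xi | xi in paths].

Let pathsT xi : paths xi -> [/\ {within I01, continuous xi}, xi @` I01 `<=` T & xi 0 = a].
Proof. by move=> [[cxi [xi0 _]] xiT]. Qed.

Lemma compact_excursion_le (M q : R) : ereal_sup A = M%:E -> M < q ->
  exists2 U : R, 0 < U & forall u, U <= u -> exists B : set Omega, [/\ measurable B,
    (P B <= (expR (- (u ^+ 2 / (2 * q))))%:E)%E & event_ab T X a b u `<=` B].
Proof.
move=> AM Mq.
have M0 : 0 <= M.
  have [M' M'0] := paths_sup gX cX pathsT paths0; rewrite -/A AM => -[->]; exact: M'0.
(* An intermediate level leaves room on both sides: near-minimal configurations below [q1], and the
   loss of the upper bound between [q1] and [q]. It is positive even if [M = 0]. *)
pose q1 := (M + q) / 2.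
have Mq1 : M < q1 by rewrite /q1; lra.
have q1q : q1 < q by rewrite /q1; lra.
have q10 : 0 < q1 by exact: le_lt_trans Mq1.
pose FF : set (set V) := [set S | exists2 xi, paths xi & S = xi @` I01].
have T0 : T !=set0.
  have [xi pxi] := paths0; have [_ xiT _] := pathsT pxi.
  by exists (xi 0); apply: xiT; exists 0 => //; exact: I010.
have [|U U0 HU] := excursion_upper_bound (FF := FF) gX cT cX T0 q10 q1q.
  move=> _ [xi pxi ->]; have [cxi xiT _] := pathsT pxi; split => //.
  apply: (path_quad_points_le gX cX cxi xiT _ Mq1).
  by rewrite -AM; apply: ereal_sup_ubound; exists xi.
exists U => // u Uu; have [B [mB PB HB]] := HU u Uu; exists B; split => //.
apply: subset_trans HB => w [xi [pxi h]]; exists (xi @` I01); first by exists xi.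
by move=> _ [v Iv <-]; exact: h.
Qed.

(** One inequality is duality against every admissible [H]. For the other, the near-optimal [H] is a
    finite average of field values, which lies in the closed span without any limit. *)
Lemma C_X_energy : C_X P T X a b = einv (ereal_sup A).
Proof.
have [M M0 ME] := paths_sup gX cX pathsT paths0; rewrite -/A in ME; rewrite ME.
apply: (ereal_inf_einv ME M0 (paths_fin gX cX pathsT)).
  move=> _ [H [[/sq_integrable_L2 LH _] [xi [pxi wH]]] <-].
  have [cxi xiT _] := pathsT pxi; have [m m0 mE] := path_quad_min_fin gX cX cxi xiT.
  exists m%:E; first by exists xi.
  rewrite L2_integral_sqr//; apply: (einv_quad_min_le_norm gX cX cxi xiT LH mE m0).
  by move=> v Iv; exact/ltW/wH.
move=> m eps [xi pxi mE] m0 eps0; have [cxi xiT _] := pathsT pxi.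
have [s [del [sS del0 sle sw]]] := path_tilt gX cX cxi xiT mE m0 eps0.
have sT : points_in T s by move=> p ps; exact/xiT/sS.
exists (inner P (lin_comb X s) (lin_comb X s))%:E; last by rewrite lee_fin.
exists (lin_comb X s); last by rewrite L2_integral_sqr//; exact: (L2_lin_comb gX).
split; first exact: lin_comb_in_L.
exists xi; split => // v Iv; have := sw (xi v); rewrite innerC => h.
have : 1 + 3 * del <= inner P (X (xi v)) (lin_comb X s) by apply: h; exists v.
by apply: lt_le_trans; rewrite ltrDl mulr_gt0.
Qed.

Theorem compact_field_large_deviations :
  (forall u, measurable (event_ab T X a b u)) ->
  [/\ rate (Psi_ab P T X a b) u @[u --> +oo] --> (- (1/2)%:E * C_X P T X a b)%E,
      C_X P T X a b = einv (ereal_sup A) &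
      forall xi, path_in T xi a b -> is_min_quad (cov P X) xi].
Proof.
move=> mE; split; last first.
- by move=> xi /pathsT[cxi xiT _]; exact: (path_is_min_quad gX cX).
- exact: C_X_energy.
rewrite C_X_energy; apply: (paths_rate_cvg gX cX pathsT paths0 (E := event_ab T X a b)) => //.
exact: compact_excursion_le.
Qed.

End compact_field.

(** * Stationary fields *)

Section spread.
Context {R : realType} {d : nat}.
Local Notation V := 'rV[R]_d.

Lemma compact_norm_ball (B : R) : compact [set t : V | `|t| <= B].
Proof.
apply: bounded_closed_compact.
  exists B; split; first exact: num_real.
  by move=> x Bx t /= tB; apply: le_trans tB (ltW Bx).
have -> : [set t : V | `|t| <= B] = (fun t => `|t|) @^-1` [set x | x <= B] by [].
apply: closed_comp; last exact: closed_le.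
by move=> t _; exact: norm_continuous.
Qed.

Lemma path_norm_value (xi : R -> V) (v y : R) : {within I01, continuous xi} ->
  xi 0 = 0 -> I01 v -> 0 <= y <= `|xi v| -> exists2 p, (xi @` I01) p & `|p| = y.
Proof.
move=> cxi xi0 /I01P/andP[v0 v1] /andP[y0 yv].
have sub : `[0, v] `<=` (@I01 R).
  move=> u; rewrite /= in_itv/= => /andP[u0 uv]; apply/I01P; rewrite u0/=; exact: le_trans v1.
have cn : {within `[0, v], continuous (fun u => `|xi u|)}.
  apply/within_continuousP => u uI eps eps0.
  have [del del0 H] := (within_continuousP _ _).1 (continuous_subspaceW sub cxi) u uI eps eps0.
  exists del => // u' u'I uu'; apply: le_lt_trans (H u' u'I uu'); exact: ler_dist_dist.
have [|c cI cy] := IVT v0 cn (v := y).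
  by rewrite xi0 normr0 min_l ?max_r// y0 yv.
by exists (xi c) => //; exists c => //; exact: sub.
Qed.

End spread.

Section stationary.
Context {R : realType} {d : nat} {dO : measure_display} {Omega : measurableType dO}.
Variables (P : probability Omega R) (X : 'rV[R]_d -> Omega -> R).
Local Notation V := 'rV[R]_d.
Variable a : V.
Hypothesis gX : centered_gaussian_field P setT X.
Hypothesis cX : forall w, continuous (fun t => X t w).
Hypothesis stat : forall s t h, cov P X (s + h) (t + h) = cov P X s t.
Let paths := [set xi : R -> V | is_path xi 0 a].

Lemma stationary_cov s t : cov P X s t = cov P X 0 (s - t).
Proof. by rewrite -(stat 0 (s - t) t) add0r subrK covC. Qed.

Lemma stationary_paths0 : paths !=set0.
Proof.
exists (fun v => v *: a); split; last by rewrite scale0r scale1r.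
by apply: continuous_subspaceT => v; exact: scalel_continuous.
Qed.

Lemma stationary_pathsT xi : paths xi ->
  [/\ {within I01, continuous xi}, xi @` I01 `<=` setT & xi 0 = 0].
Proof. by move=> [cxi [xi0 _]]. Qed.

Lemma stationary_within (T : set V) w : {within T, continuous (fun t => X t w)}.
Proof. by apply: continuous_subspaceT; exact: cX. Qed.

Hypothesis limR : forall eps : R, 0 < eps -> exists M : R, forall t : V,
  M < `|t| -> cov P X 0 t <= eps.

(* A path leaving a large ball meets the spheres of radii [0, D, 2 D, ...], hence contains
   many points at mutual distance at least [D], whose average has a small variance. *)
Lemma spread_quad_points (q : R) : 0 < q -> exists2 B : R, 0 <= B &
  forall (xi : R -> V) v, {within I01, continuous xi} -> xi 0 = 0 -> I01 v -> B < `|xi v| ->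
  exists s : seq V, [/\ s != [::], forall p, p \in s -> (xi @` I01) p /\ `|p| <= B &
    quad_points P X s <= q].
Proof.
move=> q0; set R0 := cov P X 0 0.
have R00 : 0 <= R0 by exact: inner_ge0.
have q20 : 0 < q / 2 by rewrite divr_gt0.
(* Points at mutual distance at least [D > M1] have covariance at most [q / 2]; [n] such points add
   the diagonal part [R0 / n], also at most [q / 2]. *)
have [M1 HM1] := limR q20.
pose D := `|M1| + 1.
have D0 : 0 < D by rewrite ltr_wpDl.
have M1D : M1 < D by rewrite (le_lt_trans (ler_norm _))// ltrDl.
have [n n0 nR] : exists2 n : nat, 0 < n%:R :> R & R0 / n%:R <= q / 2.
  exists (Num.trunc (R0 / (q / 2))).+1; first by rewrite ltr0n.
  rewrite ler_pdivrMr ?ltr0n// mulrC -ler_pdivrMr//; apply: ltW; exact: truncnS_gt.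
exists (n%:R * D) => [|xi v cxi xi0 Iv xiv]; first by rewrite mulr_ge0// ltW.
have [f fP] : exists f : nat -> V, forall k, (k < n)%N -> (xi @` I01) (f k) /\ `|f k| = k%:R * D.
  have /choice[f fP] : forall k, exists p, (k < n)%N -> (xi @` I01) p /\ `|p| = k%:R * D.
    move=> k; have [kn|_] := boolP (k < n)%N; last by exists 0.
    have [|p xp pE] := path_norm_value (y := k%:R * D) cxi xi0 Iv.
      rewrite mulr_ge0 ?(ltW D0)//= (le_trans _ (ltW xiv))// ler_pM2r// ler_nat; exact: ltnW.
    by exists p.
  by exists f.
exists (map f (iota 0 n)); split.
- by rewrite -size_eq0 size_map size_iota -lt0n -(ltr0n R).
- move=> p /mapP[k]; rewrite mem_iota add0n => /andP[_ kn] ->; have [fk nk] := fP k kn.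
  by split=> //; rewrite nk ler_pM2r// ler_nat ltnW.
rewrite /quad_points size_map size_iota big_map.
have row k : (k < n)%N ->
    \sum_(r <- map f (iota 0 n)) cov P X (f k) r <= R0 + n%:R * (q / 2).
  move=> kn; rewrite big_map.
  have -> : R0 + n%:R * (q / 2) = \sum_(l <- iota 0 n) ((if l == k then R0 else 0) + q / 2).
    rewrite big_split/= [X in _ = _ + X]big_const_seq count_predT size_iota iter_addr addr0.
    rewrite [n%:R * _]mulr_natl; congr (_ + _).
    rewrite -big_mkcond /= big_const_seq (_ : count _ _ = 1%N) /= ?addr0//.
    by rewrite (count_uniq_mem k (iota_uniq 0 n)) mem_iota kn.
  rewrite big_seq [leRHS]big_seq; apply: ler_sum => l; rewrite mem_iota add0n => /andP[_ ln].
  case: (eqVneq l k) => [->|lk].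
    by rewrite stationary_cov subrr lerDl ltW.
  rewrite add0r stationary_cov; apply: HM1; apply: (lt_le_trans M1D).
  have := lerB_dist (f k) (f l); have := lerB_dist (f l) (f k).
  rewrite [`|f l - _|]distrC (fP k kn).2 (fP l ln).2 -!mulrBl.
  have [lk'|kl'|/eqP] := ltngtP l k; last by rewrite (negbTE lk).
    move=> _; apply: le_trans; rewrite -natrB ?(ltnW lk')// ler_peMl ?(ltW D0)//.
    by rewrite ler1n subn_gt0.
  move=> h _; apply: le_trans h; rewrite -natrB ?(ltnW kl')// ler_peMl ?(ltW D0)//.
  by rewrite ler1n subn_gt0.
apply: (@le_trans _ _ (n%:R ^- 2 * \sum_(k <- iota 0 n) (R0 + n%:R * (q / 2)))).
  rewrite ler_pM2l ?invr_gt0 ?exprn_gt0// big_seq [leRHS]big_seq; apply: ler_sum => k.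
  by rewrite mem_iota => /andP[_ kn]; exact: row.
rewrite big_const_seq count_predT size_iota iter_addr addr0 -[X in _ * X]mulr_natl.
have -> : n%:R ^- 2 * (n%:R * (R0 + n%:R * (q / 2))) = R0 / n%:R + q / 2.
  by field; rewrite gt_eqF.
lra.
Qed.

Let A := [set quad_min (cov P X) xi | xi in paths].

(** The paths are cut to a ball [T], where the compact case applies to the parts [xi ([0, 1])]
    inside [T]. A path staying in [T] has a configuration from its minimal energy; one leaving [T]
    has the spread points, which lie in [T] too. Exceeding [u] on the whole path entails exceeding
    it on the part. *)
Lemma stationary_excursion_le (M q : R) : ereal_sup A = M%:E -> M < q ->
  exists2 U : R, 0 < U & forall u, U <= u -> exists B : set Omega, [/\ measurable B,
    (P B <= (expR (- (u ^+ 2 / (2 * q))))%:E)%E & event_a X a u `<=` B].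
Proof.
move=> AM Mq.
have M0 : 0 <= M.
  have [M' M'0] := paths_sup gX (stationary_within (T := setT)) stationary_pathsT stationary_paths0.
  by rewrite -/A AM => -[->].
pose q1 := (M + q) / 2.
have Mq1 : M < q1 by rewrite /q1; lra.
have q1q : q1 < q by rewrite /q1; lra.
have q10 : 0 < q1 by exact: le_lt_trans Mq1.
have [B B0 HB] := spread_quad_points q10.
pose T : set V := [set t | `|t| <= B].
pose FF : set (set V) := [set S | exists2 xi, paths xi & S = (xi @` I01) `&` T].
have T0 : T !=set0 by exists 0; rewrite /T /= normr0.
have gT : centered_gaussian_field P T X by apply: (gaussian_field_sub gX); exact: subsetT.
have [|U U0 HU] := excursion_upper_bound (FF := FF) gT (@compact_norm_ball R d B)
    (stationary_within (T := T)) T0 q10 q1q.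
  move=> _ [xi pxi ->]; have [cxi _ xi0] := stationary_pathsT pxi.
  split; first by move=> t [].
  have [xiT|/existsNP[t /not_implyP[[v Iv <-] vB]]] := pselect (xi @` I01 `<=` T).
    rewrite (setIidl xiT); apply: (path_quad_points_le gT (stationary_within (T := T)) cxi xiT _ Mq1).
    by rewrite -AM; apply: ereal_sup_ubound; exists xi.
  have [|s [s0 sP sq]] := HB xi v cxi xi0 Iv; first by rewrite ltNge; exact/negP.
  by exists s; split => // p ps; have [h1 h2] := sP p ps; split.
exists U => // u Uu; have [C [mC PC HC]] := HU u Uu; exists C; split => //.
apply: subset_trans HC => w [xi [pxi h]]; exists ((xi @` I01) `&` T); first by exists xi.
by move=> _ [[v Iv <-] _]; exact: h.
Qed.

End stationary.

(** * Spectral side of the stationary case *)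

Section spectral.
Context {R : realType} {d : nat}.
Local Notation V := 'rV[R]_d.

Lemma dotRB (s t x : V) : dotR (s - t) x = dotR s x - dotR t x.
Proof.
rewrite /dotR -sumrB; apply: eq_bigr => i _.
by rewrite !mxE mulrBl.
Qed.

Lemma dotRN (t x : V) : dotR t (- x) = - dotR t x.
Proof. by rewrite /dotR -sumrN; apply: eq_bigr => i _; rewrite !mxE mulrN. Qed.

Lemma continuous_borel_measurable (f : V -> R) : continuous f ->
  measurable_fun [set: @BorelV R d] f.
Proof.
move=> /continuousP cf; apply: (measurability _ (RGenOpens.measurableE R)).
move=> _ [_ [a [b ->] <-]]; rewrite setTI; apply: sub_sigma_algebra.
exact/cf/interval_open.
Qed.

Lemma dotR_measurable (t : V) : measurable_fun [set: @BorelV R d] (dotR t).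
Proof.
have mc i : measurable_fun [set: @BorelV R d] (fun x : V => t ord0 i * x ord0 i).
  have mx : measurable_fun [set: @BorelV R d] (fun x : V => x ord0 i).
    by apply: continuous_borel_measurable; exact: coord_continuous.
  by apply: measurable_funM.
exact: (measurable_sum _ mc).
Qed.

Lemma cos_dotR_measurable (t : V) : measurable_fun [set: @BorelV R d] (fun x => cos (dotR t x)).
Proof.
apply: (measurableT_comp _ (dotR_measurable t)).
by apply: continuous_measurable_fun; exact: continuous_cos.
Qed.

Lemma sin_dotR_measurable (t : V) : measurable_fun [set: @BorelV R d] (fun x => sin (dotR t x)).
Proof.
apply: (measurableT_comp _ (dotR_measurable t)).
by apply: continuous_measurable_fun; exact: continuous_sin.
Qed.

(** The squared modulus of [sum_p exp (i (p, x))] in real form. *)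
Lemma sum_cos_dotRB (s : seq V) (x : V) :
  \sum_(p <- s) \sum_(r <- s) cos (dotR (p - r) x) =
  (\sum_(p <- s) cos (dotR p x)) ^+ 2 + (\sum_(p <- s) sin (dotR p x)) ^+ 2.
Proof.
rewrite !expr2 !mulr_suml -big_split; apply: eq_bigr => p _ /=.
rewrite !mulr_sumr -big_split; apply: eq_bigr => r _ /=.
by rewrite dotRB cosB.
Qed.

Variable F : {finite_measure set (@BorelV R d) -> \bar R}.

Lemma integrable_cos_dotR (t : V) : F.-integrable setT (EFin \o (fun x => cos (dotR t x))).
Proof.
apply: (@bounded_integrable _ _ _ F _ 1) => [|x]; first exact: cos_dotR_measurable.
exact: cos_max.
Qed.

Lemma integrable_sin_dotR (t : V) : F.-integrable setT (EFin \o (fun x => sin (dotR t x))).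
Proof.
apply: (@bounded_integrable _ _ _ F _ 1) => [|x]; first exact: sin_dotR_measurable.
exact: sin_max.
Qed.

Lemma integral_EFin_Rintegral (f : BorelV -> R) : F.-integrable setT (EFin \o f) ->
  (\int[F]_x (f x)%:E)%E = (\int[F]_x f x)%:E.
Proof. by move=> If; rewrite /Rintegral fineK// integrable_fin_num. Qed.

Lemma integral_scaled_sum (I : eqType) (s : seq I) (c : R) (f : I -> BorelV -> R) :
  (forall i, F.-integrable setT (EFin \o f i)) ->
  F.-integrable setT (EFin \o (fun x => c * \sum_(i <- s) f i x)) /\
  \int[F]_x (c * \sum_(i <- s) f i x) = c * \sum_(i <- s) \int[F]_x f i x.
Proof.
move=> If; have [|I1 E1] := @Rintegral_seq_sum _ _ _ F _ s f; first by move=> i _; exact: If.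
split; first exact: (integrableZl measurableT c I1).
by rewrite (RintegralZl _ measurableT I1) E1.
Qed.

Variable rho : V -> R.
Hypothesis Frho : forall t : V,
  (rho t)%:E = (\int[F]_x (cos (dotR t x))%:E)%E /\ (\int[F]_x (sin (dotR t x))%:E)%E = 0%E.

Lemma Rintegral_cos_dotR t : \int[F]_x cos (dotR t x) = rho t.
Proof. by rewrite /Rintegral -(Frho t).1. Qed.

Lemma Rintegral_sin_dotR t : \int[F]_x sin (dotR t x) = 0.
Proof. by rewrite /Rintegral (Frho t).2. Qed.

Lemma integral_sum_cos_dotRB (s : seq V) :
  let f x := \sum_(p <- s) \sum_(r <- s) cos (dotR (p - r) x) in
  F.-integrable setT (EFin \o f) /\
  \int[F]_x f x = \sum_(p <- s) \sum_(r <- s) rho (p - r).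
Proof.
move=> f; have Irow p : F.-integrable setT (EFin \o (fun x => \sum_(r <- s) cos (dotR (p - r) x))) /\
    \int[F]_x (\sum_(r <- s) cos (dotR (p - r) x)) = \sum_(r <- s) rho (p - r).
  have [|I1 E1] := @Rintegral_seq_sum _ _ _ F _ s (fun r x => cos (dotR (p - r) x)).
    by move=> r _; exact: integrable_cos_dotR.
  by split=> //; rewrite E1; apply: eq_bigr => r _; exact: Rintegral_cos_dotR.
have [|I1 E1] := @Rintegral_seq_sum _ _ _ F _ s
    (fun p x => \sum_(r <- s) cos (dotR (p - r) x)).
  by move=> p _; case: (Irow p).
by split=> //; rewrite E1; apply: eq_bigr => p _; case: (Irow p).
Qed.

(* Expanding [int |h - (lam / n) sum_p exp (i (p, x))|^2 >= 0]. *)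
Lemma spec_norm_ge (hr hi : BorelV -> R) (s : seq V) (lam : R) :
  spec_admissible F hr hi -> s != [::] -> 0 <= lam ->
  (forall p, p \in s -> (1 < spec_re F hr hi p)%E) ->
  ((2 * lam - lam ^+ 2 * ((size s)%:R ^- 2 * \sum_(p <- s) \sum_(r <- s) rho (p - r)))%:E <=
    \int[F]_x ((hr x) ^+ 2 + (hi x) ^+ 2)%:E)%E.
Proof.
move=> [mhr [mhi [hfin _]]] s0 lam0 hs.
have n0 : 0 < (size s)%:R :> R by rewrite ltr0n lt0n size_eq0.
pose G x := hr x ^+ 2 + hi x ^+ 2.
have G0 x : 0 <= G x by rewrite addr_ge0 ?sqr_ge0.
have IG : F.-integrable setT (EFin \o G).
  apply/integrableP; split.
    by apply/measurable_EFinP; apply: measurable_funD; exact: measurable_funX.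
  by under eq_integral => x _ do rewrite /= ger0_norm//.
pose D p x := cos (dotR p x) * hr x + sin (dotR p x) * hi x.
have ID p : F.-integrable setT (EFin \o D p).
  have I1G : F.-integrable setT (EFin \o (fun x => 1 + G x)).
    by apply: integrable_add2 => //; exact: finite_measure_integrable_cst.
  apply: (le_integrable _ _ _ I1G) => //.
    apply/measurable_EFinP; apply: measurable_funD; apply: measurable_funM => //.
      exact: cos_dotR_measurable.
    exact: sin_dotR_measurable.
  move=> x _; rewrite /= lee_fin [leRHS]ger0_norm ?addr_ge0 ?sqr_ge0//.
  apply: (le_trans (ler_normD _ _)); rewrite !normrM.
  have h1 : `|cos (dotR p x)| * `|hr x| <= `|hr x| by rewrite ler_piMl// cos_max.
  have h2 : `|sin (dotR p x)| * `|hi x| <= `|hi x| by rewrite ler_piMl// sin_max.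
  rewrite /G -[hr x ^+ 2]real_normK ?num_real// -[hi x ^+ 2]real_normK ?num_real//.
  move: h1 h2 (sqr_ge0 (`|hr x| - 1 / 2)) (sqr_ge0 (`|hi x| - 1 / 2)); rewrite !sqrrB; lra.
(* The weight of each exponential in the average scaled by [lam]. *)
pose al := lam / (size s)%:R.
have [I1 E1] := @integral_scaled_sum _ s (- 2 * al) D ID.
have [I2' E2'] := integral_sum_cos_dotRB s.
have I2 := integrableZl measurableT (al ^+ 2) I2'.
have E2 := RintegralZl (al ^+ 2) measurableT I2'; rewrite E2' in E2.
have pos x : 0 <= G x + ((- 2 * al) * (\sum_(p <- s) D p x) +
    al ^+ 2 * (\sum_(p <- s) \sum_(r <- s) cos (dotR (p - r) x))).
  rewrite sum_cos_dotRB /D big_split /= -!mulr_suml /G.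
  set C := \sum_(p <- s) _; set S := \sum_(p <- s) sin _.
  have := addr_ge0 (sqr_ge0 (hr x - al * C)) (sqr_ge0 (hi x - al * S)).
  by congr (0 <= _); ring.
have := @Rintegral_ge0 _ _ _ F setT _ (fun x _ => pos x).
rewrite (RintegralD measurableT IG (integrable_add2 I1 I2)) (RintegralD measurableT I1 I2) E1 E2.
rewrite (integral_EFin_Rintegral IG) lee_fin.
set Q := \sum_(p <- s) \sum_(r <- s) _.
have -> : lam ^+ 2 * ((size s)%:R ^- 2 * Q) = al ^+ 2 * Q by rewrite /al; field; rewrite gt_eqF.
have : lam <= al * \sum_(i <- s) \int[F]_x D i x.
  have -> : lam = al * \sum_(i <- s) 1.
    by rewrite big_const_seq count_predT iter_addr addr0 /al divfK ?gt_eqF.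
  rewrite ler_wpM2l ?divr_ge0 ?(ltW n0)// big_seq [leRHS]big_seq; apply: ler_sum => p ps.
  have := hs p ps; rewrite /spec_re (integral_EFin_Rintegral (ID p)) lte_fin; exact: ltW.
by rewrite -[\int[F]_x G x]/(\int[F]_x G x); lra.
Qed.

(** Here [h] is [c * sum_p exp (i (p, x))], the spectral image of [c * sum_p X p]; its norm and its
    transform therefore reproduce the covariances of that combination. *)
Lemma spec_avg (s : seq V) (c : R) (hr := fun x : BorelV => c * \sum_(p <- s) cos (dotR p x))
    (hi := fun x : BorelV => c * \sum_(p <- s) sin (dotR p x)) :
  [/\ spec_admissible F hr hi,
    (\int[F]_x ((hr x) ^+ 2 + (hi x) ^+ 2)%:E)%E =
      (c ^+ 2 * \sum_(p <- s) \sum_(r <- s) rho (p - r))%:E,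
    forall t, spec_re F hr hi t = (c * \sum_(p <- s) rho (t - p))%:E &
    forall t, spec_im F hr hi t = 0%E].
Proof.
have [I2' E2'] := integral_sum_cos_dotRB s.
have I2 := integrableZl measurableT (c ^+ 2) I2'.
have E2 := RintegralZl (c ^+ 2) measurableT I2'; rewrite E2' in E2.
have EG : (\int[F]_x ((hr x) ^+ 2 + (hi x) ^+ 2)%:E)%E =
      (c ^+ 2 * \sum_(p <- s) \sum_(r <- s) rho (p - r))%:E.
  transitivity (\int[F]_x (c ^+ 2 * (\sum_(p <- s) \sum_(r <- s) cos (dotR (p - r) x)))%:E)%E.
    by apply: eq_integral => x _; congr EFin; rewrite sum_cos_dotRB /hr /hi; ring.
  by rewrite (integral_EFin_Rintegral I2) E2.
split.
- split; last split; last split; last split.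
  + apply: measurable_funM; first exact: measurable_cst.
    by apply: measurable_sum => p; exact: cos_dotR_measurable.
  + apply: measurable_funM; first exact: measurable_cst.
    by apply: measurable_sum => p; exact: sin_dotR_measurable.
  + by rewrite EG ltry.
  + by move=> x; congr (_ * _); apply: eq_bigr => p _; rewrite dotRN cosN.
  + move=> x; rewrite /hi -mulrN -sumrN; congr (_ * _).
    by apply: eq_bigr => p _; rewrite dotRN sinN.
- exact: EG.
- move=> t; rewrite /spec_re.
  have Ip p : F.-integrable setT (EFin \o (fun x => cos (dotR (t - p) x))).
    exact: integrable_cos_dotR.
  have [It Et] := integral_scaled_sum s c Ip.
  transitivity (\int[F]_x (c * (\sum_(p <- s) cos (dotR (t - p) x)))%:E)%E.
    apply: eq_integral => x _; congr EFin; rewrite /hr /hi mulrCA [sin _ * _]mulrCA -mulrDr.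
    congr (_ * _); rewrite !mulr_sumr -big_split; apply: eq_bigr => p _ /=.
    by rewrite dotRB cosB.
  rewrite (integral_EFin_Rintegral It) Et; congr (_ * _)%:E.
  by apply: eq_bigr => p _; exact: Rintegral_cos_dotR.
- move=> t; rewrite /spec_im.
  have Ip p : F.-integrable setT (EFin \o (fun x => sin (dotR (t - p) x))).
    exact: integrable_sin_dotR.
  have [It Et] := integral_scaled_sum s c Ip.
  transitivity (\int[F]_x (c * (\sum_(p <- s) sin (dotR (t - p) x)))%:E)%E.
    apply: eq_integral => x _; congr EFin; rewrite /hr /hi mulrCA [cos _ * _]mulrCA -mulrBr.
    congr (_ * _); rewrite !mulr_sumr -sumrB; apply: eq_bigr => p _ /=.
    by rewrite dotRB sinB.
  rewrite (integral_EFin_Rintegral It) Et big1 ?mulr0// => p _; exact: Rintegral_sin_dotR.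
Qed.

End spectral.

Section stationary_field.
Context {R : realType} {d : nat} {dO : measure_display} {Omega : measurableType dO}.
Variables (P : probability Omega R) (X : 'rV[R]_d -> Omega -> R).
Local Notation V := 'rV[R]_d.
Variables (a : V) (F : {finite_measure set (@BorelV R d) -> \bar R}).
Hypothesis gX : centered_gaussian_field P setT X.
Hypothesis cX : forall w, continuous (fun t => X t w).
Hypothesis stat : forall s t h, cov P X (s + h) (t + h) = cov P X s t.
Hypothesis limR : forall eps : R, 0 < eps -> exists M : R, forall t : V,
  M < `|t| -> cov P X 0 t <= eps.
Hypothesis Fcov : forall t : V,
  (cov P X 0 t)%:E = (\int[F]_x (cos (dotR t x))%:E)%E /\ (\int[F]_x (sin (dotR t x))%:E)%E = 0%E.
Let paths := [set xi : R -> V | is_path xi 0 a].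
Let A := [set quad_min (cov P X) xi | xi in paths].
Let cXT := stationary_within cX (T := setT).

(** The argument of the compact case carried out in [L^2(F)]: [spec_norm_ge] feeds the duality, and
    [spec_avg], with the weights of the energy witness, supplies near-optimal functions. *)
Lemma C_X_spec_energy : C_X_spec F a = einv (ereal_sup A).
Proof.
have [M M0 ME] := paths_sup gX cXT (@stationary_pathsT _ _ a) (stationary_paths0 a).
rewrite -/A in ME; rewrite ME.
apply: (ereal_inf_einv ME M0 (paths_fin gX cXT (@stationary_pathsT _ _ a))).
  move=> _ [hr [hi [adm [xi [pxi hxi]] ->]]].
  have [cxi xiT _] := stationary_pathsT pxi; have [m m0 mE] := path_quad_min_fin gX cXT cxi xiT.
  exists m%:E; first by exists xi.
  have zfin : (\int[F]_x ((hr x) ^+ 2 + (hi x) ^+ 2)%:E)%E \is a fin_num.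
    rewrite ge0_fin_numE; first exact: adm.2.2.1.
    by apply: integral_ge0 => x _; rewrite lee_fin addr_ge0 ?sqr_ge0.
  rewrite -(fineK zfin).
  apply: (einv_quadk_min_le (pathk_lipschitz gX cXT cxi xiT) mE m0) => s lam s0 sI lam0.
  rewrite -lee_fin (fineK zfin) quad_seq_points /quad_points.
  have -> : \sum_(p <- map xi s) \sum_(r <- map xi s) cov P X p r =
     \sum_(p <- map xi s) \sum_(r <- map xi s) cov P X 0 (p - r).
    by apply: eq_bigr => p _; apply: eq_bigr => r _; exact: stationary_cov.
  apply: (spec_norm_ge Fcov adm) => //; first by rewrite -size_eq0 size_map size_eq0.
  by move=> p /mapP[v vs ->]; exact: (hxi v (sI v vs)).1.
move=> m eps [xi pxi mE] m0 eps0; have [cxi xiT _] := stationary_pathsT pxi.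
have [s [c [del [s0 sI del0 sq su]]]] := quadk_min_witness (pathk_lipschitz gX cXT cxi xiT)
  (pathk_ge0 gX xiT) (pathk_sym P X xi) mE m0 eps0.
have [adm EG Ere Eim] := spec_avg Fcov (map xi s) (c / (size s)%:R).
exists (c ^+ 2 * quad_seq (pathk P X xi) s)%:E; last by rewrite lee_fin.
eexists; eexists; split; [exact: adm| |].
- exists xi; split => // v Iv; rewrite Ere Eim; split => //.
  rewrite lte_fin big_map; apply: (@lt_le_trans _ _ (1 + 3 * del)).
    by rewrite ltrDl mulr_gt0.
  apply: (le_trans (su v Iv)); rewrite mulrA le_eqVlt; apply/orP; left; apply/eqP; congr (_ * _).
  by apply: eq_bigr => p _; rewrite /pathk covC (stationary_cov stat).
- rewrite EG quad_seq_points /quad_points size_map.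
  have -> : \sum_(p <- map xi s) \sum_(r <- map xi s) cov P X p r =
     \sum_(p <- map xi s) \sum_(r <- map xi s) cov P X 0 (p - r).
    by apply: eq_bigr => p _; apply: eq_bigr => r _; exact: stationary_cov.
  by rewrite exprMn exprVn mulrA.
Qed.

Theorem stationary_field_large_deviations :
  (forall u, measurable (event_a X a u)) ->
  [/\ rate (Psi_a P X a) u @[u --> +oo] --> (- (1/2)%:E * C_X_spec F a)%E,
      C_X_spec F a =
        einv (ereal_sup [set quad_min (fun s t => cov P X 0 (s - t)) xi | xi in
                           [set xi | is_path xi 0 a]]) &
      forall xi, is_path xi 0 a -> is_min_quad (fun s t => cov P X 0 (s - t)) xi].
Proof.
have -> : (fun s t => cov P X 0 (s - t)) = cov P X.
  by apply/funext => s; apply/funext => t; rewrite [RHS](stationary_cov stat).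
move=> mE; split; last first.
- by move=> xi /stationary_pathsT[cxi xiT _]; exact: (path_is_min_quad gX cXT).
- exact: C_X_spec_energy.
rewrite C_X_spec_energy.
apply: (paths_rate_cvg gX cXT (@stationary_pathsT _ _ a) (stationary_paths0 a)
  (E := event_a X a)) => //.
exact: stationary_excursion_le.
Qed.

End stationary_field.

Unset Implicit Arguments.
Set Strict Implicit.

Theorem theorem3p2 :
  (* (i) compact index set T *)
  (forall (R : realType) (d : nat) (dO : measure_display)
     (Omega : measurableType dO) (P : probability Omega R)
     (T : set 'rV[R]_d) (X : 'rV[R]_d -> Omega -> R) (a b : 'rV[R]_d),
     compact T ->
     centered_gaussian_field P T X ->
     (forall w, {within T, continuous (fun t => X t w)}) ->
     a != b ->
     (exists xi, path_in T xi a b) ->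
     (forall u, measurable (event_ab T X a b u)) ->
     [/\ rate (Psi_ab P T X a b) u @[u --> +oo] --> (- (1/2)%:E * C_X P T X a b)%E,
         C_X P T X a b =
           einv (ereal_sup [set quad_min (cov P X) xi | xi in
                              [set xi | path_in T xi a b]]) &
         forall xi, path_in T xi a b -> is_min_quad (cov P X) xi]) /\
  (* (ii) stationary field on R^d *)
  (forall (R : realType) (d : nat) (dO : measure_display)
     (Omega : measurableType dO) (P : probability Omega R)
     (X : 'rV[R]_d -> Omega -> R) (a : 'rV[R]_d)
     (F : {finite_measure set (@BorelV R d) -> \bar R}),
     centered_gaussian_field P setT X ->
     (forall w, continuous (fun t => X t w)) ->
     (forall s t h, cov P X (s + h) (t + h) = cov P X s t) ->
     (forall eps : R, 0 < eps -> exists M : R, forall t : 'rV[R]_d,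
         M < `|t| -> cov P X 0 t <= eps) ->
     (forall t : 'rV[R]_d,
         (cov P X 0 t)%:E = (\int[F]_x (cos (dotR t x))%:E)%E /\
         (\int[F]_x (sin (dotR t x))%:E)%E = 0%E) ->
     a != 0 ->
     (forall u, measurable (event_a X a u)) ->
     [/\ rate (Psi_a P X a) u @[u --> +oo] --> (- (1/2)%:E * C_X_spec F a)%E,
         C_X_spec F a =
           einv (ereal_sup [set quad_min (fun s t => cov P X 0 (s - t)) xi | xi in
                              [set xi | is_path xi 0 a]]) &
         forall xi, is_path xi 0 a -> is_min_quad (fun s t => cov P X 0 (s - t)) xi]).
Proof.
split.
  move=> R d dO Omega P T X a b cT gX cX _ [xi pxi] mE.
  by apply: (compact_field_large_deviations gX cT cX _ mE); exists xi.
move=> R d dO Omega P X a F gX cX stat limR Fcov _ mE.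
exact: (stationary_field_large_deviations gX cX stat limR Fcov mE).
Qed.
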